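(* Let $X$ be a compact metric space, $r:X\to X$ Borel measurable with $0<\#r^{-1}(x)<\infty$ for all $x$, $\mu$ a strongly invariant Borel probability measure on $X$, and $m_0\in L^\infty(X,\mu)$ with $\frac{1}{\#r^{-1}(x)}\sum_{r(y)=x}|m_0(y)|^2=1$ for all $x$, and suppose $m_0$ is non-singular, i.e. $\mu(\{m_0=0\})=0$. Let $(\mathcal H,U,\pi,\varphi)$ be the realization on the solenoid described in the context. The following are equivalent: (i) the wavelet representation is irreducible, i.e. the only bounded operators on $\mathcal H$ commuting with $U$ and with all $\pi(f)$, $f\in L^\infty(X)$, are scalar multiples of the identity; (ii) the automorphism $r_\infty$ on $(X_\infty,\mu_\infty)$ is ergodic; (iii) the only bounded measurable fixed points of the transfer operator $R_{m_0}$ are the constants; (iv) there is no $p>1$ and no non-constant $h\in L^p(X,\mu)$ with $R_{m_0}h=h$ and $\sup_{n\in\mathbb N}\int_X|m_0^{(n)}(x)|^2|h(x)|^p\,d\mu(x)<\infty$, where $m_0^{(n)}(x)=m_0(x)m_0(r(x))\cdots m_0(r^{n-1}(x))$; (v) if $\varphi'\in\mathcal H$ satisfies $U\varphi'=\pi(m_0)\varphi'$, then $\varphi'$ is a constant multiple of $\varphi$.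
   Context: Strongly invariant: $\int f\,d\mu=\int\frac{1}{\#r^{-1}(x)}\sum_{r(y)=x}f(y)\,d\mu(x)$ for all $f\in C(X)$. Transfer operator: $R_{m_0}f(x)=\frac{1}{\#r^{-1}(x)}\sum_{r(y)=x}|m_0(y)|^2f(y)$. Solenoid: $X_\infty=\{(x_0,x_1,\dots)\in X^{\mathbb N}: r(x_{n+1})=x_n\ \forall n\}$ with the cylinder $\sigma$-algebra, $r_\infty(x_0,x_1,\dots)=(r(x_0),x_0,x_1,\dots)$, $\theta_0(x_0,x_1,\dots)=x_0$. With $W(x)=|m_0(x)|^2/\#r^{-1}(r(x))$, the path measure $P_x$ on $\Omega_x=\{(x_n)\in X_\infty: x_0=x\}$ is $P_x(\{x_1=z_1,\dots,x_n=z_n\})=W(z_1)\cdots W(z_n)$, and $\int f\,d\mu_\infty=\int_X\int_{\Omega_x}f\,dP_x\,d\mu(x)$. Then $\mathcal H=L^2(X_\infty,\mu_\infty)$, $Uf=(m_0\circ\theta_0)(f\circ r_\infty)$ (unitary), $\pi(f)g=(f\circ\theta_0)g$, $\varphi=1$; this is the wavelet representation associated to $m_0$. *)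

(* Defs.v *)
From HB Require Import structures.
From mathcomp Require Import all_boot all_order all_algebra.
From mathcomp Require Import all_classical all_reals all_analysis.
From mathcomp Require Import finmap complex.

Set Implicit Arguments.
Unset Strict Implicit.
Unset Printing Implicit Defensive.

Import Order.TTheory GRing.Theory Num.Theory.
Import numFieldNormedType.Exports.

Local Open Scope classical_set_scope.
Local Open Scope ring_scope.
Local Open Scope complex_scope.

Definition borel (X : ptopologicalType) := g_sigma_algebraType (@open X).

Section Defs.
Variable R : realType.
Local Notation C := R[i].

Section OnX.
Variable X : ptopologicalType.

Definition fibre (r : X -> X) (x : X) : set X := r @^-1` [set x].

Definition nfib (r : X -> X) (x : X) : nat := (#|` fset_set (fibre r x) |)%fset.

Definition strongly_invariant (r : X -> X) (mu : measure (borel X) R) :=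
  forall f : X -> R, continuous f ->
    (\int[mu]_x (f x)%:E =
     \int[mu]_x (((nfib r x)%:R)^-1 * \sum_(y \in fibre r x) f y)%:E)%E.

Definition cabs (z : C) : R := Num.sqrt (complex.Re z ^+ 2 + complex.Im z ^+ 2).
Definition sqn (z : C) : R := cabs z ^+ 2.

Definition transfer (r : X -> X) (m0 : X -> C) (h : X -> C) (x : X) : C :=
  ((nfib r x)%:R^-1)%:C * \sum_(y \in fibre r x) ((sqn (m0 y))%:C * h y).

Definition m0n (r : X -> X) (m0 : X -> C) (n : nat) (x : X) : C :=
  \prod_(k < n) m0 (iter k r x).

Definition Wt (r : X -> X) (m0 : X -> C) (x : X) : R :=
  sqn (m0 x) / (nfib r (r x))%:R.

End OnX.

Section FunSpaces.
Context {d : measure_display} {T : measurableType d}.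
Implicit Types (mu : measure T R) (f g : T -> C).

Definition cmeasurable f :=
  measurable_fun setT (fun x => complex.Re (f x)) /\
  measurable_fun setT (fun x => complex.Im (f x)).

Definition aeq mu f g := {ae mu, forall x, f x = g x}.

Definition ae_constant mu f := exists c : C, aeq mu f (fun=> c).

Definition Linf mu f :=
  cmeasurable f /\ exists M : R, {ae mu, forall x, cabs (f x) <= M}.

Definition Lp mu (p : R) f :=
  cmeasurable f /\ (\int[mu]_x ((cabs (f x)) `^ p)%:E < +oo)%E.

Definition L2 mu f :=
  cmeasurable f /\ (\int[mu]_x (sqn (f x))%:E < +oo)%E.

Definition L2normsq mu f : R := fine (\int[mu]_x (sqn (f x))%:E).

(* a bounded (linear) operator on the Hilbert space L^2(mu), represented as a
   map on representatives that preserves L^2, respects a.e. equality, is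
   linear up to a.e. equality and is norm-bounded *)
Definition bounded_op mu (Op : (T -> C) -> (T -> C)) :=
  [/\ (forall f, L2 mu f -> L2 mu (Op f)),
      (forall f g, L2 mu f -> L2 mu g -> aeq mu f g -> aeq mu (Op f) (Op g)),
      (forall (a : C) f g, L2 mu f -> L2 mu g ->
         aeq mu (Op (fun x => a * f x + g x)) (fun x => a * Op f x + Op g x)) &
      (exists M : R, forall f, L2 mu f -> L2normsq mu (Op f) <= M * L2normsq mu f)].

Definition ergodic mu (phi : T -> T) :=
  forall A, measurable A -> phi @^-1` A = A -> mu A = 0%E \/ mu A = 1%E.

End FunSpaces.

Section Solenoid.
Variable X : ptopologicalType.

Definition cyl_gen : set (set (nat -> X)) :=
  [set A | exists (n : nat) (B : set (borel X)), measurable B /\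
                                                  A = [set s | B (s n)]].

Definition seqspace := g_sigma_algebraType cyl_gen.

Definition in_solenoid (r : X -> X) (s : nat -> X) := forall n, r (s n.+1) = s n.

Definition rinf (r : X -> X) (s : seqspace) : seqspace :=
  fun n => if n is n'.+1 then s n' else r (s 0%N).

Definition theta0 (s : seqspace) : X := s 0%N.

(* sum over paths x = z_0 <- z_1 <- ... <- z_n (r z_{j+1} = z_j) of
   prod_j W(z_j) 1_{B_(k+j-1)}(z_j), j = 1..n: this is
   P_x(x_k in B_k, ..., x_(k+n-1) in B_(k+n-1)) shifted *)
Fixpoint pathw (r : X -> X) (W : X -> R) (B : nat -> set X) (n k : nat) (x : X)
    : R :=
  if n is n'.+1 then
    \sum_(y \in fibre r x) (W y * \1_(B k) y * pathw r W B n' k.+1 y)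
  else 1.

(* muinf is the measure mu_oo on the solenoid: it is carried by X_oo and
   mu_oo(x_0 in B_0, ..., x_n in B_n)
     = int_X 1_{B_0}(x) P_x(x_1 in B_1, ..., x_n in B_n) dmu(x),
   with P_x(x_1 = z_1, ..., x_n = z_n) = W(z_1) ... W(z_n). *)
Definition solenoid_measure (r : X -> X) (m0 : X -> C)
    (mu : measure (borel X) R) (muinf : measure seqspace R) :=
  {ae muinf, forall s, in_solenoid r s} /\
  forall (n : nat) (B : nat -> set X),
    (forall k, measurable (B k : set (borel X))) ->
    muinf [set s | forall k, (k <= n)%N -> B k (s k)] =
    (\int[mu]_x (\1_(B 0%N) x * pathw r (Wt r m0) B n 1 x)%:E)%E.

Definition Uop (r : X -> X) (m0 : X -> C) (f : seqspace -> C) : seqspace -> C :=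
  fun s => m0 (theta0 s) * f (rinf r s).

Definition piop (g : X -> C) (f : seqspace -> C) : seqspace -> C :=
  fun s => g (theta0 s) * f s.

Definition irreducible_wavelet (r : X -> X) (m0 : X -> C)
    (mu : measure (borel X) R) (muinf : measure seqspace R) :=
  forall Op : (seqspace -> C) -> (seqspace -> C),
    bounded_op muinf Op ->
    (forall f, L2 muinf f -> aeq muinf (Op (Uop r m0 f)) (Uop r m0 (Op f))) ->
    (forall g, Linf mu g -> forall f, L2 muinf f ->
       aeq muinf (Op (piop g f)) (piop g (Op f))) ->
    exists c : C, forall f, L2 muinf f -> aeq muinf (Op f) (fun s => c * f s).

End Solenoid.
End Defs.

(* Main.v *)
(* The measurability of the fibre averages Tf(x) = (1/#r^-1(x)) sum_{r(y)=x} f(y)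
   is the first point: for 0 <= f <= 1, the inner integrals of Tf and T(1-f) add
   up to 1 when f is continuous, by strong invariance, so that Tf agrees a.e. with
   a Borel function; a Dynkin class argument extends this and the invariance
   identity to all nonnegative Borel f. Hence all fixed point equations hold along
   almost every fibre and R_{m_0} acts on classes of functions.

   (i) => (ii): multiplication by 1_A commutes with U and pi when A is invariant.
   (ii) => (v): as m_0 <> 0 a.e., U phi = pi(m_0) phi says that phi is invariant
   under r_oo.
   (v) => (i): an operator commuting with U and pi commutes with multiplication by
   the indicators of all cylinders, hence of all measurable sets, so it is
   multiplication by the image of 1, which satisfies the equation in (v).
   (iii) => (ii): the conditional density of an invariant set given x_0 is a fixed
   point of R_{m_0}.
   (v) => (iii): if h is a bounded fixed point, h(x_n) is a bounded martingale; a
   subsequence converges a.e. to an r_oo-invariant function, with conditional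
   expectation h given x_0.
   (iv) => (iii): p = 2 bounds every bounded fixed point.
   (iii) => (iv): the positive part f of an L^p fixed point is subharmonic, and the
   integrals of its iterates g_n = R^n f are bounded by 1 + M. The limit t of the
   truncations min(g_n, k) is superharmonic and R^n t decreases to a bounded fixed
   point, i.e. a constant c <= 1 + M. As f <= R^n t + R^n (f - k)^+, and the second
   term has integral at most k^(1-p) M, letting n, then k, tend to infinity gives
   f <= 1 + M, so that the fixed point is bounded. *)
Require Import Defs.
From HB Require Import structures.
From mathcomp Require Import all_boot all_order all_algebra.
From mathcomp Require Import all_classical all_reals all_analysis.
From mathcomp Require Import measurable_realfun finmap complex.
From mathcomp Require Import ring lra.

Set Implicit Arguments.
Unset Strict Implicit.
Unset Printing Implicit Defensive.

Import Order.TTheory GRing.Theory Num.Theory.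
Import numFieldNormedType.Exports.

Local Open Scope classical_set_scope.
Local Open Scope ring_scope.

(** The isometry of U is the change of variables $\int |m_0(x_0)|^2 F(r_\infty s)\,d\mu_\infty =
    \int F\,d\mu_\infty$. It drives the inductions on coordinates: composing with $r_\infty$ turns
    $x_{n+1}$ into $x_n$, and the weight $|m_0(x_0)|^2$ is itself a function of $x_n$, because $x_0
    = r^n(x_n)$. Non-singularity of $m_0$ removes this weight when null sets are pulled back along
    $r_\infty$. In (v) => (iii) an a.e. limit of $h(x_{n_k})$ need not be invariant, since
    $r_\infty$ moves the index by one. The subsequence is chosen so that $h(x_{n_k})$ and
    $h(x_{n_k+1})$ have the same limit; orthogonality of martingale increments makes this possible
    and yields a.e. convergence directly. In (iii) => (iv) the obstacle is that truncating a fixed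
    point destroys the fixed point equation; a minimum with a constant only gives superharmonicity,
    hence the second limit. The exponent p > 1 enters as uniform integrability: the part of f above
    k has iterates of integral small in k, uniformly in n. *)

Section AlmostEverywhere.
Context {d : measure_display} {T : measurableType d} {R : realType}.
Variable mu : {measure set T -> \bar R}.
Implicit Types P Q S : T -> Prop.

Lemma aeS P Q : {ae mu, forall x, P x} -> (forall x, P x -> Q x) ->
  {ae mu, forall x, Q x}.
Proof. by move=> aP PQ; apply: filterS aP. Qed.

Lemma aeS2 P Q S : {ae mu, forall x, P x} -> {ae mu, forall x, Q x} ->
  (forall x, P x -> Q x -> S x) -> {ae mu, forall x, S x}.
Proof. by move=> aP aQ PQS; apply: filterS2 aP aQ. Qed.

Lemma aeS3 P Q S S' : {ae mu, forall x, P x} -> {ae mu, forall x, Q x} ->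
  {ae mu, forall x, S x} ->
  (forall x, P x -> Q x -> S x -> S' x) -> {ae mu, forall x, S' x}.
Proof. by move=> aP aQ aS PQS; apply: filterS3 aP aQ aS. Qed.

End AlmostEverywhere.

(** * Integrals of nonnegative real functions *)
Section RealIntegrals.
Context {d : measure_display} {T : measurableType d} {R : realType}.
Variable mu : {measure set T -> \bar R}.
Implicit Types f g : T -> R.

Import HBNNSimple.

(** [f] need not be measurable: its integral is the supremum over the simple functions below it. Cut
    to 0 on the null set [N], [g] keeps its integral and lies below [f] everywhere; conversely, a
    simple function below [f] is a.e. below [g]. *)
Lemma ge0_ae_integral_eq f g : (forall x, 0 <= f x) -> (forall x, 0 <= g x) ->
  measurable_fun setT g -> {ae mu, forall x, f x = g x} ->
  (\int[mu]_x (f x)%:E = \int[mu]_x (g x)%:E)%E.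
Proof.
move=> f0 g0 mg [N [mN N0 fgN]].
have gE : (\int[mu]_x (g x)%:E = \int[mu]_x (g x * \1_(~` N) x)%:E)%E.
  apply: ge0_ae_eq_integral => //.
  - exact/measurable_EFinP.
  - apply/measurable_EFinP/measurable_funM => //.
    exact/measurable_indic/measurableC.
  - by move=> x _; rewrite lee_fin.
  - by move=> x _; rewrite lee_fin mulr_ge0.
  - exists N; split => // x /= /not_implyP[_]; rewrite indicE.
    by case: (boolP (x \in ~` N)) => [|]; rewrite ?mulr1 // notin_setE /= => /contrapT.
apply/eqP; rewrite eq_le; apply/andP; split; last first.
  rewrite gE ge0_integralTE; last by move=> x; rewrite lee_fin mulr_ge0.
  rewrite [leRHS]ge0_integralTE; last by move=> x; rewrite lee_fin.
  apply: ge_ereal_sup => _ [h /= hg <-]; apply: ereal_sup_ubound; exists h => //= x.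
  apply: (le_trans (hg x)); rewrite lee_fin indicE.
  case: (boolP (x \in ~` N)) => [xN|_]; last by rewrite mulr0.
  rewrite mulr1; move: xN => /set_mem xN.
  suff -> : f x = g x by [].
  by apply: contrapT => fg; apply: xN; apply: fgN.
rewrite ge0_integralTE; last by move=> x; rewrite lee_fin.
apply: ge_ereal_sup => _ [h /= hf <-].
rewrite -integralT_nnsfun.
apply: ae_ge0_le_integral => //.
- by move=> x _; rewrite lee_fin.
- exact/measurable_EFinP.
- by move=> x _; rewrite lee_fin.
- exact/measurable_EFinP.
- exists N; split => // x /= /not_implyP[_] hg; apply: fgN => /= fg; apply: hg.
  by rewrite -fg.
Qed.

Lemma integral0_ae f : measurable_fun setT f -> (forall x, 0 <= f x) ->
  (\int[mu]_x (f x)%:E = 0)%E -> {ae mu, forall x, f x = 0}.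
Proof.
move=> mf f0 If.
have : (\int[mu]_x `|(f x)%:E| = 0)%E.
  by rewrite -If; apply: eq_integral => x _; rewrite gee0_abs ?lee_fin.
move/(ae_eq_integral_abs _ measurableT ((measurable_EFinP _ _).2 mf)).
by apply: filterS => x /= /(_ I) [].
Qed.

(* The Lebesgue integral of a nonmeasurable function is an inner integral, so
   the hypothesis says that the inner integrals of f and 1 - f add up to 1. *)
Lemma ae_measurable_of_inner f : mu setT = 1%E ->
  (forall x, 0 <= f x <= 1) ->
  (\int[mu]_x (f x)%:E + \int[mu]_x (1 - f x)%:E = 1)%E ->
  exists g, [/\ measurable_fun setT g, (forall x, 0 <= g x) &
                {ae mu, forall x, f x = g x}].
Proof.
move=> mu1 f01 If.
have f0 x : 0 <= f x by have /andP[] := f01 x.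
have f1 x : 0 <= 1 - f x by rewrite subr_ge0; have /andP[] := f01 x.
have fin (u : T -> R) (u' : T -> R): (forall x, 0 <= u x) -> (forall x, 0 <= u' x) ->
   (\int[mu]_x (u x)%:E + \int[mu]_x (u' x)%:E = 1)%E ->
   (\int[mu]_x (u x)%:E)%E \is a fin_num.
  move=> u0 u'0 Iu; rewrite ge0_fin_numE ?integral_ge0 //; last first.
    by move=> x _; rewrite lee_fin.
  rewrite (@le_lt_trans _ _ 1%E) ?ltry// -Iu leeDl// integral_ge0//.
  by move=> x _; rewrite lee_fin.
have approx (u : T -> R) (n : nat) : (forall x, 0 <= u x) ->
    (\int[mu]_x (u x)%:E)%E \is a fin_num ->
    exists h : {nnsfun T >-> R}, (forall x, h x <= u x) /\
      (\int[mu]_x (u x)%:E - (n.+1%:R^-1)%:E < \int[mu]_x (h x)%:E)%E.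
  move=> u0; rewrite ge0_integralTE; last by move=> x; rewrite lee_fin.
  move=> finu; have n0 : 0 < n.+1%:R^-1 :> R by rewrite invr_gt0.
  have [_ [h /= hu <-] uh] := ub_ereal_sup_adherent n0 finu.
  by exists h; split=> [x|]; [rewrite -lee_fin; exact: hu | rewrite integralT_nnsfun].
have [h hP] := choice (fun n => approx f n f0 (fin _ _ f0 f1 If)).
have finf' : (\int[mu]_x (1 - f x)%:E)%E \is a fin_num.
  by apply: (fin _ f) => //; rewrite addeC.
have [k kP] := choice (fun n => approx (fun x => 1 - f x) n f1 finf').
(* The simple functions [h n] below f and [k n] below 1 - f are within 1/(n+1) of the inner
   integrals. Each gap 1 - h_n - k_n dominates f - g and has integral less than 2/(n+1), so the
   infimum [q] of the gaps has integral 0. *)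
pose g x := sups (h ^~ x) 0.
have ubh x : has_ubound (range (h ^~ x)).
  by exists (f x) => _ [n _ <-]; apply: (hP n).1.
have lbk x : has_lbound (range (fun n => 1 - h n x - k n x)).
  exists 0 => _ [n _ <-].
  by have := (hP n).1 x; have := (kP n).1 x; lra.
pose q x := infs (fun n => 1 - h n x - k n x) 0.
have mg : measurable_fun setT g by apply: measurable_fun_sups.
have mhk n : measurable_fun setT (fun x => 1 - h n x - k n x).
  by apply: measurable_funB => //; apply: measurable_funB.
have mq : measurable_fun setT q by apply: measurable_fun_infs.
have hg n x : h n x <= g x.
  by apply: ub_le_sup; [apply: has_ubound_sdrop|exists n].
have gf x : g x <= f x.
  apply: ge_sup; first by exists (h 0%N x); exists 0%N.
  by move=> _ [n _ <-]; apply: (hP n).1.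
have qhk n x : q x <= 1 - h n x - k n x.
  apply: ge_inf; first exact: has_lbound_sdrop.
  by exists n.
have q0 x : 0 <= q x.
  apply: lb_le_inf; first by exists (1 - h 0%N x - k 0%N x); exists 0%N.
  by move=> _ [n _ <-]; have := (hP n).1 x; have := (kP n).1 x; lra.
have fgq x : f x - g x <= q x.
  apply: lb_le_inf; first by exists (1 - h 0%N x - k 0%N x); exists 0%N.
  by move=> _ [n _ <-]; have := (kP n).1 x; have := hg n x; lra.
have Iq : (\int[mu]_x (q x)%:E = 0)%E.
  apply/eqP; rewrite eq_le integral_ge0 ?andbT; last by move=> x _; rewrite lee_fin.
  apply/lee_addgt0Pr => e e0; rewrite add0e.
  have e20 : 0 < e / 2 by rewrite divr_gt0.
  near \oo => n.
  have [hf Ih] := hP n; have [kf Ik] := kP n.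
  have := lteD Ih Ik.
  have If1 := fin _ _ f0 f1 If.
  have If2 : (\int[mu]_x (1 - f x)%:E)%E \is a fin_num.
    by apply: (fin _ f) => //; rewrite addeC.
  have I1 : (\int[mu]_x (1 - h n x - k n x)%:E + \int[mu]_x (h n x)%:E
       + \int[mu]_x (k n x)%:E = 1)%E.
    rewrite -ge0_integralD//; last 4 first.
    - by move=> x _; rewrite lee_fin; have := hf x; have := kf x; lra.
    - exact/measurable_EFinP.
    - by move=> x _; rewrite lee_fin.
    - exact/measurable_EFinP.
    rewrite -ge0_integralD//; last 4 first.
    - move=> x _; rewrite -EFinD lee_fin; have := hf x; have := kf x.
      by have := f0 x; lra.
    - by apply: emeasurable_funD => //; exact/measurable_EFinP.
    - by move=> x _; rewrite lee_fin.
    - exact/measurable_EFinP.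
    rewrite -mu1 -[RHS]mul1e -integral_cst//; apply: eq_integral => x _.
    by rewrite -!EFinD; congr (_%:E); rewrite /=; lra.
  have fin3 (a b c : \bar R) : (0 <= a -> 0 <= b -> 0 <= c -> a + b + c = 1 ->
     [/\ a \is a fin_num, b \is a fin_num & c \is a fin_num])%E.
    by case: a b c => [a||] [b||] [c||].
  have [||| F1 F2 F3] := fin3 _ _ _ _ _ _ I1.
  - apply: integral_ge0 => x _; rewrite lee_fin; have := hf x; have := kf x; lra.
  - by apply: integral_ge0 => x _; rewrite lee_fin.
  - by apply: integral_ge0 => x _; rewrite lee_fin.
  have le1 : (\int[mu]_x (q x)%:E <= \int[mu]_x (1 - h n x - k n x)%:E)%E.
    apply: ge0_le_integral => //.
    - by move=> x _; rewrite lee_fin.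
    - exact/measurable_EFinP.
    - exact/measurable_EFinP.
    - by move=> x _; rewrite lee_fin.
  move=> lt; apply: (le_trans le1); move: If I1 lt.
  rewrite -(fineK If1) -(fineK If2) -(fineK F1) -(fineK F2) -(fineK F3).
  rewrite -!EFinB -!EFinD lte_fin lee_fin => -[E1] [E2] lt.
  have : n.+1%:R^-1 < e / 2.
    by near: n; exact: (near_infty_natSinv_lt (PosNum e20)).
  by move: (n.+1%:R^-1) lt => c; lra.
exists g; split => //.
- by move=> x; rewrite (le_trans _ (hg 0%N x)).
- have := integral0_ae mq q0 Iq; apply: filterS => x qx.
  by have := fgq x; have := gf x; rewrite qx; lra.
Unshelve. all: by end_near. Qed.

Lemma ge0_measurable_ind (P : (T -> R) -> Prop) :
  (forall A, measurable A -> P \1_A) ->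
  (forall a f g, 0 <= a -> measurable_fun setT f -> measurable_fun setT g ->
     (forall x, 0 <= f x) -> (forall x, 0 <= g x) ->
     P f -> P g -> P (fun x => a * f x + g x)) ->
  (forall (f_ : nat -> T -> R) f,
     (forall n, measurable_fun setT (f_ n)) -> measurable_fun setT f ->
     (forall n x, 0 <= f_ n x) -> (forall x, nondecreasing_seq (f_ ^~ x)) ->
     (forall x, f_ ^~ x @ \oo --> f x) -> (forall n, P (f_ n)) -> P f) ->
  forall f, measurable_fun setT f -> (forall x, 0 <= f x) -> P f.
Proof.
move=> Pind PD Plim f mf f0.
have mf' := (measurable_EFinP setT f).2 mf.
pose f_ n : T -> R := nnsfun_approx measurableT mf' n.
apply: (Plim f_) => //.
- by move=> x m n mn; have /lefP := nd_nnsfun_approx measurableT mf' mn; apply.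
- move=> x; have f0' y : [set: T] y -> (0 <= (f y)%:E)%E by rewrite lee_fin.
  by have /fine_cvgP[] := cvg_nnsfun_approx measurableT mf' f0' (I : [set: T] x).
move=> n; rewrite /f_; move: (nnsfun_approx _ _ n) => h.
have hE : (h : T -> R) = fun x => \sum_(y <- fset_set (range h)) y * \1_(h @^-1` [set y]) x.
  apply/funext => x; rewrite {1}(fimfunE h x) fsbig_finite//.
rewrite hE.
(* Only nonnegative coefficients are allowed in the combinations, so the values of the simple
   function have to be known to be nonnegative. *)
have h0 y : y \in fset_set (range h) -> 0 <= y.
  by rewrite in_fset_set// => /set_mem[x _ <-].
have {h0} : all (fun y => 0 <= y) (enum_fset (fset_set (range h))) by apply/allP.
elim: (enum_fset (fset_set (range h))) => [_|y s IH /= /andP[y0 s0]].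
  under eq_fun do rewrite big_nil.
  by rewrite (_ : (fun _ => 0) = \1_set0)//; [exact: Pind | rewrite indic0].
under eq_fun do rewrite big_cons.
apply: PD => //; [| |exact: Pind|exact: IH].
- apply: measurable_sum => z; apply: measurable_funM => //.
- move=> x; rewrite big_seq sumr_ge0// => z zs.
  by rewrite mulr_ge0// (allP s0).
Qed.
End RealIntegrals.

(** The image under [th] of the measure with density [a] is compared with the measure of density
    [b]; keeping this as an identity of integrals avoids constructing either measure. *)
Lemma ge0_integral_transport d1 d2 (T1 : measurableType d1) (T2 : measurableType d2)
    (R : realType) (mu1 : {measure set T1 -> \bar R}) (mu2 : {measure set T2 -> \bar R})
    (a : T1 -> R) (b : T2 -> R) (th : T1 -> T2) :
  measurable_fun setT a -> (forall x, 0 <= a x) ->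
  measurable_fun setT b -> (forall x, 0 <= b x) ->
  measurable_fun setT th ->
  (forall B, measurable B ->
    \int[mu1]_x (a x * \1_B (th x))%:E = \int[mu2]_x (b x * \1_B x)%:E)%E ->
  forall psi : T2 -> R, measurable_fun setT psi -> (forall x, 0 <= psi x) ->
  (\int[mu1]_x (a x * psi (th x))%:E = \int[mu2]_x (b x * psi x)%:E)%E.
Proof.
move=> ma a0 mb b0 mth abB.
apply: ge0_measurable_ind => //.
- move=> c f g c0 mf mg f0 g0 fE gE.
  have split_int d (T : measurableType d) (m : {measure set T -> \bar R})
      (u : T -> R) (F G : T -> R) :
      measurable_fun setT u -> (forall x, 0 <= u x) ->
      measurable_fun setT F -> (forall x, 0 <= F x) ->
      measurable_fun setT G -> (forall x, 0 <= G x) ->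
      (\int[m]_x (u x * (c * F x + G x))%:E =
       c%:E * \int[m]_x (u x * F x)%:E + \int[m]_x (u x * G x)%:E)%E.
    move=> mu u0 mF F0 mG G0.
    have muF := measurable_funM mu mF; have muG := measurable_funM mu mG.
    rewrite -ge0_integralZl//; last 2 first.
    - exact/measurable_EFinP.
    - by move=> x _; rewrite lee_fin mulr_ge0.
    rewrite -ge0_integralD//.
    - by apply: eq_integral => x _; rewrite -EFinM -EFinD; congr (_%:E); ring.
    - by move=> x _; rewrite -EFinM lee_fin !mulr_ge0.
    - by apply: measurable_funeM; exact/measurable_EFinP.
    - by move=> x _; rewrite lee_fin mulr_ge0.
    - exact/measurable_EFinP.
  have mfth := measurableT_comp mf mth; have mgth := measurableT_comp mg mth.
  rewrite (split_int _ _ _ a _ _ ma a0 mfth (fun x => f0 _) mgth (fun x => g0 _)).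
  by rewrite split_int// fE gE.
- move=> f_ f mf_ mf f0 nd cf fE.
  have lim_int d (T : measurableType d) (m : {measure set T -> \bar R})
      (u : T -> R) (F_ : nat -> T -> R) (F : T -> R) :
      measurable_fun setT u -> (forall x, 0 <= u x) ->
      (forall n, measurable_fun setT (F_ n)) -> (forall n x, 0 <= F_ n x) ->
      (forall x, nondecreasing_seq (F_ ^~ x)) ->
      (forall x, F_ ^~ x @ \oo --> F x) ->
      (\int[m]_x (u x * F_ n x)%:E @[n --> \oo] --> \int[m]_x (u x * F x)%:E)%E.
    move=> mu u0 mF F0 ndF cF.
    have -> : (\int[m]_x (u x * F x)%:E =
               \int[m]_x limn (fun n => (u x * F_ n x)%:E))%E.
      apply: eq_integral => x _; apply/esym/cvg_lim => //.
      by apply: cvg_EFin; [exact: nearW | apply: cvgMr; exact: cF].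
    apply: (cvg_monotone_convergence measurableT) => //.
    - by move=> n; apply/measurable_EFinP; apply: measurable_funM.
    - by move=> n x _; rewrite lee_fin mulr_ge0.
    - by move=> x _ n m' nm; rewrite lee_fin ler_wpM2l//; exact: ndF.
  have := lim_int _ _ mu1 a (fun n => f_ n \o th) (f \o th) ma a0.
  move=> /(_ (fun n => measurableT_comp (mf_ n) mth) _ _ _) H1.
  have := lim_int _ _ mu2 b f_ f mb b0 mf_ f0 nd cf.
  rewrite -(funext fE) => H2.
  apply: cvg_unique H2; first exact: ereal_hausdorff.
  by apply: H1 => [n x|x|x]; [exact: f0|exact: nd|exact: cf].
Qed.

Lemma integral_set_indic d (T : measurableType d) (R : realType)
    (mu : {measure set T -> \bar R}) (a : T -> R) (E : set T) :
  (\int[mu]_(x in E) (a x)%:E = \int[mu]_x (a x * \1_E x)%:E)%E.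
Proof.
rewrite integral_mkcond; apply: eq_integral => x _; rewrite patchE indicE.
by case: (_ \in _); rewrite ?mulr1 ?mulr0.
Qed.

(** Uniqueness of a finite measure prescribed on a pi-system. Finiteness of the total mass permits
    the subtraction in the complement step. *)
Lemma integral_transport_pi_system d1 d2 (T1 : measurableType d1)
    (T2 : measurableType d2) (R : realType) (mu1 : {measure set T1 -> \bar R})
    (mu2 : {measure set T2 -> \bar R}) (a : T1 -> R) (b : T2 -> R) (th : T1 -> T2)
    (G : set (set T2)) :
  @measurable _ T2 = <<s G >> -> setI_closed G ->
  measurable_fun setT a -> (forall x, 0 <= a x) ->
  measurable_fun setT b -> (forall x, 0 <= b x) ->
  measurable_fun setT th ->
  (\int[mu1]_x (a x)%:E = \int[mu2]_x (b x)%:E)%E ->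
  (\int[mu1]_x (a x)%:E < +oo)%E ->
  (forall B, G B ->
    \int[mu1]_x (a x * \1_B (th x))%:E = \int[mu2]_x (b x * \1_B x)%:E)%E ->
  forall psi : T2 -> R, measurable_fun setT psi -> (forall x, 0 <= psi x) ->
  (\int[mu1]_x (a x * psi (th x))%:E = \int[mu2]_x (b x * psi x)%:E)%E.
Proof.
move=> GE GI ma a0 mb b0 mth ab aoo abG.
have ma' E : measurable_fun E (EFin \o a).
  by apply/measurable_EFinP; exact: measurable_funTS.
have mb' E : measurable_fun E (EFin \o b).
  by apply/measurable_EFinP; exact: measurable_funTS.
have mthE E : measurable E -> measurable (th @^-1` E).
  by move=> mE; rewrite -[X in measurable X]setTI; exact: mth.
apply: ge0_integral_transport => // E mE.
have toset B : (\int[mu1]_x (a x * \1_B (th x))%:E =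
    \int[mu1]_(x in th @^-1` B) (a x)%:E)%E by rewrite integral_set_indic.
rewrite toset -integral_set_indic.
rewrite GE in mE; move: E mE; apply: dynkin_induction => //.
- by move=> B GB; rewrite -toset integral_set_indic; exact: abG.
- move=> B mB PB.
  have U1 : (\int[mu1]_(x in th @^-1` B) (a x)%:E +
             \int[mu1]_(x in th @^-1` (~` B)) (a x)%:E = \int[mu1]_x (a x)%:E)%E.
    rewrite -ge0_integral_setU//=.
    - by rewrite -preimage_setU setUv preimage_setT.
    - exact: mthE.
    - by apply: mthE; exact: measurableC.
    - by move=> x _; rewrite lee_fin.
    - by apply/disj_setPS => x [].
  have U2 : (\int[mu2]_(x in B) (b x)%:E + \int[mu2]_(x in ~` B) (b x)%:E =
             \int[mu2]_x (b x)%:E)%E.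
    rewrite -ge0_integral_setU//= ?setUv//.
    - exact: measurableC.
    - by move=> x _; rewrite lee_fin.
    - by apply/disj_setPS => x [].
  have fin : (\int[mu2]_(x in B) (b x)%:E)%E \is a fin_num.
    rewrite ge0_fin_numE; last by apply: integral_ge0 => x _; rewrite lee_fin.
    apply: le_lt_trans aoo; rewrite ab -U2 leeDl// integral_ge0// => x _.
    by rewrite lee_fin.
  have := congr1 (fun z => z - \int[mu2]_(x in B) (b x)%:E)%E (etrans U1 (etrans ab (esym U2))).
  by rewrite PB 2!(addeC (\int[mu2]_(x in B) (b x)%:E)%E) !addeK.
- move=> F mF tF PF.
  rewrite preimage_bigcup !ge0_integral_bigcup//.
  + by apply: eq_eseriesr => k _; exact: PF.
  + by move=> x _; rewrite lee_fin.
  + by move=> k; exact: mthE.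
  + by move=> x _; rewrite lee_fin.
  + apply/trivIsetP => i j _ _ ij; move/trivIsetP: tF => /(_ i j I I ij).
    by move=> FF; rewrite -[LHS]/(th @^-1` (F i `&` F j)) FF preimage_set0.
Qed.

(** * Averages over the fibres of r *)
Section FibreAverage.
Variables (R : realType) (X : pseudoPMetricType R) (r : X -> X).
Hypothesis rfin : forall x, finite_set (fibre r x) /\ fibre r x !=set0.
Implicit Types f g : X -> R.

Definition Tavg f (x : X) : R :=
  ((nfib r x)%:R)^-1 * \sum_(y \in fibre r x) f y.

Lemma TavgE f x :
  Tavg f x = ((nfib r x)%:R)^-1 * \sum_(y <- fset_set (fibre r x)) f y.
Proof. by rewrite /Tavg fsbig_finite//; exact: (rfin x).1. Qed.

Lemma nfib_gt0 x : 0 < (nfib r x)%:R :> R.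
Proof.
rewrite ltr0n /nfib cardfs_gt0; apply/eqP => E.
have [fin [y yx]] := rfin x.
have : y \in fset_set (fibre r x) by rewrite in_fset_set// mem_set.
by rewrite E.
Qed.

Lemma mem_fibre x y : y \in fset_set (fibre r x) -> r y = x.
Proof. by rewrite in_fset_set; [move/set_mem|exact: (rfin x).1]. Qed.

Lemma eq_Tavg f g x : (forall y, r y = x -> f y = g y) -> Tavg f x = Tavg g x.
Proof.
move=> fg; rewrite !TavgE; congr (_ * _); rewrite big_seq [RHS]big_seq.
by apply: eq_bigr => y /mem_fibre; exact: fg.
Qed.

Lemma Tavg_le f g x : (forall y, r y = x -> f y <= g y) -> Tavg f x <= Tavg g x.
Proof.
move=> fg; rewrite !TavgE ler_wpM2l// ?invr_ge0//.
rewrite big_seq [leRHS]big_seq.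
by apply: ler_sum => y /mem_fibre; exact: fg.
Qed.

Lemma Tavg_ge0 f x : (forall y, r y = x -> 0 <= f y) -> 0 <= Tavg f x.
Proof.
move=> f0; rewrite TavgE mulr_ge0// big_seq sumr_ge0// => y /mem_fibre.
exact: f0.
Qed.

Lemma TavgD a f g x : Tavg (fun y => a * f y + g y) x = a * Tavg f x + Tavg g x.
Proof.
by rewrite !TavgE big_split/= -mulr_sumr mulrDr mulrCA.
Qed.

(** A function of r y is constant along a fibre, as for a conditional expectation. *)
Lemma Tavg_pull phi f x : Tavg (fun y => phi (r y) * f y) x = phi x * Tavg f x.
Proof.
rewrite (@eq_Tavg _ (fun y => phi x * f y)); last by move=> y ->.
by rewrite !TavgE -mulr_sumr mulrCA.
Qed.

Lemma Tavg_cst c x : Tavg (fun=> c) x = c.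
Proof.
rewrite TavgE big_const_seq count_predT iter_addr_0 -[c *+ _]mulr_natr.
by rewrite mulrCA mulVf ?mulr1// gt_eqF// nfib_gt0.
Qed.

Lemma TavgB f g x : Tavg (fun y => f y - g y) x = Tavg f x - Tavg g x.
Proof.
rewrite (@eq_Tavg _ (fun y => (-1) * g y + f y)); last by move=> y _; ring.
by rewrite TavgD; ring.
Qed.

Lemma Tavg_cvg (f_ : nat -> X -> R) f x :
  (forall y, r y = x -> f_ ^~ y @ \oo --> f y) -> (Tavg (f_ n) x @[n --> \oo] --> Tavg f x).
Proof.
move=> cf; rewrite TavgE; under eq_fun do rewrite TavgE.
apply: cvgMr.
have : forall y, y \in enum_fset (fset_set (fibre r x)) -> f_ ^~ y @ \oo --> f y.
  by move=> y /mem_fibre; exact: cf.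
elim: (enum_fset (fset_set (fibre r x))) => [|y s IH] sf.
  by under eq_fun do rewrite big_nil; rewrite big_nil; exact: cvg_cst.
under eq_fun do rewrite big_cons; rewrite big_cons; apply: cvgD.
  by apply: sf; rewrite in_cons eqxx.
by apply: IH => z zs; apply: sf; rewrite in_cons zs orbT.
Qed.

Lemma Tavg_eq0 f x : (forall y, 0 <= f y) -> Tavg f x = 0 ->
  forall y, r y = x -> f y = 0.
Proof.
move=> f0 T0 y yx; apply/eqP; rewrite eq_le f0 andbT.
have yin : y \in fset_set (fibre r x) by rewrite in_fset_set ?mem_set//; exact: (rfin x).1.
move: T0; rewrite TavgE (big_fsetD1 y)//= => /eqP; rewrite mulf_eq0.
rewrite invr_eq0 gt_eqF ?nfib_gt0//= addr_eq0 => /eqP ->.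
by rewrite oppr_le0 sumr_ge0.
Qed.

End FibreAverage.

(** * Continuous approximation of indicators of open sets *)

Section BorelFunctions.
Variables (R : realType) (X : pseudoPMetricType R).

Lemma continuous_borel_measurable (f : X -> R) :
  continuous f -> measurable_fun setT (f : borel X -> R).
Proof.
move=> cf; apply: (measurability _ (RGenOInfty.measurableE R)).
move=> _ [_ [x ->] <-]; rewrite setTI; apply: sub_sigma_algebra.
by apply: open_comp => // y _; exact: cf.
Qed.

(** The distance to a set is extended, and infinite when the set is empty; cutting it at 1 gives a
    real continuous function with the same zeros. *)
Definition tdist (A : set X) (x : X) : R := fine (Order.min 1%E (edist_inf A x)).

Lemma tdist_itv A x : 0 <= tdist A x <= 1.
Proof.
rewrite /tdist; have := edist_inf_ge0 A x.
case: (edist_inf A x) => [e||]//=; rewrite ?lee_fin => e0.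
- by rewrite -EFin_min/= le_min ler01 e0 ge_min lexx.
- by rewrite minEle leey/= ler01 lexx.
Qed.

Lemma tdist_lip A x y e : 0 < e -> ball x e y -> tdist A x <= e + tdist A y.
Proof.
move=> e0 xy; have := edist_inf_triangle A x y.
have := @edist_fin R X e (x, y) e0 xy.
have := edist_ge0 (x, y).
move: (edist (x, y)) => d.
have min1y : Order.min 1%E +oo%E = 1%E :> \bar R by rewrite min_l// leey.
rewrite /tdist; have := edist_inf_ge0 A x; have := edist_inf_ge0 A y.
case: (edist_inf A x) => [a||]//=; case: (edist_inf A y) => [b||]//=;
  case: d => [d||]//=; rewrite -?EFinD ?lee_fin //= => ? ? ? ? ?.
- rewrite -!EFin_min/=; case: (leP 1 a) => ?; case: (leP 1 b) => ?; lra.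
- rewrite min1y -!EFin_min/=; case: (leP 1 a) => ?; lra.
- by rewrite min1y; lra.
Qed.

Lemma tdist_continuous A : continuous (tdist A).
Proof.
move=> x; apply/cvgrPdist_le => e e0.
have : nbhs x (ball x e) by exact: nbhsx_ballx.
apply: filterS => y xy; rewrite ler_distl.
have := tdist_lip A e0 xy; have := tdist_lip A e0 (ball_sym xy).
by move=> h1 h2; apply/andP; split; lra.
Qed.

Lemma tdist_eq0 A x : A x -> tdist A x = 0.
Proof.
by move=> Ax; rewrite /tdist edist_inf0// -EFin_min/= min_r.
Qed.

Lemma tdist_gt0 A x : closed A -> ~ A x -> 0 < tdist A x.
Proof.
move=> cA nAx.
have : nbhs x (~` A).
  by apply: open_nbhs_nbhs; split => //; exact: closed_openC.
rewrite -nbhs_ballE => -[e /= e0 xeA].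
have : (e%:E <= edist_inf A x)%E.
  apply: le_ereal_inf_tmp => _ [a Aa <-]; rewrite leNgt; apply/negP => lt.
  by apply: (xeA a) => //; exact: (edist_lt_ball lt).
rewrite /tdist; case: (edist_inf A x) => [b||]//=.
- by rewrite lee_fin -EFin_min/= lt_min ltr01 => eb; rewrite (lt_le_trans e0).
- by rewrite min_l ?leey.
Qed.
End BorelFunctions.

(** * From continuous to Borel functions in the invariance identity *)

Section StronglyInvariant.
Variables (R : realType) (X : pseudoPMetricType R) (r : X -> X).
Variable mu : probability (borel X) R.
Hypothesis rfin : forall x, finite_set (fibre r x) /\ fibre r x !=set0.
Hypothesis muinv : strongly_invariant r mu.
Implicit Types f g : borel X -> R.

(* [Tavg r f] need not be Borel (this would require the Lusin-Novikov theorem);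
   it is so off a null Borel set. *)
Definition avg_invariant f := exists N : set (borel X),
  [/\ measurable N, mu N = 0%E,
      measurable_fun setT (fun x : borel X => \1_(~` N) x * Tavg r f x) &
      (\int[mu]_x (\1_(~` N) x * Tavg r f x)%:E = \int[mu]_x (f x)%:E)%E].

Lemma indicC_ae (N : set (borel X)) f : measurable N -> mu N = 0%E ->
  {ae mu, forall x, \1_(~` N) x * f x = f x}.
Proof.
move=> mN N0; exists N; split => // x /=; rewrite indicE.
by case: (boolP (x \in ~` N)) => [|]; rewrite ?mul1r // notin_setE /= => /contrapT.
Qed.

Lemma avg_invariant_of_ae f g : (forall x, 0 <= f x) ->
  measurable_fun setT g -> (forall x, 0 <= g x) ->
  {ae mu, forall x, Tavg r f x = g x} ->
  (\int[mu]_x (g x)%:E = \int[mu]_x (f x)%:E)%E -> avg_invariant f.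
Proof.
move=> f0 mg g0 [N [mN N0 TfN]] Ig; exists N.
have E : (fun x : borel X => \1_(~` N) x * Tavg r f x) =
         (fun x => \1_(~` N) x * g x).
  apply/funext => x; rewrite indicE.
  case: (boolP (x \in ~` N)) => [/set_mem xN|]; rewrite ?mul0r// !mul1r.
  by apply: contrapT => h; apply: xN; apply: TfN.
have mI : measurable_fun setT (fun x => \1_(~` N) x * g x).
  by apply: measurable_funM => //; exact/measurable_indic/measurableC.
split => //; first by rewrite E.
rewrite -Ig; transitivity (\int[mu]_x (\1_(~` N) x * g x)%:E)%E.
  by apply: eq_integral => x _; rewrite (congr1 (@^~ x) E).
apply: ge0_ae_integral_eq => //.
- by move=> x; rewrite mulr_ge0.
- exact: indicC_ae.
Qed.

(** Trades the explicit null set for a Borel version of the average, the form in which sums and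
    complements can be computed. *)
Lemma avg_invariantP f : measurable_fun setT f -> (forall x, 0 <= f x) ->
  avg_invariant f <-> exists g, [/\ measurable_fun setT g, forall x, 0 <= g x,
    {ae mu, forall x, Tavg r f x = g x} &
    (\int[mu]_x (g x)%:E = \int[mu]_x (f x)%:E)%E].
Proof.
move=> mf f0; split => [[N [mN N0 mT IT]]|[g [mg g0 Tg Ig]]]; last first.
  exact: avg_invariant_of_ae Ig.
exists (fun x => \1_(~` N) x * Tavg r f x); split => //.
- by move=> x; rewrite mulr_ge0// Tavg_ge0.
- by apply: (aeS (indicC_ae (Tavg r f) mN N0)) => x ->.
Qed.

Lemma integral_bounded01 f : measurable_fun setT f -> (forall x, 0 <= f x <= 1) ->
  (\int[mu]_x (f x)%:E + \int[mu]_x (1 - f x)%:E = 1)%E.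
Proof.
move=> mf f01.
have f0 x : 0 <= f x by have /andP[] := f01 x.
have f1 x : 0 <= 1 - f x by rewrite subr_ge0; have /andP[] := f01 x.
rewrite -ge0_integralD//=.
- rewrite -(probability_setT mu) -[RHS]mul1e -integral_cst//.
  by apply: eq_integral => x _; rewrite -EFinD; congr (_%:E); rewrite /=; ring.
- by move=> x _; rewrite lee_fin.
- exact/measurable_EFinP.
- by move=> x _; rewrite lee_fin.
- by apply/measurable_EFinP; apply: measurable_funB.
Qed.

Lemma Tavg01 f x : (forall x, 0 <= f x <= 1) -> 0 <= Tavg r f x <= 1.
Proof.
move=> f01; rewrite Tavg_ge0//=; last by move=> y _; have /andP[] := f01 y.
rewrite -[leRHS](Tavg_cst rfin 1 x); apply: Tavg_le => // y _.
by have /andP[] := f01 y.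
Qed.

Lemma avg_invariant_continuous (f : X -> R) : continuous f ->
  (forall x, 0 <= f x <= 1) -> avg_invariant f.
Proof.
move=> cf f01.
have mf := continuous_borel_measurable cf.
have f0 x : 0 <= f x by have /andP[] := f01 x.
have cf1 : continuous (fun x => 1 - f x).
  by move=> x; apply: cvgB; [exact: cvg_cst|exact: cf].
have T1 x : Tavg r (fun y => 1 - f y) x = 1 - Tavg r f x.
  by rewrite TavgB// Tavg_cst.
have I1 : (\int[mu]_x (Tavg r f x)%:E = \int[mu]_x (f x)%:E)%E.
  by rewrite (muinv cf).
have I2 : (\int[mu]_x (1 - Tavg r f x)%:E = \int[mu]_x (1 - f x)%:E)%E.
  by rewrite (muinv cf1); apply: eq_integral => x _; rewrite -T1.
have [|||g [mg g0 Tg]] := @ae_measurable_of_inner _ _ _ mu (Tavg r f).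
- exact: probability_setT.
- by move=> x; exact: Tavg01.
- by rewrite I1 I2; exact: integral_bounded01.
apply: (avg_invariant_of_ae _ mg g0 Tg) => //.
rewrite -I1; apply/esym; apply: ge0_ae_integral_eq => //.
by move=> x; rewrite Tavg_ge0.
Qed.

Lemma avg_invariantD a f g : 0 <= a ->
  measurable_fun setT f -> measurable_fun setT g ->
  (forall x, 0 <= f x) -> (forall x, 0 <= g x) ->
  avg_invariant f -> avg_invariant g -> avg_invariant (fun x => a * f x + g x).
Proof.
move=> a0 mf mg f0 g0 /avg_invariantP[]// F [mF F0 TF IF].
move=> /avg_invariantP[]// G [mG G0 TG IG].
have intD (u v : borel X -> R) : measurable_fun setT u -> measurable_fun setT v ->
    (forall x, 0 <= u x) -> (forall x, 0 <= v x) ->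
    (\int[mu]_x (a * u x + v x)%:E = a%:E * \int[mu]_x (u x)%:E + \int[mu]_x (v x)%:E)%E.
  move=> mu' mv u0 v0.
  rewrite -ge0_integralZl//; last 2 first.
  - exact/measurable_EFinP.
  - by move=> x _; rewrite lee_fin.
  rewrite -ge0_integralD//.
  - by move=> x _; rewrite -EFinM lee_fin mulr_ge0.
  - by apply: measurable_funeM; exact/measurable_EFinP.
  - by move=> x _; rewrite lee_fin.
  - exact/measurable_EFinP.
apply: (@avg_invariant_of_ae _ (fun x => a * F x + G x)).
- by move=> x; rewrite addr_ge0// mulr_ge0.
- by apply: measurable_funD => //; apply: measurable_funM.
- by move=> x; rewrite addr_ge0// mulr_ge0.
- by apply: (aeS2 TF TG) => x TFx TGx; rewrite TavgD// TFx TGx.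
- by rewrite !intD// IF IG.
Qed.

Lemma avg_invariant_lim (f_ : nat -> borel X -> R) f :
  (forall n, measurable_fun setT (f_ n)) -> measurable_fun setT f ->
  (forall n x, 0 <= f_ n x) -> (forall x, nondecreasing_seq (f_ ^~ x)) ->
  (forall x, f_ ^~ x @ \oo --> f x) -> (forall n, avg_invariant (f_ n)) ->
  avg_invariant f.
Proof.
move=> mf_ mf f_0 ndf cf invf.
have f0 x : 0 <= f x by rewrite -(cvg_lim _ (cf x))//; apply: limr_ge; [apply: cvgP (cf x)|exact: nearW].
have [N_ NP] := choice invf.
(* A single null set off which all the averages are measurable. Since fibres are finite, the
   averages converge pointwise, and monotone convergence applies on both sides of the identity. *)
pose N : set (borel X) := \bigcup_n N_ n.
have mN : measurable N by apply: bigcupT_measurable => n; have [] := NP n.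
have N0 : mu N = 0%E.
  apply/negligibleP => //; apply: negligible_bigcup => n; have [mn n0 _ _] := NP n.
  exact/negligibleP.
have mT n : measurable_fun setT (fun x : borel X => \1_(~` N) x * Tavg r (f_ n) x).
  have [mNn _ mTn _] := NP n.
  have -> : (fun x : borel X => \1_(~` N) x * Tavg r (f_ n) x) =
     (fun x => \1_(~` N) x * (\1_(~` (N_ n)) x * Tavg r (f_ n) x)).
    apply/funext => x; rewrite !indicE.
    case: (boolP (x \in ~` N)) => [/set_mem xN|]; rewrite ?mul0r//.
    rewrite !mul1r mem_set ?mul1r// => xn; apply: xN; exists n => //.
  by apply: measurable_funM => //; exact/measurable_indic/measurableC.
have cT x : \1_(~` N) x * Tavg r (f_ n) x @[n --> \oo] --> \1_(~` N) x * Tavg r f x.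
  by apply: cvgMr; apply: Tavg_cvg => // y _; exact: cf.
have mTf : measurable_fun setT (fun x : borel X => \1_(~` N) x * Tavg r f x).
  by apply: (measurable_fun_cvg mT) => x _; exact: cT.
have lim_int (F_ : nat -> borel X -> R) (F : borel X -> R) :
    (forall n, measurable_fun setT (F_ n)) -> (forall n x, 0 <= F_ n x) ->
    (forall x, nondecreasing_seq (F_ ^~ x)) -> (forall x, F_ ^~ x @ \oo --> F x) ->
    (\int[mu]_x (F_ n x)%:E @[n --> \oo] --> \int[mu]_x (F x)%:E)%E.
  move=> mF F0 ndF cF.
  have -> : (\int[mu]_x (F x)%:E = \int[mu]_x limn (fun n => (F_ n x)%:E))%E.
    apply: eq_integral => x _; apply/esym/cvg_lim => //.
    by apply: cvg_EFin; [exact: nearW | exact: cF].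
  apply: (cvg_monotone_convergence measurableT) => //.
  - by move=> n; exact/measurable_EFinP.
  - by move=> n x _; rewrite lee_fin.
  - by move=> x _ n m' nm; rewrite lee_fin; exact: ndF.
exists N; split => //.
have T0 n x : 0 <= \1_(~` N) x * Tavg r (f_ n) x by rewrite mulr_ge0// Tavg_ge0.
have := lim_int _ _ mf_ f_0 ndf cf.
have := lim_int _ _ mT T0 _ cT.
have -> : (fun n => \int[mu]_x (\1_(~` N) x * Tavg r (f_ n) x)%:E)%E =
          (fun n => \int[mu]_x (f_ n x)%:E)%E.
  apply/funext => n; have [mNn N0n mTn <-] := NP n.
  apply: ge0_ae_integral_eq => //.
  - by move=> x; rewrite mulr_ge0// Tavg_ge0.
  - apply: (aeS2 (indicC_ae (Tavg r (f_ n)) mN N0)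
      (indicC_ae (Tavg r (f_ n)) mNn N0n)) => x -> -> //.
move=> H1 H2; apply: cvg_unique H2; first exact: ereal_hausdorff.
apply: H1 => x n m nm; rewrite ler_wpM2l//; apply: Tavg_le => // y _.
exact: ndf.
Qed.

Lemma avg_invariant_indicC (A : set (borel X)) : measurable A ->
  avg_invariant \1_A -> avg_invariant \1_(~` A).
Proof.
move=> mA /avg_invariantP[]// g [mg g0 Tg Ig].
have A01 (x : borel X) : 0 <= (\1_A x : R) <= 1 by rewrite indicE; case: (_ \in _); rewrite /= ?lexx ler01.
have CE x : \1_(~` A) x = 1 - \1_A x :> R.
  by rewrite !indicE in_setC; case: (_ \in _); rewrite ?subr0 ?subrr.
(* Capping alters the version on a null set only, as the average of an indicator is at most 1, and
   it keeps 1 - g' nonnegative everywhere. *)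
pose g' x := Num.min (g x) 1.
have Tg' : {ae mu, forall x, Tavg r \1_A x = g' x}.
  apply: (aeS Tg) => x Tx; rewrite /g' -Tx min_l//.
  by have /andP[] := @Tavg01 \1_A x A01.
have mg' : measurable_fun setT g' by apply: measurable_minr.
have g'01 x : 0 <= g' x <= 1.
  by rewrite /g' le_min g0 ler01 ge_min lexx orbT.
have g'0 x : 0 <= g' x by have /andP[] := g'01 x.
have Ig' : (\int[mu]_x (g' x)%:E = \int[mu]_x (\1_A x)%:E)%E.
  rewrite -Ig; apply: ge0_ae_integral_eq => //.
  by apply: (aeS2 Tg Tg') => x <- <-.
apply: (@avg_invariant_of_ae _ (fun x => 1 - g' x)).
- by [].
- by apply: measurable_funB.
- by move=> x; rewrite subr_ge0; have /andP[] := g'01 x.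
- apply: (aeS Tg') => x <-; rewrite -(Tavg_cst rfin 1 x) -TavgB//.
  by apply: eq_Tavg => // y _; rewrite CE.
- have H1 := integral_bounded01 mg' g'01.
  have mIA : measurable_fun setT (\1_A : borel X -> R) by exact: measurable_indic.
  have H2 := integral_bounded01 mIA A01.
  have fin : (\int[mu]_x (g' x)%:E)%E \is a fin_num.
    by rewrite Ig' integral_indic// setIT fin_num_measure.
  rewrite -Ig' in H2.
  have -> : (\int[mu]_x (\1_(~` A) x)%:E = \int[mu]_x (1 - \1_A x)%:E)%E.
    by apply: eq_integral => x _; rewrite CE.
  have := congr1 (fun z => z - \int[mu]_x (g' x)%:E)%E (etrans H1 (esym H2)).
  by rewrite 2!(addeC (\int[mu]_x (g' x)%:E)%E) !addeK.
Qed.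

Lemma avg_invariant_indic (A : set (borel X)) : measurable A -> avg_invariant \1_A.
Proof.
move=> mA.
apply: (@dynkin_induction _ (borel X) (@open X) (fun A => avg_invariant \1_A)) => //.
- exact: openI.
- rewrite (_ : \1_setT = cst 1); last by apply/funext => x; rewrite indicE in_setT.
  apply: avg_invariant_continuous; first by move=> x; exact: cvg_cst.
  by move=> x; rewrite lexx ler01.
- move=> U oU.
  (* Multiples of the distance to the complement, cut at 1: continuous functions increasing to the
     indicator of [U]. *)
  pose f_ n (x : borel X) : R := Num.min 1 (n%:R * tdist (~` U) x).
  have f_c n : continuous (f_ n : X -> R).
    move=> x; apply: (@continuous_min _ _ (cst 1) (fun x => n%:R * tdist (~` U) x)).
      exact: cvg_cst.
    by apply: cvgMr; exact: tdist_continuous.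
  have t0 x : 0 <= tdist (~` U) x by have /andP[] := tdist_itv (~` U) x.
  have f_01 n x : 0 <= f_ n x <= 1.
    by rewrite /f_ le_min ler01 mulr_ge0//= ge_min lexx.
  apply: (@avg_invariant_lim f_).
  + by move=> n; exact: continuous_borel_measurable.
  + by apply: measurable_indic; exact: sub_sigma_algebra.
  + by move=> n x; have /andP[] := f_01 n x.
  + move=> x n m nm; rewrite /f_ le_min ge_min lexx/= ge_min; apply/orP; right.
    by rewrite ler_wpM2r// ler_nat.
  + move=> x; rewrite indicE; case: (boolP (x \in U)) => xU.
      have tx : 0 < tdist (~` U) x.
        by apply: tdist_gt0; [exact: open_closedC|move=> h; apply: h; exact: set_mem].
      apply: cvg_near_cst; near=> n; rewrite /f_ min_l// -ler_pdivrMr// mul1r.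
      by near: n; exact: nbhs_infty_ger.
    rewrite /f_ tdist_eq0; last by move/negP: xU => h Ux; apply: h; exact: mem_set.
    by under eq_fun do rewrite mulr0 min_r//; exact: cvg_cst.
  + by move=> n; exact: avg_invariant_continuous.
- by move=> S mS; exact: avg_invariant_indicC.
- move=> F mF tF invF.
  (* Disjointness makes the indicator of a partial union a sum of indicators, so additivity gives
     the finite unions and monotone limits the countable one. *)
  pose f_ n : borel X -> R := \1_(\big[setU/set0]_(i < n) F i).
  have mU n : measurable (\big[setU/set0]_(i < n) F i).
    by apply: bigsetU_measurable => i _.
  apply: (@avg_invariant_lim f_).
  + by move=> n; apply: measurable_indic.
  + by apply: measurable_indic; exact: bigcupT_measurable.
  + by [].
  + move=> x n m nm; rewrite /f_ !indicE ler_nat.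
    case: (boolP (x \in _)) => //= /set_mem xn; rewrite mem_set//.
    by move: x xn; exact: subset_bigsetU.
  + move=> x; rewrite /f_ indicE; case: (boolP (x \in \bigcup_k F k)) => xU.
      have [k _ Fk] := set_mem xU.
      apply: cvg_near_cst; near=> n; rewrite indicE mem_set//.
      rewrite -bigcup_mkord; exists k => //=.
      by near: n; exact: nbhs_infty_gt.
    apply: cvg_near_cst; apply: nearW => n; rewrite indicE memNset// => xn.
    move/negP: xU; apply; apply: mem_set; move: xn; rewrite -bigcup_mkord => -[k _ Fk].
    by exists k.
  + elim=> [|n IH].
      rewrite /f_ big_ord0 indic0; apply: avg_invariant_continuous.
        by move=> x; exact: cvg_cst.
      by move=> x; rewrite lexx ler01.
    rewrite (_ : f_ n.+1 = fun x => 1 * \1_(F n) x + f_ n x).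
      by apply: avg_invariantD => //; apply: measurable_indic.
    apply/funext => x; rewrite /f_ big_ord_recr/= mul1r !indicE in_setU.
    case: (boolP (x \in F n)) => xn; rewrite ?orbT ?orbF ?add0r//.
    rewrite memNset ?addr0// -bigcup_mkord => -[k /= kn Fk].
    move: tF => /trivIsetP/(_ k n I I); rewrite (ltn_eqF kn) => /(_ isT).
    by apply/eqP/set0P; exists x; split => //; exact: set_mem.
Unshelve. all: by end_near. Qed.

Lemma Tavg_invariant f : measurable_fun setT f -> (forall x, 0 <= f x) ->
  exists g, [/\ measurable_fun setT g, forall x, 0 <= g x,
    {ae mu, forall x, Tavg r f x = g x} &
    (\int[mu]_x (g x)%:E = \int[mu]_x (f x)%:E)%E].
Proof.
move=> mf f0; apply/avg_invariantP => //.
apply: ge0_measurable_ind mf f0.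
- exact: avg_invariant_indic.
- exact: avg_invariantD.
- exact: avg_invariant_lim.
Qed.

(** The average of the indicator of a null set has integral 0, so it vanishes a.e.; being a positive
    combination over the fibre, it vanishes only where the fibre misses the null set. *)
Lemma ae_fibre (P : X -> Prop) : {ae mu, forall x, P x} ->
  {ae mu, forall x, forall y, r y = x -> P y}.
Proof.
move=> [N [mN N0 PN]].
have [//|//|g [mg g0 Tg Ig]] := @Tavg_invariant \1_N.
have /(integral0_ae mg g0) g_0 : (\int[mu]_x (g x)%:E = 0)%E.
  by rewrite Ig integral_indic// setIT.
apply: (aeS2 Tg g_0) => x Tx gx y yx; apply: contrapT => nP.
have : \1_N y = 0 :> R by apply: (@Tavg_eq0 _ _ r rfin _ x) => //; rewrite Tx.
by rewrite indicE mem_set ?oner_eq0//; [move/eqP; rewrite oner_eq0|exact: PN].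
Qed.

End StronglyInvariant.

(** * The transfer operator on real functions and its adjoint identity *)

Section WeightedAverage.
Variables (R : realType) (X : pseudoPMetricType R) (r : X -> X).
Variable mu : probability (borel X) R.
Hypothesis rfin : forall x, finite_set (fibre r x) /\ fibre r x !=set0.
Hypothesis muinv : strongly_invariant r mu.
Hypothesis mr : measurable_fun setT (r : borel X -> borel X).
Variable w : borel X -> R.
Hypotheses (mw : measurable_fun setT w) (w0 : forall x, 0 <= w x).
Hypothesis w1 : forall x, Tavg r w x = 1.
Implicit Types f g h phi q : borel X -> R.

Definition Rw h (x : X) : R := Tavg r (fun y => w y * h y) x.

Lemma eq_Rw f g x : (forall y, r y = x -> f y = g y) -> Rw f x = Rw g x.
Proof. by move=> fg; apply: eq_Tavg => // y yx; rewrite fg. Qed.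

Lemma Rw_le f g x : (forall y, r y = x -> f y <= g y) -> Rw f x <= Rw g x.
Proof. by move=> fg; apply: Tavg_le => // y yx; rewrite ler_wpM2l// fg. Qed.

Lemma Rw_ge0 f x : (forall y, r y = x -> 0 <= f y) -> 0 <= Rw f x.
Proof. by move=> f0; apply: Tavg_ge0 => // y yx; rewrite mulr_ge0// f0. Qed.

Lemma RwD a f g x : Rw (fun y => a * f y + g y) x = a * Rw f x + Rw g x.
Proof. by rewrite /Rw -TavgD//; apply: eq_Tavg => // y _; ring. Qed.

Lemma RwB f g x : Rw (fun y => f y - g y) x = Rw f x - Rw g x.
Proof. by rewrite /Rw -TavgB//; apply: eq_Tavg => // y _; ring. Qed.

Lemma Rw_cst c x : Rw (fun=> c) x = c.
Proof.
rewrite /Rw (@eq_Tavg _ _ _ rfin _ (fun y => c * w y)); last by move=> y; rewrite mulrC.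
by rewrite (@Tavg_pull _ _ _ rfin (fun=> c)) w1 mulr1.
Qed.

Lemma Rw_pull phi f x : Rw (fun y => phi (r y) * f y) x = phi x * Rw f x.
Proof. by rewrite /Rw -Tavg_pull//; apply: eq_Tavg => // y _; ring. Qed.

Lemma Rw_cvg (f_ : nat -> borel X -> R) f x :
  (forall y, r y = x -> f_ ^~ y @ \oo --> f y) -> Rw (f_ n) x @[n --> \oo] --> Rw f x.
Proof. by move=> cf; apply: Tavg_cvg => // y yx; apply: cvgMr; exact: cf. Qed.

Lemma ae_Rw_le f g : {ae mu, forall x, f x <= g x} ->
  {ae mu, forall x, Rw f x <= Rw g x}.
Proof. by move=> /(ae_fibre rfin muinv) fg; apply: (aeS fg) => x; exact: Rw_le. Qed.

Lemma ae_eq_Rw f g : {ae mu, forall x, f x = g x} ->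
  {ae mu, forall x, Rw f x = Rw g x}.
Proof. by move=> /(ae_fibre rfin muinv) fg; apply: (aeS fg) => x; exact: eq_Rw. Qed.

Definition is_version h (q : borel X -> R) := [/\ measurable_fun setT q, forall x, 0 <= q x &
  {ae mu, forall x, q x = Rw h x}].

Lemma ex_version h : measurable_fun setT h -> (forall x, 0 <= h x) ->
  exists q, is_version h q.
Proof.
move=> mh h0.
have [||q [mq q0 Tq _]] := @Tavg_invariant _ _ _ _ rfin muinv (fun y => w y * h y).
- exact: measurable_funM.
- by move=> x; rewrite mulr_ge0.
by exists q; split => //; apply: (aeS Tq).
Qed.

(** [Rw h] need not be Borel, so it cannot be iterated inside integrals. This picks a Borel version;
    the default 0 is never reached for nonnegative measurable [h]. *)
Definition Qw h : borel X -> R := xget (cst 0) [set q | is_version h q].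

Lemma QwP h : measurable_fun setT h -> (forall x, 0 <= h x) -> is_version h (Qw h).
Proof. by move=> mh h0; rewrite /Qw; case: xgetP => // /(_ _ (projT2 (cid (ex_version mh h0)))). Qed.

(** Duality between the transfer operator and composition with [r]: [phi (r y)] is pulled out of the
    average, and the average preserves integrals. *)
Lemma integral_version phi h q : measurable_fun setT phi -> (forall x, 0 <= phi x) ->
  measurable_fun setT h -> (forall x, 0 <= h x) -> is_version h q ->
  (\int[mu]_x (phi x * q x)%:E = \int[mu]_x (w x * (phi (r x) * h x))%:E)%E.
Proof.
move=> mphi phi0 mh h0 [mq q0 qR].
have mphir : measurable_fun setT (phi \o (r : borel X -> borel X)).
  exact: measurableT_comp.
have [||g [mg g0 Tg <-]] :=
  @Tavg_invariant _ _ _ _ rfin muinv (fun y => w y * (phi (r y) * h y)).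
- by apply: measurable_funM => //; apply: measurable_funM.
- by move=> x; rewrite !mulr_ge0.
apply: ge0_ae_integral_eq => //; first by move=> x; rewrite mulr_ge0.
apply: (aeS2 Tg qR) => x <- ->; rewrite -Rw_pull//.
Qed.

End WeightedAverage.

(** * The path measure *)
Section Solenoid.
Variables (R : realType) (X : pseudoPMetricType R) (r : X -> X).
Variable mu : probability (borel X) R.
Hypothesis rfin : forall x, finite_set (fibre r x) /\ fibre r x !=set0.
Hypothesis muinv : strongly_invariant r mu.
Hypothesis mr : measurable_fun setT (r : borel X -> borel X).
Variable m0 : borel X -> R[i].
Let w : borel X -> R := fun x => sqn (m0 x).
Hypothesis mw : measurable_fun setT w.
Hypothesis w1 : forall x, Tavg r w x = 1.
Variable nu : probability (seqspace X) R.
Hypothesis nuP : solenoid_measure r m0 mu nu.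

Implicit Types (psi D : borel X -> R) (B : nat -> set (borel X)).

Let w0 x : 0 <= w x. Proof. exact: sqr_ge0. Qed.

Lemma measurable_coord n : measurable_fun setT (fun s : seqspace X => (s n : borel X)).
Proof.
move=> _ B mB; rewrite setTI; apply: sub_sigma_algebra; exists n, B; split => //.
Qed.

Lemma measurable_rinf : measurable_fun setT (rinf r : seqspace X -> seqspace X).
Proof.
apply: (measurability _ (erefl : @measurable _ (seqspace X) = <<s @cyl_gen X >>)).
move=> _ [_ [n [B [mB ->]] <-]]; rewrite setTI.
case: n => [|n].
- rewrite (_ : _ @^-1` _ = [set s | (r @^-1` B) (s 0%N)])//.
  apply: sub_sigma_algebra; exists 0%N, (r @^-1` B); split => //.
  by rewrite -[X in measurable X]setTI; exact: mr.
- by apply: sub_sigma_algebra; exists n, B; split.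
Qed.

Definition rect n (B : nat -> set (borel X)) : set (seqspace X) :=
  [set s | forall k, (k <= n)%N -> B k (s k)].

Definition rects : set (set (seqspace X)) :=
  [set A | exists n B, (forall k, measurable (B k)) /\ A = rect n B].

(** Padding with the full space. A rectangle pulled back by [rinf] constrains both r(x_0) and x_0,
    so the coordinates 0 and 1 must both be present. *)
Lemma rect_succ n B : rect n B = rect n.+1 (fun k => if (k <= n)%N then B k else setT).
Proof.
apply/seteqP; split=> s sB k kn; first by case: ifP => // kn'; exact: sB.
by have := sB k (leqW kn); rewrite kn.
Qed.

Lemma measurable_rect n B : (forall k, measurable (B k)) -> measurable (rect n B).
Proof.
move=> mB; rewrite (_ : rect n B =
    \bigcap_(k in [set k | (k <= n)%N]) ((fun s : seqspace X => (s k : borel X)) @^-1` B k)).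
  apply: bigcap_measurable => [|k _]; first by exists 0%N.
  by rewrite -[X in measurable X]setTI; exact: measurable_coord.
by apply/seteqP; split=> s sB k kn; exact: sB.
Qed.

Lemma rects_setI : setI_closed rects.
Proof.
move=> _ _ [n [B [mB ->]]] [m [C [mC ->]]].
exists (maxn n m), (fun k => (if (k <= n)%N then B k else setT) `&`
                             (if (k <= m)%N then C k else setT)); split.
  by move=> k; apply: measurableI; case: ifP.
apply/seteqP; split=> s.
- by move=> [sB sC] k _; split; case: ifP => // ?; [exact: sB|exact: sC].
- move=> sBC; split=> k kn.
  + by have [+ _] := sBC k (leq_trans kn (leq_maxl _ _)); rewrite kn.
  + by have [_ +] := sBC k (leq_trans kn (leq_maxr _ _)); rewrite kn.
Qed.

Lemma measurable_rectsE : @measurable _ (seqspace X) = <<s rects >>.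
Proof.
apply/seteqP; split.
- apply: smallest_sub; first exact: smallest_sigma_algebra.
  move=> _ [n [B [mB ->]]]; apply: sub_sigma_algebra.
  exists n, (fun k => if k == n then B else setT); split.
    by move=> k; case: ifP.
  apply/seteqP; split=> s /=; last by move/(_ n (leqnn _)); rewrite eqxx.
  by move=> sB k _; case: eqP => // ->.
- apply: smallest_sub; first exact: sigma_algebra_measurable.
  by move=> _ [n [B [mB ->]]]; exact: measurable_rect.
Qed.

(** [Wt] divides by the size of the fibre over r y, which is the fibre over x being summed; one step
    of the path sum is thus one application of the transfer operator. *)
Lemma pathwS B n k (x : X) : pathw r (Wt r m0) B n.+1 k x =
  Rw r w (fun y => \1_(B k) y * pathw r (Wt r m0) B n k.+1 y) x.
Proof.
rewrite /= fsbig_finite ?(rfin x).1//; last exact: (rfin x).1.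
rewrite /Rw TavgE// mulr_sumr big_seq [RHS]big_seq.
apply: eq_bigr => y /(mem_fibre rfin) yx; rewrite /Wt yx /w; ring.
Qed.

Lemma pathw_ge0 B n k x : 0 <= pathw r (Wt r m0) B n k x.
Proof.
elim: n k x => [|n IH] k x; first exact: ler01.
by rewrite pathwS Rw_ge0// => y _; rewrite mulr_ge0.
Qed.

(** Each path step may leave the Borel class. The version found for the shorter path is substituted
    on almost every fibre before the next average is taken. *)
Lemma pathw_version B n k : (forall k, measurable (B k : set (borel X))) ->
  exists D : borel X -> R, [/\ measurable_fun setT D, forall x, 0 <= D x &
    {ae mu, forall x, pathw r (Wt r m0) B n k x = D x}].
Proof.
move=> mB; elim: n k => [|n IH] k.
  by exists (cst 1); split => //; exact: aeW.
have [D [mD D0 DE]] := IH k.+1.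
have [||q [mq q0 qE]] := @ex_version _ _ _ _ rfin muinv _ mw w0 (fun y => \1_(B k) y * D y).
- by apply: measurable_funM => //; exact: measurable_indic.
- by move=> x; rewrite mulr_ge0.
exists q; split => //.
apply: (aeS2 (ae_fibre rfin muinv DE) qE) => x DEx ->; rewrite pathwS.
by apply: eq_Rw => // y yx; rewrite DEx.
Qed.

(** [D] is the conditional probability, given x_0, of the constraints on x_1, ..., x_n. *)
Lemma integral_coord0_rect n B D psi : (forall k, measurable (B k : set (borel X))) ->
  measurable_fun setT D -> (forall x, 0 <= D x) ->
  {ae mu, forall x, pathw r (Wt r m0) B n 1 x = D x} ->
  measurable_fun setT psi -> (forall x : borel X, 0 <= psi x) ->
  (\int[nu]_s (\1_(rect n B) s * psi (s 0%N))%:E =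
   \int[mu]_x (\1_(B 0%N) x * D x * psi x)%:E)%E.
Proof.
move=> mB mD D0 DE mpsi psi0.
have mR := measurable_rect n mB.
apply: (@ge0_integral_transport _ _ _ _ _ nu mu (\1_(rect n B)) _
  (fun s : seqspace X => (s 0%N : borel X))) => //.
- by apply: measurable_funM => //; exact: measurable_indic.
- by move=> x; rewrite mulr_ge0.
- exact: measurable_coord.
move=> C mC.
(* The condition on x_0 is absorbed into the base of the rectangle; path sums started at index 1 do
   not see that coordinate. *)
pose B' k := if k is 0 then B 0%N `&` C else B k.
have mB' k : measurable (B' k : set (borel X)).
  by case: k => [|k]; rewrite /B'//; exact: measurableI.
have pathB' : forall m k x, pathw r (Wt r m0) B' m k.+1 x = pathw r (Wt r m0) B m k.+1 x.
  elim=> [//|m IH] k x; rewrite !pathwS; apply: eq_Rw => // y _; by rewrite IH.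
transitivity (nu (rect n B')).
  rewrite -[rect n B']setIT -integral_indic//; last exact: measurable_rect.
  apply: eq_integral => s _; congr (_%:E).
  rewrite (_ : rect n B' = rect n B `&` [set s | C (s 0%N)]).
    by rewrite indicI.
  apply/seteqP; split=> [t tB'|t [tB tC] [|k] kn].
  - split; last by have [] := tB' 0%N isT.
    by move=> [|k] kn; have := tB' _ kn; [case|].
  - by split => //; exact: (tB 0%N).
  - exact: tB.
rewrite (nuP.2 n B' mB'); apply: ge0_ae_integral_eq => //.
- by move=> x; rewrite mulr_ge0// pathw_ge0.
- by move=> x; rewrite !mulr_ge0.
- apply: measurable_funM; last exact: measurable_indic.
  by apply: measurable_funM => //; exact: measurable_indic.
- apply: (aeS DE) => x <-; rewrite pathB' /B' indicI /=; ring.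
Qed.

Lemma integral_coord0 psi : measurable_fun setT psi -> (forall x : borel X, 0 <= psi x) ->
  (\int[nu]_s (psi (s 0%N))%:E = \int[mu]_x (psi x)%:E)%E.
Proof.
move=> mpsi psi0.
have := @integral_coord0_rect 0 (fun=> setT) (cst 1) psi.
have -> : rect 0 (fun=> setT) = setT by apply/seteqP; split.
under eq_integral do rewrite indicT mul1r.
under [X in _ -> _ -> _ -> _ -> _ -> _ -> _ = X]eq_integral do rewrite indicT !mul1r.
by apply => //; exact: aeW.
Qed.

Lemma integral_w : (\int[mu]_x (w x)%:E = 1)%E.
Proof.
have H := @integral_version _ _ _ _ rfin muinv mr _ mw w0 (cst 1) (cst 1) (cst 1).
rewrite -(probability_setT mu) -[RHS]mul1e -integral_cst//.
rewrite (eq_integral (fun x => (w x * (1 * 1))%:E)); last by move=> x _; rewrite !mulr1.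
rewrite -H//; first by apply: eq_integral => x _; rewrite mulr1.
by split => //; apply: aeW => x; rewrite Rw_cst.
Qed.

(** The change of variables behind the isometry of U. Both sides are measures of total mass 1 in
    [f], so rectangles suffice; there, duality turns the weight [w] at x_0 into one more step of the
    path sum. *)
Lemma integral_rinf (f : seqspace X -> R) :
  measurable_fun setT f -> (forall s, 0 <= f s) ->
  (\int[nu]_s (w (s 0%N) * f (rinf r s))%:E = \int[nu]_s (f s)%:E)%E.
Proof.
move=> mf f0.
have m_w0 : measurable_fun setT (fun s : seqspace X => w (s 0%N)).
  by apply: (measurableT_comp mw); exact: measurable_coord.
have Iw : (\int[nu]_s (w (s 0%N))%:E = 1)%E by rewrite integral_coord0// integral_w.
transitivity (\int[nu]_s (1 * f s)%:E)%E; last by apply: eq_integral => s _; rewrite mul1r.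
apply: (@integral_transport_pi_system _ _ _ _ _ nu nu (fun s => w (s 0%N)) (cst 1) (rinf r)
          rects) => //.
- exact: measurable_rectsE.
- exact: rects_setI.
- exact: measurable_rinf.
- rewrite Iw -[RHS]/(\int[nu]_x (cst 1%E x))%E integral_cst// mul1e.
  exact/esym/probability_setT.
- by rewrite Iw ltry.
move=> _ [n [B [mB ->]]]; rewrite rect_succ.
set B1 := (fun k : nat => if _ then _ else _); have mB1 k : measurable (B1 k : set (borel X)).
  by rewrite /B1; case: ifP.
(* The preimage of the rectangle under [rinf]: the first two constraints both fall on x_0, the
   others move down by one index. *)
pose B2 k := if k is 0 then (r @^-1` B1 0%N) `&` B1 1%N else B1 k.+1.
have mB2 k : measurable (B2 k : set (borel X)).
  case: k => [|k]; rewrite /B2//; apply: measurableI => //.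
  by rewrite -[X in measurable X]setTI; exact: mr.
have [D [mD D0 DE]] := pathw_version n 2 mB1.
have DE2 : {ae mu, forall x, pathw r (Wt r m0) B2 n 1 x = D x}.
  apply: (aeS DE) => x <-.
  have : forall m k x, pathw r (Wt r m0) B2 m k.+1 x = pathw r (Wt r m0) B1 m k.+2 x.
    by elim=> [//|m IH] k y; rewrite !pathwS; apply: eq_Rw => // z _; rewrite IH.
  by apply.
transitivity (\int[nu]_s (\1_(rect n B2) s * w (s 0%N))%:E)%E.
  apply: eq_integral => s _; rewrite mulrC; congr (_ * _)%:E.
  rewrite !indicE; suff -> : (rinf r s \in rect n.+1 B1) = (s \in rect n B2) by [].
  apply/idP/idP => /set_mem H; apply: mem_set.
  - case=> [|k] kn; last exact: (H k.+2).
    by split; [exact: (H 0%N)|exact: (H 1%N)].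
  - case=> [|[|k]] kn; [by have [] := H 0%N isT|by have [] := H 0%N isT|exact: (H k.+1)].
rewrite (integral_coord0_rect mB2 mD D0 DE2)//.
have [||q qP] := @ex_version _ _ _ _ rfin muinv _ mw w0 (fun y => \1_(B1 1%N) y * D y).
- by apply: measurable_funM => //; exact: measurable_indic.
- by move=> x; rewrite mulr_ge0.
have mB1D : measurable_fun setT (fun y => \1_(B1 1%N) y * D y : R).
  by apply: measurable_funM => //; exact: measurable_indic.
transitivity (\int[mu]_x (\1_(B1 0%N) x * q x)%:E)%E.
  rewrite (@integral_version _ _ _ _ rfin muinv mr _ mw w0 (\1_(B1 0%N))
    (fun y => \1_(B1 1%N) y * D y) q)//.
  - by apply: eq_integral => x _; congr (_%:E); rewrite /B2 indicI/=; ring.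
  - by move=> x; rewrite mulr_ge0.
have [mq q0 qE] := qP.
transitivity (nu (rect n.+1 B1)).
  rewrite (nuP.2 n.+1 B1 mB1); apply/esym/ge0_ae_integral_eq => //.
  - by move=> x; rewrite mulr_ge0// pathw_ge0.
  - by move=> x; rewrite !mulr_ge0.
  - by apply: measurable_funM => //; exact: measurable_indic.
  - apply: (aeS2 (ae_fibre rfin muinv DE) qE) => x DEx ->; rewrite pathwS; congr (_ * _).
    by apply: eq_Rw => // y yx; rewrite DEx.
rewrite -[rect n.+1 B1]setIT -integral_indic ?setIT//; last exact: measurable_rect.
by apply: eq_integral => s _; rewrite mul1r.
Qed.

End Solenoid.

(** * Zero-one dichotomies and almost everywhere constants *)

Section ZeroOne.
Context {d : measure_display} {T : measurableType d} {R : realType}.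
Variable nu : probability T R.

Lemma ae_False : ~ {ae nu, forall x : T, False}.
Proof.
move=> [N [mN N0 FN]]; have : (nu setT <= nu N)%E.
  by apply: le_measure; rewrite ?in_setE// => x _; exact: FN.
by rewrite probability_setT N0 leNgt lte01.
Qed.

(** The constant is the infimum of the levels q with g <= q a.e. This set of levels is nonempty and
    bounded below, since a real value can be neither above every integer nor below every negative
    one. *)
Lemma ae_const_of_dichotomy (g : T -> R) :
  (forall q, {ae nu, forall x, g x <= q} \/ {ae nu, forall x, q < g x}) ->
  exists c, {ae nu, forall x, g x = c}.
Proof.
move=> gq; pose E := [set q | {ae nu, forall x, g x <= q}].
have nE q : ~ E q -> {ae nu, forall x, q < g x} by case: (gq q).
have [q1 Eq1] : exists q, E q.
  apply: contrapT => nex.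
  have H n : {ae nu, forall x, n%:R < g x}.
    by apply: nE => En; apply: nex; exists n%:R.
  apply: ae_False; apply: (aeS (ae_foralln H)) => x Hx.
  have := Hx (Num.bound `|g x|); rewrite ltNge => /negP; apply.
  by rewrite (le_trans (ler_norm _))// ltW// archi_boundP.
have [q0 nEq0] : exists q, ~ E q.
  apply: contrapT => nex.
  have H n : {ae nu, forall x, g x <= - n%:R}.
    by apply: contrapT => nEn; apply: nex; exists (- n%:R).
  apply: ae_False; apply: (aeS (ae_foralln H)) => x Hx.
  have := Hx (Num.bound `|g x|); rewrite leNgt => /negP; apply.
  have : `|g x| < (Num.bound `|g x|)%:R by exact: archi_boundP.
  by rewrite ltr_norml => /andP[].
have Eup q q' : E q -> q <= q' -> E q'.
  by move=> Eq qq'; apply: (aeS Eq) => x /le_trans; apply.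
have infE : has_inf E.
  split; first by exists q1.
  exists q0 => q Eq; rewrite leNgt; apply/negP => qq0.
  by apply: nEq0; apply: Eup Eq _; exact: ltW.
exists (inf E).
have H1 n : {ae nu, forall x, g x <= inf E + n.+1%:R^-1}.
  have n0 : 0 < n.+1%:R^-1 :> R by rewrite invr_gt0.
  by have [q Eq qinf] := inf_adherent n0 infE; apply: Eup Eq _; exact: ltW.
have H2 n : {ae nu, forall x, inf E - n.+1%:R^-1 < g x}.
  apply: nE => En; have := ge_inf infE.2 En.
  by rewrite lerBDr gerDl leNgt invr_gt0 ltr0n.
apply: (aeS2 (ae_foralln H1) (ae_foralln H2)) => x H1x H2x.
apply/eqP; rewrite eq_le; apply/andP; split; apply/ler_addgt0Pr => e e0.
- near \oo => n.
  have : n.+1%:R^-1 < e by near: n; exact: (near_infty_natSinv_lt (PosNum e0)).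
  by have := H1x n; move: (n.+1%:R^-1) => c; lra.
- near \oo => n.
  have : n.+1%:R^-1 < e by near: n; exact: (near_infty_natSinv_lt (PosNum e0)).
  by have := H2x n; move: (n.+1%:R^-1) => c; lra.
Unshelve. all: by end_near. Qed.

Lemma measurable_sublevel (g : T -> R) q : measurable_fun setT g ->
  measurable [set x | g x <= q].
Proof.
move=> mg; rewrite (_ : [set x | g x <= q] = setT `&` g @^-1` [set` `]-oo, q]]).
  by apply: mg => //; exact: measurable_itv.
by rewrite setTI; apply/seteqP; split=> x /=; rewrite in_itv.
Qed.

Lemma ae_of_measure1 (A : set T) : measurable A -> nu A = 1%E ->
  {ae nu, forall x, A x}.
Proof.
move=> mA A1; exists (~` A); split => //; first exact: measurableC.
by rewrite probability_setC// A1 subee.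
Qed.

Lemma ae_of_measure0 (A : set T) : measurable A -> nu A = 0%E ->
  {ae nu, forall x, ~ A x}.
Proof. by move=> mA A0; exists A; split => // x /=; exact: contrapT. Qed.

End ZeroOne.

(** * Null sets and invariant sets of the shift *)

Section Shift.
Variables (R : realType) (X : pseudoPMetricType R) (r : X -> X).
Variable mu : probability (borel X) R.
Hypothesis rfin : forall x, finite_set (fibre r x) /\ fibre r x !=set0.
Hypothesis muinv : strongly_invariant r mu.
Hypothesis mr : measurable_fun setT (r : borel X -> borel X).
Variable m0 : borel X -> R[i].
Let w : borel X -> R := fun x => sqn (m0 x).
Hypothesis mw : measurable_fun setT w.
Hypothesis w1 : forall x, Tavg r w x = 1.
Variable nu : probability (seqspace X) R.
Hypothesis nuP : solenoid_measure r m0 mu nu.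
Hypothesis m0n0 : {ae mu, forall x, m0 x <> 0}.

Let integral_coord0' := integral_coord0 rfin nuP.
Let integral_rinf' := integral_rinf rfin muinv mr mw w1 nuP.

Lemma sqnE (z : R[i]) : sqn z = complex.Re z ^+ 2 + complex.Im z ^+ 2.
Proof. by rewrite /sqn /cabs sqr_sqrtr// addr_ge0// sqr_ge0. Qed.

Lemma sqn_ge0 (z : R[i]) : 0 <= sqn z. Proof. exact: sqr_ge0. Qed.

Lemma sqn_eq0 (z : R[i]) : sqn z = 0 -> z = 0.
Proof.
rewrite sqnE => /eqP; rewrite paddr_eq0 ?sqr_ge0// !sqrf_eq0 => /andP[/eqP a /eqP b].
by apply/eqP; rewrite eq_complex a b !eqxx.
Qed.

Lemma sqn0 : sqn (0 : R[i]) = 0. Proof. by rewrite sqnE/= expr0n addr0. Qed.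

Lemma ae_coord0 (P : X -> Prop) : {ae mu, forall x, P x} ->
  {ae nu, forall s, P (s 0%N)}.
Proof.
move=> [N [mN N0 PN]].
have mI : measurable_fun setT (\1_N : borel X -> R) by exact: measurable_indic.
have mI0 : measurable_fun setT (fun s : seqspace X => \1_N (s 0%N) : R).
  by apply: (measurableT_comp mI); exact: measurable_coord.
have /(integral0_ae mI0) H : (\int[nu]_s (\1_N (s 0%N))%:E = 0)%E.
  by rewrite integral_coord0'// integral_indic// setIT.
apply: (aeS (H _)) => // s; rewrite indicE.
case: (boolP (s 0%N \in N)) => [_ /eqP|]; first by rewrite oner_eq0.
by move=> sN _; apply: contrapT => nP; move/negP: sN; apply; apply: mem_set; exact: PN.
Qed.

(** The change of variables shows that the weight [w] at x_0 times the indicator of the pulled back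
    null set vanishes a.e.; as m_0 is a.e. nonzero, the indicator itself vanishes. *)
Lemma ae_rinf (P : seqspace X -> Prop) : {ae nu, forall s, P s} ->
  {ae nu, forall s, P (rinf r s)}.
Proof.
move=> [N [mN N0 PN]].
have mI : measurable_fun setT (\1_N : seqspace X -> R) by exact: measurable_indic.
have mI0 : measurable_fun setT (fun s : seqspace X => w (s 0%N) * \1_N (rinf r s) : R).
  apply: measurable_funM.
    by apply: (measurableT_comp mw); exact: measurable_coord.
  by apply: (measurableT_comp mI); exact: measurable_rinf.
have /(integral0_ae mI0) H : (\int[nu]_s (w (s 0%N) * \1_N (rinf r s))%:E = 0)%E.
  by rewrite integral_rinf'// integral_indic// setIT.
have {}H := H (fun s => mulr_ge0 (sqn_ge0 _) (ler0n R _)).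
apply: (aeS2 H (ae_coord0 m0n0)) => s /eqP + m0s; rewrite mulf_eq0 => /orP[/eqP/sqn_eq0//|].
rewrite indicE; case: (boolP (rinf r s \in N)) => [_|]; first by rewrite oner_eq0.
by move=> sN _; apply: contrapT => nP; move/negP: sN; apply; apply: mem_set; exact: PN.
Qed.

Lemma ae_iter_rinf (P : seqspace X -> Prop) n : {ae nu, forall s, P s} ->
  {ae nu, forall s, P (iter n (rinf r) s)}.
Proof.
move=> aP; elim: n => [//|n IH]; apply: (aeS (ae_rinf IH)) => s.
by rewrite -iterSr.
Qed.

(** [ergodic] speaks of strictly invariant sets, whereas sublevel sets of an a.e. invariant function
    are invariant only up to null sets. The set of points whose orbit eventually stays in [A] is
    strictly invariant and differs from [A] by a null set. *)
Lemma invariant_version (A : set (seqspace X)) : measurable A ->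
  {ae nu, forall s, A (rinf r s) <-> A s} ->
  exists A', [/\ measurable A', rinf r @^-1` A' = A' & {ae nu, forall s, A s <-> A' s}].
Proof.
move=> mA Ainv.
pose A' := \bigcup_m \bigcap_(n in [set n | (m <= n)%N]) (iter n (rinf r) @^-1` A).
have miter n : measurable_fun setT (iter n (rinf r) : seqspace X -> seqspace X).
  elim: n => [|n IH]; first exact: measurable_id.
  by apply: measurableT_comp IH; exact: measurable_rinf.
exists A'; split.
- apply: bigcupT_measurable => m; apply: bigcap_measurable => [|n _]; first by exists m => /=.
  by rewrite -[X in measurable X]setTI; exact: miter.
- apply/seteqP; split=> s [m _ sA].
  + exists m.+1 => // -[//|n] mn; have := sA n mn; rewrite /= -iterSr//.
  + exists m => // n mn; rewrite /= -[A _]/((iter n (rinf r) @^-1` A) (rinf r s)).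
    by have := sA n.+1 (leqW mn); rewrite /preimage/= -iterS iterSr.
- have H := ae_foralln (fun n => ae_iter_rinf n Ainv).
  apply: (aeS H) => s sA.
  have sE n : A (iter n (rinf r) s) <-> A s.
    by elim: n => [//|n IH]; rewrite -IH; exact: sA.
  split=> [As|[m _ /(_ m (leqnn m))]]; last by move/sE.
  by exists 0%N => // n _; apply/sE.
Qed.

Lemma ergodic_ae_invariant (A : set (seqspace X)) : ergodic nu (rinf r) ->
  measurable A -> {ae nu, forall s, A (rinf r s) <-> A s} ->
  {ae nu, forall s, A s} \/ {ae nu, forall s, ~ A s}.
Proof.
move=> erg mA /(invariant_version mA)[A' [mA' iA' AA']].
have [A0|A1] := erg A' mA' iA'.
- by right; apply: (aeS2 AA' (ae_of_measure0 mA' A0)) => s <-.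
- by left; apply: (aeS2 AA' (ae_of_measure1 mA' A1)) => s <-.
Qed.

Lemma ergodic_invariant_const (g : seqspace X -> R) : ergodic nu (rinf r) ->
  measurable_fun setT g -> {ae nu, forall s, g (rinf r s) = g s} ->
  exists c, {ae nu, forall s, g s = c}.
Proof.
move=> erg mg ginv; apply: ae_const_of_dichotomy => q.
have mA : measurable [set s : seqspace X | g s <= q].
  exact: measurable_sublevel.
have [|H|H] := ergodic_ae_invariant erg mA.
- by apply: (aeS ginv) => s /= ->.
- by left.
- by right; apply: (aeS H) => s /= /negP; rewrite -ltNge.
Qed.

Lemma ergodic_fixed_const (phi : seqspace X -> R[i]) : ergodic nu (rinf r) ->
  L2 nu phi -> aeq nu (Uop r m0 phi) (piop m0 phi) -> exists c, aeq nu phi (fun=> c).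
Proof.
move=> erg [[mRe mIm] _] Uphi.
have inv : {ae nu, forall s, phi (rinf r s) = phi s}.
  by apply: (aeS2 Uphi (ae_coord0 m0n0)) => s /[swap] /eqP m0s /(mulfI m0s).
have [|a aP] := ergodic_invariant_const erg mRe; first by apply: (aeS inv) => s ->.
have [|b bP] := ergodic_invariant_const erg mIm; first by apply: (aeS inv) => s ->.
by exists (Complex a b); apply: (aeS2 aP bP) => s; case: (phi s) => u v /= -> ->.
Qed.

End Shift.

(** * Square integrable complex functions *)
Section ComplexFunctions.
Context {d : measure_display} {T : measurableType d} {R : realType}.
Variable nu : probability T R.
Implicit Types f g : T -> R[i].
Local Open Scope complex_scope.

Lemma cReM (x y : R[i]) : complex.Re (x * y) =
  complex.Re x * complex.Re y - complex.Im x * complex.Im y.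
Proof. by case: x y => a b [c e]. Qed.

Lemma cImM (x y : R[i]) : complex.Im (x * y) =
  complex.Re x * complex.Im y + complex.Im x * complex.Re y.
Proof. by case: x y => a b [c e]. Qed.

Lemma cReD (x y : R[i]) : complex.Re (x + y) = complex.Re x + complex.Re y.
Proof. by case: x y => a b [c e]. Qed.

Lemma cImD (x y : R[i]) : complex.Im (x + y) = complex.Im x + complex.Im y.
Proof. by case: x y => a b [c e]. Qed.

Lemma sqnM (x y : R[i]) : sqn (x * y) = sqn x * sqn y.
Proof. by rewrite !sqnE cReM cImM; ring. Qed.

Lemma sqnD (x y : R[i]) : sqn (x + y) <= 2 * sqn x + 2 * sqn y.
Proof.
rewrite !sqnE cReD cImD -subr_ge0.
set a := complex.Re x; set b := complex.Im x; set c := complex.Re y; set e := complex.Im y.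
rewrite (_ : _ - _ = (a - c) ^+ 2 + (b - e) ^+ 2); last by ring.
by rewrite addr_ge0// sqr_ge0.
Qed.

Lemma sqn_real (a : R) : sqn a%:C = a ^+ 2.
Proof. by rewrite sqnE/= expr0n addr0. Qed.

Lemma cmeasurable_cst (c : R[i]) : cmeasurable (fun _ : T => c).
Proof. by split; exact: measurable_cst. Qed.

Lemma cmeasurable_real (f : T -> R) : measurable_fun setT f ->
  cmeasurable (fun x => (f x)%:C).
Proof. by move=> mf; split => //; exact: measurable_cst. Qed.

Lemma cmeasurableD f g : cmeasurable f -> cmeasurable g ->
  cmeasurable (fun x => f x + g x).
Proof.
move=> [mf1 mf2] [mg1 mg2]; split.
- by under eq_fun do rewrite cReD; exact: measurable_funD.
- by under eq_fun do rewrite cImD; exact: measurable_funD.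
Qed.

Lemma cmeasurableM f g : cmeasurable f -> cmeasurable g ->
  cmeasurable (fun x => f x * g x).
Proof.
move=> [mf1 mf2] [mg1 mg2]; split.
- by under eq_fun do rewrite cReM; apply: measurable_funB; exact: measurable_funM.
- by under eq_fun do rewrite cImM; apply: measurable_funD; exact: measurable_funM.
Qed.

Lemma measurable_sqn f : cmeasurable f -> measurable_fun setT (fun x => sqn (f x)).
Proof.
move=> [m1 m2]; under eq_fun do rewrite sqnE.
by apply: measurable_funD; exact: measurable_funX.
Qed.

Definition cind (E : set T) (x : T) : R[i] := (\1_E x : R)%:C.

Lemma cindE E x : cind E x = (x \in E)%:R.
Proof. by rewrite /cind indicE; case: (_ \in _). Qed.

Lemma cmeasurable_cind E : measurable E -> cmeasurable (cind E).
Proof. by move=> mE; apply: cmeasurable_real; exact: measurable_indic. Qed.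

Lemma sqn_cind_le1 E x : sqn (cind E x) <= 1.
Proof. by rewrite /cind sqn_real indicE; case: (_ \in _); rewrite ?expr1n ?expr0n ?ler01. Qed.

Lemma integral_sqnM_le (b f : T -> R[i]) (M : R) : 0 <= M ->
  cmeasurable b -> cmeasurable f ->
  {ae nu, forall x, sqn (b x) <= M} ->
  (\int[nu]_x (sqn (b x * f x))%:E <= M%:E * \int[nu]_x (sqn (f x))%:E)%E.
Proof.
move=> M0 mb mf bM.
have msf := measurable_sqn mf.
rewrite -ge0_integralZl//; last 2 first.
- exact/measurable_EFinP.
- by move=> x _; rewrite lee_fin sqn_ge0.
apply: ae_ge0_le_integral => //.
- by move=> x _; rewrite lee_fin sqn_ge0.
- by apply/measurable_EFinP/measurable_sqn; exact: cmeasurableM.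
- by move=> x _; rewrite -EFinM lee_fin mulr_ge0// sqn_ge0.
- by apply: measurable_funeM; exact/measurable_EFinP.
- by apply: (aeS bM) => x bx _; rewrite -EFinM lee_fin sqnM ler_wpM2r// sqn_ge0.
Qed.

Lemma L2M (b f : T -> R[i]) (M : R) : cmeasurable b ->
  {ae nu, forall x, sqn (b x) <= M} -> L2 nu f -> L2 nu (fun x => b x * f x).
Proof.
move=> mb bM [mf ff]; split; first exact: cmeasurableM.
have bM' : {ae nu, forall x, sqn (b x) <= Num.max 0 M}.
  by apply: (aeS bM) => x bx; rewrite le_max bx orbT.
apply: le_lt_trans (integral_sqnM_le _ mb mf bM') _; first by rewrite le_max lexx.
by rewrite lte_mul_pinfty// lee_fin le_max lexx.
Qed.

Lemma L2_cind E f : measurable E -> L2 nu f -> L2 nu (fun x => cind E x * f x).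
Proof.
move=> mE; apply: L2M; first exact: cmeasurable_cind.
by apply: aeW => x; exact: sqn_cind_le1.
Qed.

Lemma L2D f g : L2 nu f -> L2 nu g -> L2 nu (fun x => f x + g x).
Proof.
move=> [mf ff] [mg gg]; split; first exact: cmeasurableD.
have msf := measurable_sqn mf; have msg := measurable_sqn mg.
apply: (@le_lt_trans _ _ (\int[nu]_x (2 * sqn (f x) + 2 * sqn (g x))%:E)%E).
  apply: ge0_le_integral => //.
  - by move=> x _; rewrite lee_fin sqn_ge0.
  - by apply/measurable_EFinP/measurable_sqn; exact: cmeasurableD.
  - by apply/measurable_EFinP; apply: measurable_funD; exact: measurable_funM.
  - by move=> x _; rewrite lee_fin sqnD.
rewrite (eq_integral (fun x => 2%:E * (sqn (f x))%:E + 2%:E * (sqn (g x))%:E)%E)//.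
rewrite ge0_integralD//; last 4 first.
- by move=> x _; rewrite -EFinM lee_fin mulr_ge0// sqn_ge0.
- by apply: measurable_funeM; exact/measurable_EFinP.
- by move=> x _; rewrite -EFinM lee_fin mulr_ge0// sqn_ge0.
- by apply: measurable_funeM; exact/measurable_EFinP.
rewrite !ge0_integralZl//; last 4 first.
- exact/measurable_EFinP.
- by move=> x _; rewrite lee_fin sqn_ge0.
- exact/measurable_EFinP.
- by move=> x _; rewrite lee_fin sqn_ge0.
by rewrite lte_add_pinfty// lte_mul_pinfty.
Qed.

Lemma L2Z (a : R[i]) f : L2 nu f -> L2 nu (fun x => a * f x).
Proof. by apply: (L2M (M := sqn a)); [exact: cmeasurable_cst|exact: aeW]. Qed.

Lemma L2_lin (a : R[i]) f g : L2 nu f -> L2 nu g -> L2 nu (fun x => a * f x + g x).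
Proof. by move=> /(L2Z a) ? ?; exact: L2D. Qed.

Lemma L2_bounded f (M : R) : cmeasurable f -> (forall x, sqn (f x) <= M) -> L2 nu f.
Proof.
move=> mf fM; split => //; apply: (@le_lt_trans _ _ (\int[nu]_x (cst M%:E x))%E).
  apply: ge0_le_integral => //.
  - by move=> x _; rewrite lee_fin sqn_ge0.
  - by apply/measurable_EFinP/measurable_sqn.
  - by move=> x _; rewrite lee_fin fM.
rewrite integral_cst// [X in (_ * X)%E](_ : _ = 1%E) ?mule1 ?ltry//.
exact: probability_setT.
Qed.

Lemma L2_cst (c : R[i]) : L2 nu (fun=> c).
Proof. by apply: (@L2_bounded _ (sqn c)) => //; exact: cmeasurable_cst. Qed.

Lemma L2normsqE f : L2 nu f -> (\int[nu]_x (sqn (f x))%:E = (L2normsq nu f)%:E)%E.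
Proof.
move=> [mf ff]; rewrite /L2normsq fineK// ge0_fin_numE//.
by apply: integral_ge0 => x _; rewrite lee_fin sqn_ge0.
Qed.

Lemma sqn_int0_ae f : cmeasurable f -> (\int[nu]_x (sqn (f x))%:E <= 0)%E ->
  {ae nu, forall x, f x = 0}.
Proof.
move=> mf If; have := @integral0_ae _ _ _ nu _ (measurable_sqn mf) (fun x => sqn_ge0 _).
move=> H; apply: (aeS (H _)) => [|x]; last exact: sqn_eq0.
by apply/eqP; rewrite eq_le If integral_ge0// => x _; rewrite lee_fin sqn_ge0.
Qed.

(** For identities reached in the limit: [f] is a defect not depending on n, estimated through
    approximations that do. *)
Lemma sqn_squeeze f (K : R) (e : nat -> \bar R) : cmeasurable f ->
  (forall n, \int[nu]_x (sqn (f x))%:E <= K%:E * e n)%E ->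
  (e @ \oo --> 0%E)%E -> {ae nu, forall x, f x = 0}.
Proof.
move=> mf fe e0; apply: sqn_int0_ae => //.
have : (K%:E * e n @[n --> \oo] --> K%:E * 0)%E by apply: cvgeZl.
rewrite mule0 => Ke0; rewrite -(cvg_lim _ Ke0)//.
by apply: lime_ge; [apply: cvgP Ke0|exact: nearW].
Qed.

Lemma sqn_dominated_cvg0 (u : nat -> T -> R[i]) (F : T -> R) :
  (forall n, cmeasurable (u n)) -> measurable_fun setT F ->
  (forall x, 0 <= F x) -> (\int[nu]_x (F x)%:E < +oo)%E ->
  (forall n x, sqn (u n x) <= F x) ->
  (forall x, sqn (u n x) @[n --> \oo] --> 0) ->
  (\int[nu]_x (sqn (u n x))%:E @[n --> \oo] --> 0)%E.
Proof.
move=> mu_ mF F0 Foo uF u0.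
have [||||| _ _] := @dominated_convergence _ _ _ nu setT measurableT
  (fun n x => (sqn (u n x))%:E) (cst 0%E) (EFin \o F).
- by move=> n; apply/measurable_EFinP/measurable_sqn.
- by [].
- by apply: aeW => x _; apply: cvg_EFin; [exact: nearW|exact: u0].
- apply/integrableP; split; first exact/measurable_EFinP.
  by under eq_integral do rewrite gee0_abs ?lee_fin//.
- by apply: aeW => x n _; rewrite gee0_abs ?lee_fin ?sqn_ge0//; exact: uF.
- by rewrite integral0.
Qed.

Section BoundedOperator.
Variable Op : (T -> R[i]) -> T -> R[i].
Hypothesis bOp : bounded_op nu Op.

Lemma op_L2 f : L2 nu f -> L2 nu (Op f). Proof. by have [+ _ _ _] := bOp; apply. Qed.

Lemma op_lin a f g : L2 nu f -> L2 nu g ->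
  aeq nu (Op (fun x => a * f x + g x)) (fun x => a * Op f x + Op g x).
Proof. by have [_ _ + _] := bOp; apply. Qed.

Lemma op_bound : exists M : R, forall f, L2 nu f ->
  (\int[nu]_x (sqn (Op f x))%:E <= M%:E * \int[nu]_x (sqn (f x))%:E)%E.
Proof.
have [_ _ _ [M MP]] := bOp; exists M => f L2f.
rewrite (L2normsqE L2f) (L2normsqE (op_L2 L2f)) -EFinM lee_fin.
exact: MP.
Qed.

Definition commutes_ind E := forall f, L2 nu f ->
  aeq nu (Op (fun x => cind E x * f x)) (fun x => cind E x * Op f x).

Lemma commutes_indT : commutes_ind setT.
Proof.
move=> f L2f; have -> : (fun x => cind setT x * f x) = f.
  by apply/funext => x; rewrite cindE in_setT mul1r.
by apply: aeW => x; rewrite cindE in_setT mul1r.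
Qed.

Lemma commutes_indI E F : measurable E -> measurable F ->
  commutes_ind E -> commutes_ind F -> commutes_ind (E `&` F).
Proof.
move=> mE mF cE cF f L2f.
have EF x : cind (E `&` F) x = cind E x * cind F x.
  by rewrite !cindE in_setI; case: (_ \in E); rewrite ?mul1r ?mul0r.
have -> : (fun x => cind (E `&` F) x * f x) = (fun x => cind E x * (cind F x * f x)).
  by apply/funext => x; rewrite EF mulrA.
apply: (aeS2 (cF _ L2f) (cE _ (L2_cind mF L2f))) => x H1 ->.
by rewrite H1 EF mulrA.
Qed.

Lemma commutes_indC E : measurable E -> commutes_ind E -> commutes_ind (~` E).
Proof.
move=> mE cE f L2f.
have CE x : cind (~` E) x = -1 * cind E x + 1.
  by rewrite !cindE in_setC; case: (_ \in E) => /=; ring.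
have -> : (fun x => cind (~` E) x * f x) = (fun x => -1 * (cind E x * f x) + f x).
  by apply/funext => x; rewrite CE; ring.
apply: (aeS2 (op_lin (-1) (L2_cind mE L2f) L2f) (cE _ L2f)) => x -> ->.
by rewrite CE; ring.
Qed.

Lemma commutes_indU E F : measurable E -> measurable F ->
  commutes_ind E -> commutes_ind F -> commutes_ind (E `|` F).
Proof.
move=> mE mF cE cF; rewrite -[E `|` F]setCK setCU; apply: commutes_indC.
  by apply: measurableI; exact: measurableC.
by apply: commutes_indI; [exact: measurableC|exact: measurableC|
  exact: commutes_indC|exact: commutes_indC].
Qed.

(** Finite unions follow from intersections and complements. For the limit, the commutator with the
    indicator of [E] equals the commutator with multiplication by $1_E - 1_{E_n}$, which tends to 0
    strongly, and [Op] is bounded. *)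
Lemma commutes_ind_bigcup (F : (set T)^nat) : (forall n, measurable (F n)) ->
  (forall n, commutes_ind (F n)) -> commutes_ind (\bigcup_n F n).
Proof.
move=> mF cF f L2f; set E := \bigcup_n F n.
have mE : measurable E by exact: bigcupT_measurable.
pose En n := \big[setU/set0]_(i < n) F i.
have mEn n : measurable (En n) by apply: bigsetU_measurable.
have cEn n : commutes_ind (En n).
  rewrite /En; elim: n => [|n IH].
    by rewrite big_ord0 -[set0]setCT; apply: commutes_indC => //; exact: commutes_indT.
  by rewrite big_ord_recr/=; apply: commutes_indU => //; exact: mEn.
have EnE n x : x \in En n -> x \in E.
  move=> /set_mem; rewrite /En -bigcup_mkord => -[k _ Fk].
  by apply: mem_set; exists k.
pose v n g x : R[i] := cind E x * g x - cind (En n) x * g x.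
have L2v n g : L2 nu g -> L2 nu (v n g).
  move=> L2g; have := L2_lin (-1) (L2_cind (mEn n) L2g) (L2_cind mE L2g).
  by rewrite (_ : (fun x => _) = v n g)//; apply/funext => x; rewrite /v; ring.
have cvg_v g : L2 nu g -> (\int[nu]_x (sqn (v n g x))%:E @[n --> \oo] --> 0)%E.
  move=> L2g; apply: (@sqn_dominated_cvg0 _ (fun x => sqn (g x))).
  - by move=> n; exact: (L2v n g L2g).1.
  - exact: measurable_sqn L2g.1.
  - by move=> x; exact: sqn_ge0.
  - exact: L2g.2.
  - move=> n x; rewrite /v -mulrBl sqnM ler_piMl ?sqn_ge0// !cindE.
    case: (boolP (x \in En n)) => [/EnE ->|_]; first by rewrite subrr sqn0.
    by rewrite subr0; have := sqn_cind_le1 E x; rewrite cindE.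
  - move=> x; apply: cvg_near_cst.
    case: (boolP (x \in E)) => xE; last first.
      apply: nearW => n; rewrite /v !cindE (negbTE xE).
      by case: (boolP (x \in En n)) => [/EnE|]; rewrite ?(negbTE xE)// !mul0r subrr sqn0.
    have [k _ Fk] := set_mem xE; near=> n.
    have xn : x \in En n.
      apply: mem_set; rewrite /En -bigcup_mkord; exists k => //=.
      by near: n; exact: nbhs_infty_gt.
    by rewrite /v !cindE xE xn subrr sqn0.
have [M MP] := op_bound.
pose D x := Op (fun x => cind E x * f x) x - cind E x * Op f x.
have mD : cmeasurable D.
  have := (L2_lin (-1) (L2_cind mE (op_L2 L2f)) (op_L2 (L2_cind mE L2f))).1.
  by rewrite (_ : (fun x => _) = D)//; apply/funext => x; rewrite /D; ring.
suff H : {ae nu, forall x, D x = 0} by apply: (aeS H) => x /eqP; rewrite subr_eq0 => /eqP.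
(* The factor 2 comes from $|a-b|^2 \le 2|a|^2 + 2|b|^2$. *)
apply: (@sqn_squeeze _ 2 (fun n => M%:E * \int[nu]_x (sqn (v n f x))%:E +
    \int[nu]_x (sqn (v n (Op f) x))%:E)%E) => //; last first.
  rewrite -[0%E]adde0 -[X in (X + _)%E](mule0 M%:E).
  apply: cvgeD; first by rewrite mule0.
    by apply: cvgeZl => //; exact: cvg_v.
  exact: cvg_v (op_L2 L2f).
move=> n.
have m1 := measurable_sqn (op_L2 (L2v n f L2f)).1.
have m2 := measurable_sqn (L2v n _ (op_L2 L2f)).1.
have Dn : {ae nu, forall x, D x = Op (v n f) x - v n (Op f) x}.
  apply: (aeS2 (op_lin (-1) (L2_cind (mEn n) L2f) (L2_cind mE L2f)) (cEn n f L2f)) => x.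
  rewrite (_ : (fun x => -1 * _ + _) = v n f); last by apply/funext => y; rewrite /v; ring.
  by move=> -> ->; rewrite /D /v; ring.
apply: (@le_trans _ _ (\int[nu]_x (2 * sqn (Op (v n f) x) + 2 * sqn (v n (Op f) x))%:E)%E).
  apply: ae_ge0_le_integral => //.
  - by move=> x _; rewrite lee_fin sqn_ge0.
  - by apply/measurable_EFinP/measurable_sqn.
  - by move=> x _; rewrite lee_fin addr_ge0// mulr_ge0// sqn_ge0.
  - by apply/measurable_EFinP; apply: measurable_funD; exact: measurable_funM.
  - apply: (aeS Dn) => x -> _; rewrite lee_fin.
    have := sqnD (Op (v n f) x) (-1 * v n (Op f) x).
    by rewrite sqnM (_ : sqn (-1) = 1) ?mul1r ?mulN1r// sqnE/= sqrrN oppr0 expr1n expr0n addr0.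
rewrite (eq_integral (fun x => 2%:E * ((sqn (Op (v n f) x))%:E + (sqn (v n (Op f) x))%:E))%E);
  last by move=> x _; rewrite -EFinD -EFinM mulrDr.
rewrite ge0_integralZl//; last 2 first.
- by apply: emeasurable_funD; exact/measurable_EFinP.
- by move=> x _; rewrite -EFinD lee_fin addr_ge0// sqn_ge0.
rewrite lee_pmul2l ?lte_fin//.
rewrite ge0_integralD//.
- by rewrite leeD2r// MP//; exact: L2v.
- by move=> x _; rewrite lee_fin sqn_ge0.
- exact/measurable_EFinP.
- by move=> x _; rewrite lee_fin sqn_ge0.
- exact/measurable_EFinP.
Unshelve. all: by end_near. Qed.

Lemma commutes_ind_pi_system (G : set (set T)) : @measurable _ T = <<s G >> ->
  setI_closed G -> (forall E, G E -> commutes_ind E) ->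
  forall E, measurable E -> commutes_ind E.
Proof.
move=> GE GI cG E; rewrite GE; move: E; apply: dynkin_induction => //.
- exact: commutes_indT.
- by move=> E mE; exact: commutes_indC.
- by move=> F mF _; exact: commutes_ind_bigcup.
Qed.

(** On an indicator, Op 1_E = 1_E Op 1 = c 1_E. Linearity and continuity in L^2 carry this to
    nonnegative functions, then to real and complex ones. *)
Lemma commutes_ind_scalar c : (forall E, measurable E -> commutes_ind E) ->
  aeq nu (Op (fun=> 1)) (fun=> c) ->
  forall f, L2 nu f -> aeq nu (Op f) (fun x => c * f x).
Proof.
move=> cE Op1.
have pos : forall u : T -> R, measurable_fun setT u -> (forall x, 0 <= u x) ->
    L2 nu (fun x => (u x)%:C) -> aeq nu (Op (fun x => (u x)%:C)) (fun x => c * (u x)%:C).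
  apply: ge0_measurable_ind.
  - move=> A mA L2A; apply: (aeS2 (cE A mA _ (L2_cst 1)) Op1) => x.
    rewrite (_ : (fun x => cind A x * 1) = (fun x => (\1_A x : R)%:C)); last first.
      by apply/funext => y; rewrite mulr1.
    by move=> -> ->; rewrite mulrC.
  - move=> a f g a0 mf mg f0 g0 Pf Pg L2fg.
    have L2g : L2 nu (fun x => (g x)%:C).
      split; first exact: cmeasurable_real.
      apply: le_lt_trans L2fg.2; apply: ge0_le_integral => //.
      + by move=> x _; rewrite lee_fin sqn_ge0.
      + by apply/measurable_EFinP/measurable_sqn; exact: cmeasurable_real.
      + by apply/measurable_EFinP/measurable_sqn; exact: L2fg.1.
      + move=> x _; rewrite lee_fin !sqn_real lerXn2r ?nnegrE ?addr_ge0 ?mulr_ge0//.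
        by rewrite lerDr mulr_ge0.
    (* Square integrability of the sum gives that of [f] only if a is nonzero; otherwise [f]
       disappears from the sum. *)
    have [a_0|an0] := eqVneq a 0.
      have E : (fun x => (a * f x + g x)%:C) = (fun x => (g x)%:C).
        by apply/funext => x; rewrite a_0 mul0r add0r.
      rewrite E; apply: (aeS (Pg L2g)) => x ->.
      by rewrite a_0 mul0r add0r.
    have L2f : L2 nu (fun x => (f x)%:C).
      have := L2Z (a^-1)%:C (L2_lin (-1) L2g L2fg).
      rewrite (_ : (fun x => _) = (fun x => (f x)%:C))//; apply/funext => x.
      rewrite mulN1r addrC -rmorphB/= -rmorphM/= addrK mulrA mulVf// mul1r//.
    have E : (fun x => (a * f x + g x)%:C) = (fun x => a%:C * (f x)%:C + (g x)%:C).
      by apply/funext => x; rewrite rmorphD rmorphM.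
    rewrite E; apply: (aeS3 (op_lin a%:C L2f L2g) (Pf L2f) (Pg L2g)) => x -> -> ->.
    by rewrite rmorphD rmorphM; ring.
  - move=> f_ f mf_ mf f_0 nd cf Pf_ L2f.
    have f_f n x : f_ n x <= f x.
      rewrite -(cvg_lim _ (cf x))//; apply: nondecreasing_cvgn_le; first exact: nd.
      exact: cvgP (cf x).
    have L2f_ n : L2 nu (fun x => (f_ n x)%:C).
      split; first exact: cmeasurable_real.
      apply: le_lt_trans L2f.2; apply: ge0_le_integral => //.
      + by move=> x _; rewrite lee_fin sqn_ge0.
      + by apply/measurable_EFinP/measurable_sqn; exact: cmeasurable_real.
      + by apply/measurable_EFinP/measurable_sqn; exact: L2f.1.
      + move=> x _; rewrite lee_fin !sqn_real lerXn2r ?nnegrE//.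
        by rewrite (le_trans (f_0 n x)).
    pose v n x : R[i] := (f x - f_ n x)%:C.
    have L2v n : L2 nu (v n).
      have := L2_lin (-1) (L2f_ n) L2f.
      rewrite (_ : (fun x => _) = v n)//; apply/funext => x.
      by rewrite /v rmorphB; ring.
    have cvg_v : (\int[nu]_x (sqn (v n x))%:E @[n --> \oo] --> 0)%E.
      apply: (@sqn_dominated_cvg0 _ (fun x => sqn (f x)%:C)).
      - by move=> n; exact: (L2v n).1.
      - exact: measurable_sqn L2f.1.
      - by move=> x; exact: sqn_ge0.
      - exact: L2f.2.
      - move=> n x; rewrite !sqn_real lerXn2r ?nnegrE ?subr_ge0//.
          by rewrite (le_trans (f_0 n x)).
        by rewrite gerBl.
      - move=> x; under eq_fun do rewrite sqn_real expr2.
        have : f x - f_ n x @[n --> \oo] --> f x - f x by apply: cvgB => //; exact: cvg_cst.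
        by rewrite subrr => H; rewrite -(mulr0 0); apply: cvgM.
    have [M MP] := op_bound.
    pose D x := Op (fun x => (f x)%:C) x - c * (f x)%:C.
    have mD : cmeasurable D.
      have := (L2_lin (- c) L2f (op_L2 L2f)).1.
      by rewrite (_ : (fun x => _) = D)//; apply/funext => x; rewrite /D; ring.
    suff H : {ae nu, forall x, D x = 0} by apply: (aeS H) => x /eqP; rewrite subr_eq0 => /eqP.
    (* The defect is Op v_n - c v_n with v_n = f - f_n: the two terms contribute 2M and 2|c|^2 times
       the squared norm of v_n. *)
    apply: (@sqn_squeeze _ (2 * M + 2 * sqn c) (fun n => \int[nu]_x (sqn (v n x))%:E)%E) => // n.
    have sc0 : 0 <= 2 * sqn c by apply: mulr_ge0 => //; exact: sqn_ge0.
    have m1 := measurable_sqn (op_L2 (L2v n)).1.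
    have m2 := measurable_sqn (L2v n).1.
    have Dn : {ae nu, forall x, D x = Op (v n) x - c * v n x}.
      apply: (aeS2 (op_lin (-1) (L2f_ n) L2f) (Pf_ n (L2f_ n))) => x.
      rewrite (_ : (fun x => -1 * _ + _) = v n); last first.
        by apply/funext => y; rewrite /v rmorphB; ring.
      by move=> -> ->; rewrite /D /v rmorphB; ring.
    apply: (@le_trans _ _ (\int[nu]_x (2 * sqn (Op (v n) x) + 2 * sqn c * sqn (v n x))%:E)%E).
      apply: ae_ge0_le_integral => //.
      - by move=> x _; rewrite lee_fin sqn_ge0.
      - by apply/measurable_EFinP/measurable_sqn.
      - by move=> x _; rewrite lee_fin; apply: addr_ge0; apply: mulr_ge0 => //; exact: sqn_ge0.
      - by apply/measurable_EFinP; apply: measurable_funD; exact: measurable_funM.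
      - apply: (aeS Dn) => x -> _; rewrite lee_fin.
        have := sqnD (Op (v n) x) ((- c) * v n x).
        by rewrite sqnM (_ : sqn (- c) = sqn c) ?mulNr ?mulrA// !sqnE; case: (c) => a b /=; ring.
    rewrite (eq_integral (fun x => 2%:E * (sqn (Op (v n) x))%:E +
      (2 * sqn c)%:E * (sqn (v n x))%:E)%E)//.
    rewrite ge0_integralD//; last 4 first.
    - by move=> x _; rewrite -EFinM lee_fin mulr_ge0// sqn_ge0.
    - by apply: measurable_funeM; exact/measurable_EFinP.
    - by move=> x _; rewrite -EFinM lee_fin; apply: mulr_ge0 => //; exact: sqn_ge0.
    - by apply: measurable_funeM; exact/measurable_EFinP.
    rewrite ge0_integralZl//; last 2 first.
    - exact/measurable_EFinP.
    - by move=> x _; rewrite lee_fin sqn_ge0.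
    rewrite ge0_integralZl ?lee_fin//; last 2 first.
    - exact/measurable_EFinP.
    - by move=> x _; rewrite lee_fin sqn_ge0.
    have := MP _ (L2v n); rewrite (L2normsqE (L2v n)) (L2normsqE (op_L2 (L2v n))).
    rewrite -!EFinM -!EFinD !lee_fin; nra.
move=> f L2f; have [[m1 m2] If] := L2f.
have le_L2 (u : T -> R) : measurable_fun setT u -> (forall x, u x ^+ 2 <= sqn (f x)) ->
    L2 nu (fun x => (u x)%:C).
  move=> mu uf; split; first exact: cmeasurable_real.
  apply: le_lt_trans If; apply: ge0_le_integral => //.
  + by move=> x _; rewrite lee_fin sqn_ge0.
  + by apply/measurable_EFinP/measurable_sqn; exact: cmeasurable_real.
  + by apply/measurable_EFinP/measurable_sqn; exact: L2f.1.
  + by move=> x _; rewrite lee_fin sqn_real.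
have real (u : T -> R) : measurable_fun setT u -> (forall x, u x ^+ 2 <= sqn (f x)) ->
    aeq nu (Op (fun x => (u x)%:C)) (fun x => c * (u x)%:C).
  move=> mu uf.
  pose up x := Num.max (u x) 0; pose un x := Num.max (- u x) 0.
  have mup : measurable_fun setT up by apply: measurable_maxr.
  have mun : measurable_fun setT un.
    by apply: measurable_maxr => //; exact: measurable_funN.
  have up0 x : 0 <= up x by rewrite le_max lexx orbT.
  have un0 x : 0 <= un x by rewrite le_max lexx orbT.
  have uE x : u x = up x - un x.
    by rewrite /up /un; case: (leP (u x) 0) => ?; case: (leP (- u x) 0) => ?; lra.
  have L2p : L2 nu (fun x => (up x)%:C).
    apply: le_L2 => // x; apply: le_trans (uf x); rewrite /up.
    by case: (leP (u x) 0) => _; rewrite ?expr0n ?sqr_ge0.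
  have L2n : L2 nu (fun x => (un x)%:C).
    apply: le_L2 => // x; apply: le_trans (uf x); rewrite /un.
    by case: (leP (- u x) 0) => _; rewrite ?expr0n ?sqr_ge0 ?sqrrN.
  have E : (fun x => (u x)%:C) = (fun x => -1 * (un x)%:C + (up x)%:C).
    by apply/funext => x; rewrite uE rmorphB; ring.
  rewrite E; apply: (aeS3 (op_lin (-1) L2n L2p) (pos _ mup up0 L2p) (pos _ mun un0 L2n)).
  by move=> x -> -> ->; rewrite uE rmorphB; ring.
have re_le x : complex.Re (f x) ^+ 2 <= sqn (f x) by rewrite sqnE lerDl sqr_ge0.
have im_le x : complex.Im (f x) ^+ 2 <= sqn (f x) by rewrite sqnE lerDr sqr_ge0.
have E : f = (fun x => 'i * (complex.Im (f x))%:C + (complex.Re (f x))%:C).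
  by apply/funext => x; rewrite {1}(complexE (f x)) addrC.
rewrite {1}E; apply: (aeS3 (op_lin 'i (le_L2 _ m2 im_le) (le_L2 _ m1 re_le))
  (real _ m2 im_le) (real _ m1 re_le)) => x -> -> ->.
rewrite mulrCA -mulrDr; congr (c * _).
by rewrite [in RHS](complexE (f x)) addrC.
Qed.

End BoundedOperator.
End ComplexFunctions.

(** * Conditional probability of a set given a map *)

Section ConditionalDensity.
Context {d d' : measure_display} {T1 : measurableType d} {T2 : measurableType d'}.
Context {R : realType}.
Variables (nu : probability T1 R) (A : set T1) (th : T1 -> T2).
Hypotheses (mA : measurable A) (mth : measurable_fun setT th).

(* The two proofs are arguments so that the measure instances below can be
   inferred from the term. *)
Definition image_restr of measurable A & measurable_fun setT th : set T2 -> \bar R :=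
  fun B => nu (A `&` th @^-1` B).

Let m_pre B : measurable B -> measurable (A `&` th @^-1` B).
Proof.
by move=> mB; apply: measurableI => //; rewrite -[X in measurable X]setTI; exact: mth.
Qed.

Let image_restr0 : image_restr mA mth set0 = 0%E.
Proof. by rewrite /image_restr preimage_set0 setI0 measure0. Qed.

Let image_restr_ge0 B : (0 <= image_restr mA mth B)%E.
Proof. exact: measure_ge0. Qed.

Let image_restr_sigma_additive : semi_sigma_additive (image_restr mA mth).
Proof.
move=> F mF tF mUF; rewrite /image_restr preimage_bigcup setI_bigcupr.
apply: measure_semi_sigma_additive.
- by move=> n; exact: m_pre.
- apply/trivIsetP => i j _ _ ij; rewrite setIACA setIid.
  move/trivIsetP : tF => /(_ i j I I ij) FF.
  by rewrite -[X in A `&` X]/(th @^-1` (F i `&` F j)) FF preimage_set0 setI0.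
- by rewrite -setI_bigcupr -preimage_bigcup; exact: m_pre.
Qed.

HB.instance Definition _ := isMeasure.Build _ _ _ (image_restr mA mth)
  image_restr0 image_restr_ge0 image_restr_sigma_additive.

Let image_restr_fin : fin_num_fun (image_restr mA mth).
Proof. by move=> B mB; apply: fin_num_measure; exact: m_pre. Qed.

HB.instance Definition _ := @Measure_isFinite.Build _ _ _ (image_restr mA mth)
  image_restr_fin.

Variable mu : probability T2 R.
Hypothesis thmu : forall B, measurable B -> nu (th @^-1` B) = mu B.

(** A Radon-Nikodym derivative of [image_restr], which is dominated by the law [mu] of [th]; the
    domination also bounds the derivative by 1. *)
Lemma ex_conditional_density : exists h : T2 -> R,
  [/\ measurable_fun setT h, forall x, 0 <= h x <= 1 &
   forall psi : T2 -> R, measurable_fun setT psi -> (forall x, 0 <= psi x) ->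
   (\int[nu]_s (\1_A s * psi (th s))%:E = \int[mu]_x (h x * psi x)%:E)%E].
Proof.
have dom : image_restr mA mth `<< mu.
  apply/null_content_dominatesP => B mB B0.
  have : (image_restr mA mth B <= mu B)%E.
    rewrite -thmu//; apply: le_measure; rewrite ?in_setE; first exact: m_pre.
    - by rewrite -[X in measurable X]setTI; exact: mth.
    - exact: subIsetr.
  by rewrite B0 measure_le0 => /eqP.
have [f [f0 ffin fint fE]] := radon_nikodym_sigma_finite dom.
pose g x := fine (f x).
have fg x : (g x)%:E = f x by rewrite /g fineK.
have mg : measurable_fun setT g.
  apply/measurable_EFinP; rewrite (_ : EFin \o g = f).
    exact: measurable_int fint.
  by apply/funext => x; exact: fg.
have g0 x : 0 <= g x by rewrite -lee_fin fg.
have gE B : measurable B -> (\int[mu]_x (g x * \1_B x)%:E = nu (A `&` th @^-1` B))%E.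
  move=> mB; rewrite -integral_set_indic; apply: etrans (esym (fE B mB)).
  by apply: eq_integral => x _; rewrite fg.
(* On the set where the density exceeds 1, the excess integrates to the difference of a smaller and
   a larger measure, hence to 0. *)
pose C : set T2 := ~` [set x | g x <= 1].
have mC : measurable C by apply: measurableC; exact: measurable_sublevel.
have g1 : {ae mu, forall x, g x <= 1}.
  pose k x := (g x - 1) * \1_C x.
  have mk : measurable_fun setT k.
    by apply: measurable_funM; [exact: measurable_funB|exact: measurable_indic].
  have k0 x : 0 <= k x.
    rewrite /k indicE; case: (boolP (x \in C)) => [/set_mem/negP|_]; last by rewrite mulr0.
    by rewrite -ltNge mulr1 => /ltW; rewrite subr_ge0.
  have mIC : measurable_fun setT (\1_C : T2 -> R) by exact: measurable_indic.
  have kE : (\int[mu]_x (k x)%:E + mu C = nu (A `&` th @^-1` C))%E.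
    rewrite -gE// -[C in mu C]setIT -integral_indic// -ge0_integralD//.
    - by apply: eq_integral => x _; rewrite -EFinD /k; congr (_%:E); ring.
    - by move=> x _; rewrite lee_fin.
    - exact/measurable_EFinP.
    - exact/measurable_EFinP.
  have le : (nu (A `&` th @^-1` C) <= mu C)%E.
    rewrite -thmu//; apply: le_measure; rewrite ?in_setE; first exact: m_pre.
    - by rewrite -[X in measurable X]setTI; exact: mth.
    - exact: subIsetr.
  have Ik : (\int[mu]_x (k x)%:E = 0)%E.
    apply/eqP; rewrite eq_le integral_ge0 ?andbT; last by move=> x _; rewrite lee_fin.
    have fC : mu C \is a fin_num by exact: fin_num_measure.
    by rewrite -(leeD2rE _ _ fC) kE add0e.
  apply: (aeS (integral0_ae mk k0 Ik)) => x; rewrite /k indicE.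
  case: (boolP (x \in C)) => [_|xC _].
    by rewrite mulr1 => /eqP; rewrite subr_eq0 => /eqP ->.
  by apply: contrapT => h; move/negP: xC; apply; exact: mem_set.
(* Truncation replaces the a.e. bound by one valid everywhere. *)
pose h x := Num.min (g x) 1.
have mh : measurable_fun setT h by apply: measurable_minr.
have h01 x : 0 <= h x <= 1 by rewrite /h le_min g0 ler01 ge_min lexx orbT.
have h0 x : 0 <= h x by have /andP[] := h01 x.
exists h; split => //; apply: ge0_integral_transport => //.
move=> B mB; transitivity (nu (A `&` th @^-1` B)).
  rewrite -[A `&` _]setIT -integral_indic//; last exact: m_pre.
  by apply: eq_integral => s _; rewrite indicI.
rewrite -gE//; apply: ge0_ae_integral_eq => //.
- by move=> x; rewrite mulr_ge0.
- by move=> x; rewrite mulr_ge0.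
- by apply: measurable_funM => //; exact: measurable_indic.
- by apply: (aeS g1) => x gx; rewrite /h min_l.
Qed.

End ConditionalDensity.

Lemma ae_eq_of_integral d (T : measurableType d) (R : realType)
    (mu : {measure set T -> \bar R}) (f g : T -> R) :
  measurable_fun setT f -> measurable_fun setT g -> (forall x, 0 <= f x) ->
  (\int[mu]_x (f x)%:E < +oo)%E ->
  (forall E, measurable E -> \int[mu]_x (f x * \1_E x)%:E = \int[mu]_x (g x * \1_E x)%:E)%E ->
  {ae mu, forall x, f x = g x}.
Proof.
move=> mf mg f0 foo fg.
have : ae_eq mu setT (EFin \o f) (EFin \o g).
  apply: integral_ae_eq => //.
  - apply/integrableP; split; first exact/measurable_EFinP.
    by under eq_integral do rewrite gee0_abs ?lee_fin//.
  - exact/measurable_EFinP.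
  - by move=> E _ mE; have := fg E mE; rewrite -!integral_set_indic.
by move=> H; apply: (aeS H) => x /(_ I) [].
Qed.

(** * Irreducibility and ergodicity *)
Section Equivalences.
Variables (R : realType) (X : pseudoPMetricType R) (r : X -> X).
Variable mu : probability (borel X) R.
Hypothesis rfin : forall x, finite_set (fibre r x) /\ fibre r x !=set0.
Hypothesis muinv : strongly_invariant r mu.
Hypothesis mr : measurable_fun setT (r : borel X -> borel X).
Variable m0 : borel X -> R[i].
Let w : borel X -> R := fun x => sqn (m0 x).
Hypothesis mm0 : Linf mu m0.
Hypothesis mw : measurable_fun setT w.
Hypothesis w1 : forall x, Tavg r w x = 1.
Variable nu : probability (seqspace X) R.
Hypothesis nuP : solenoid_measure r m0 mu nu.
Local Open Scope complex_scope.

Let w0 x : 0 <= w x. Proof. exact: sqn_ge0. Qed.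
Let integral_coord0' := integral_coord0 rfin nuP.
Let integral_rinf' := integral_rinf rfin muinv mr mw w1 nuP.

Lemma Linf_sqn (g : borel X -> R[i]) : Linf mu g ->
  exists M, {ae mu, forall x, sqn (g x) <= M}.
Proof.
move=> [mg [M gM]]; exists (M ^+ 2); apply: (aeS gM) => x gx.
rewrite /sqn lerXn2r// ?nnegrE ?sqrtr_ge0//.
by rewrite (le_trans (sqrtr_ge0 _) gx).
Qed.

Lemma cmeasurable_coord0 (g : borel X -> R[i]) : cmeasurable g ->
  cmeasurable (fun s : seqspace X => g (s 0%N)).
Proof.
by move=> [m1 m2]; split; [apply: (measurableT_comp m1)|apply: (measurableT_comp m2)];
  exact: measurable_coord.
Qed.

Lemma cmeasurable_rinf (f : seqspace X -> R[i]) : cmeasurable f ->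
  cmeasurable (fun s => f (rinf r s)).
Proof.
by move=> [m1 m2]; split; [apply: (measurableT_comp m1)|apply: (measurableT_comp m2)];
  exact: measurable_rinf.
Qed.

Lemma cmeasurable_Uop (f : seqspace X -> R[i]) : cmeasurable f ->
  cmeasurable (Uop r m0 f).
Proof.
move=> mf; apply: cmeasurableM; first exact: cmeasurable_coord0 mm0.1.
exact: cmeasurable_rinf.
Qed.

Lemma integral_Uop (f : seqspace X -> R[i]) : cmeasurable f ->
  (\int[nu]_s (sqn (Uop r m0 f s))%:E = \int[nu]_s (sqn (f s))%:E)%E.
Proof.
move=> mf; rewrite -(integral_rinf' (measurable_sqn mf)); last by move=> s; exact: sqn_ge0.
by apply: eq_integral => s _; rewrite /Uop sqnM.
Qed.

Lemma L2_Uop f : L2 nu f -> L2 nu (Uop r m0 f).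
Proof. by move=> [mf ff]; split; [exact: cmeasurable_Uop|rewrite integral_Uop]. Qed.

Lemma Uop_inj f g : L2 nu f -> L2 nu g -> aeq nu (Uop r m0 f) (Uop r m0 g) -> aeq nu f g.
Proof.
move=> L2f L2g Ufg.
have [mv _] : L2 nu (fun s => -1 * g s + f s) by exact: L2_lin.
suff H : {ae nu, forall s, -1 * g s + f s = 0}.
  by apply: (aeS H) => s /eqP; rewrite mulN1r addrC subr_eq0 => /eqP.
apply: sqn_int0_ae => //; rewrite -integral_Uop//.
rewrite (@ge0_ae_integral_eq _ _ _ nu _ (cst 0)) ?integral0//.
- by move=> s; exact: sqn_ge0.
- apply: (aeS Ufg) => s; rewrite /Uop => E.
  by rewrite mulrDr mulrCA -E mulN1r addNr sqn0.
Qed.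

Lemma Linf_cind (B : set (borel X)) : measurable B -> Linf mu (cind B).
Proof.
move=> mB; split; first exact: cmeasurable_cind.
exists 1; apply: aeW => x; rewrite /cabs -sqnE.
by rewrite -[leRHS]sqrtr1 ler_wsqrtr// sqn_cind_le1.
Qed.

Section Commutant.
Variable Op : (seqspace X -> R[i]) -> seqspace X -> R[i].
Hypothesis bOp : bounded_op nu Op.
Hypothesis OpU : forall f, L2 nu f -> aeq nu (Op (Uop r m0 f)) (Uop r m0 (Op f)).
Hypothesis Oppi : forall g, Linf mu g -> forall f, L2 nu f ->
  aeq nu (Op (piop g f)) (piop g (Op f)).

Let cyl n (B : set (borel X)) : set (seqspace X) := [set s | B (s n)].

Let mcyl n B : measurable B -> measurable (cyl n B).
Proof. by move=> mB; apply: sub_sigma_algebra; exists n, B. Qed.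

(* U intertwines the multiplications by 1_B(x_(n+1)) and 1_B(x_n) and is
   injective, so commutation propagates from x_n to x_(n+1). *)
Lemma commutes_coord n B : measurable B -> commutes_ind nu Op (cyl n B).
Proof.
move=> mB; elim: n => [|n IH] f L2f.
  have E g : (fun s => cind (cyl 0 B) s * g s) = piop (cind B) g.
    by apply/funext => s; rewrite /piop !cindE.
  by apply: (aeS (Oppi (Linf_cind mB) L2f)) => s; rewrite E => ->; rewrite -E.
have E g : Uop r m0 (fun s => cind (cyl n.+1 B) s * g s) =
           (fun s => cind (cyl n B) s * Uop r m0 g s).
  by apply/funext => s; rewrite /Uop mulrCA !cindE.
have L2nf := L2_cind (mcyl n.+1 mB) L2f.
have L2O := op_L2 bOp L2f.
apply: Uop_inj; [exact: op_L2|exact: L2_cind (mcyl _ mB) L2O|].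
rewrite E; apply: (aeS3 (OpU L2nf) (OpU L2f) (IH _ (L2_Uop L2f))) => s <- <-.
by rewrite E.
Qed.

Lemma commutes_rect E : rects E -> commutes_ind nu Op E.
Proof.
move=> [n [B [mB ->]]]; elim: n => [|n IH].
  rewrite (_ : rect 0 B = cyl 0 (B 0%N)); first exact: commutes_coord.
  by apply/seteqP; split=> s => [|sB [|//] _]; [exact|].
rewrite (_ : rect n.+1 B = rect n B `&` cyl n.+1 (B n.+1)).
  apply: commutes_indI => //; [exact: measurable_rect|exact: mcyl|exact: commutes_coord].
apply/seteqP; split=> s => [sB|[sB sn] k].
  by split; [move=> k kn; apply: sB; exact: leqW|exact: sB].
by rewrite leq_eqVlt => /predU1P[->//|]; rewrite ltnS; exact: sB.
Qed.

Lemma commutant_scalar c : aeq nu (Op (fun=> 1)) (fun=> c) ->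
  forall f, L2 nu f -> aeq nu (Op f) (fun s => c * f s).
Proof.
apply: commutes_ind_scalar => //.
apply: (commutes_ind_pi_system bOp (@measurable_rectsE _ _) (@rects_setI _ _)).
exact: commutes_rect.
Qed.

(** U and pi(m_0) send the constant 1 to the same function, and [Op] commutes with both. *)
Lemma commutant_one_fixed :
  aeq nu (Uop r m0 (Op (fun=> 1))) (piop m0 (Op (fun=> 1))).
Proof.
have L21 : L2 nu (fun=> 1 : R[i]) by exact: L2_cst.
apply: (aeS2 (OpU L21) (Oppi mm0 L21)) => s <- <-.
by congr (Op _ s); apply/funext => t.
Qed.

End Commutant.

Lemma irreducible_of_fixed_const :
  (forall phi, L2 nu phi -> aeq nu (Uop r m0 phi) (piop m0 phi) ->
    exists c, aeq nu phi (fun=> c)) ->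
  irreducible_wavelet r m0 mu nu.
Proof.
move=> fixc Op bOp OpU Oppi.
have [c cE] := fixc _ (op_L2 bOp (L2_cst _ _)) (commutant_one_fixed OpU Oppi).
by exists c; exact: commutant_scalar cE.
Qed.

Lemma ergodic_of_irreducible :
  irreducible_wavelet r m0 mu nu -> ergodic nu (rinf r).
Proof.
move=> irr A mA Ainv.
have rA s : cind A (rinf r s) = cind A s.
  by rewrite !cindE; congr (_%:R); rewrite -{2}Ainv.
have bA : bounded_op nu (fun f s => cind A s * f s).
  split.
  - by move=> f; exact: L2_cind.
  - by move=> f g _ _ fg; apply: (aeS fg) => s ->.
  - by move=> a f g _ _; apply: aeW => s; ring.
  - exists 1 => f L2f; rewrite -lee_fin EFinM -L2normsqE//; last exact: L2_cind.
    rewrite -L2normsqE//; apply: integral_sqnM_le => //.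
    + exact: cmeasurable_cind.
    + exact: L2f.1.
    + by apply: aeW => s; exact: sqn_cind_le1.
have [||c /(_ _ (L2_cst nu 1)) cE] := irr _ bA.
- by move=> f L2f; apply: aeW => s; rewrite /Uop rA; ring.
- by move=> g Lg f L2f; apply: aeW => s; rewrite /piop; ring.
(* The scalar agrees a.e. with the indicator of [A]: if it is 1, the complement is null; if not, [A]
   itself is. *)
have [c1|c1] := eqVneq c 1; [right|left].
- have : nu (~` A) = 0%E.
    apply: measure_negligible; first exact: measurableC.
    move: cE => [N [mN N0 AN]]; exists N; split => // s As; apply: AN => /=.
    rewrite cindE memNset// c1 mul1r mul0r => /eqP; by rewrite eq_sym oner_eq0.
  rewrite probability_setC// => /eqP; rewrite sube_eq//.
  by rewrite add0e eq_sym => /eqP.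
- apply: measure_negligible => //.
  move: cE => [N [mN N0 AN]]; exists N; split => // s As; apply: AN => /=.
  by rewrite cindE mem_set// !mulr1 => /eqP; rewrite eq_sym (negbTE c1).
Qed.

Lemma transfer_Re (h : borel X -> R[i]) x :
  complex.Re (transfer r m0 h x) = Rw r w (fun y => complex.Re (h y)) x.
Proof.
rewrite /transfer fsbig_finite; last exact: (rfin x).1.
rewrite /Rw TavgE// cReM/= mul0r subr0; congr (_ * _).
elim: (enum_fset (fset_set (fibre r x))) => [|y s IH]; first by rewrite !big_nil.
by rewrite !big_cons cReD IH cReM/= mul0r subr0.
Qed.

Lemma transfer_Im (h : borel X -> R[i]) x :
  complex.Im (transfer r m0 h x) = Rw r w (fun y => complex.Im (h y)) x.
Proof.
rewrite /transfer fsbig_finite; last exact: (rfin x).1.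
rewrite /Rw TavgE// cImM/= mul0r addr0; congr (_ * _).
elim: (enum_fset (fset_set (fibre r x))) => [|y s IH]; first by rewrite !big_nil.
by rewrite !big_cons cImD IH cImM/= mul0r addr0.
Qed.

(** A form of (iii) for nonnegative real functions bounded at every point; conditional densities are
    of this kind, and the martingale argument needs such functions. *)
Definition bounded_fixed_const := forall (h : borel X -> R) (M : R),
  measurable_fun setT h -> (forall x, 0 <= h x <= M) ->
  {ae mu, forall x, Rw r w h x = h x} -> exists c, {ae mu, forall x, h x = c}.

Lemma bounded_fixed_const_real :
  (forall h : X -> R[i], Linf mu h -> aeq mu (transfer r m0 h) h -> ae_constant mu h) ->
  bounded_fixed_const.
Proof.
move=> H h M mh hM Rh.
have [||c cE] := H (fun x => (h x)%:C).
- split; first exact: cmeasurable_real.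
  exists M; apply: aeW => x; rewrite /cabs/= expr0n addr0 sqrtr_sqr.
  by have /andP[h0 h1] := hM x; rewrite ger0_norm.
- apply: (aeS Rh) => x Rhx; apply/eqP; rewrite eq_complex.
  rewrite transfer_Re transfer_Im/= Rhx eqxx/=.
  by rewrite (Rw_cst rfin w1).
by exists (complex.Re c); apply: (aeS cE) => x <-.
Qed.

(** On the solenoid each coordinate determines the earlier ones, so a condition on finitely many
    coordinates is a condition on the last. *)
Lemma coord_of_solenoid s n k : in_solenoid r s -> s k = iter n r (s (n + k)%N).
Proof. by move=> sol; elim: n => [//|n IH]; rewrite IH iterSr addSn sol. Qed.

Lemma measurable_iter n : measurable_fun setT (iter n r : borel X -> borel X).
Proof.
elim: n => [|n IH]; first exact: measurable_id.
exact: (measurableT_comp mr IH).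
Qed.

Lemma measurable_comp_coord n (psi : borel X -> R) : measurable_fun setT psi ->
  measurable_fun setT (fun s : seqspace X => psi (s n)).
Proof. by move=> mpsi; apply: (measurableT_comp mpsi); exact: measurable_coord. Qed.

(* The conditional density h of an invariant set A given x_0 is a fixed point; if
   it is constant, then A is independent of every x_n, by invariance. A cylinder is
   a condition on its last coordinate, because x_k = r^(n-k)(x_n), so A is
   independent of itself. *)
Lemma ergodic_of_bounded_fixed_const : bounded_fixed_const -> ergodic nu (rinf r).
Proof.
move=> fixc A mA Ainv.
have mIA : measurable_fun setT (\1_A : seqspace X -> R) by exact: measurable_indic.
have rA s : \1_A (rinf r s) = \1_A s :> R.
  by rewrite !indicE; congr (_%:R); rewrite -{2}Ainv.
have thmu B : measurable B -> nu ((fun s : seqspace X => s 0%N : borel X) @^-1` B) = mu B.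
  move=> mB; have mI : measurable_fun setT (\1_B : borel X -> R) by exact: measurable_indic.
  have := integral_coord0' mI (fun=> ler0n R _).
  rewrite [RHS]integral_indic// setIT => <-.
  rewrite -[X in nu X]setIT -integral_indic//.
  by rewrite -[X in measurable X]setTI; exact: measurable_coord.
have [h [mh h01 hE]] := ex_conditional_density mA (@measurable_coord _ X 0) thmu.
have h0 x : 0 <= h x by have /andP[] := h01 x.
have hoo : (\int[mu]_x (h x)%:E < +oo)%E.
  apply: (@le_lt_trans _ _ (\int[mu]_x (cst 1%E x))%E).
    apply: ge0_le_integral => //.
    - by move=> x _; rewrite lee_fin.
    - exact/measurable_EFinP.
    - by move=> x _; rewrite lee_fin; have /andP[] := h01 x.
  rewrite integral_cst// mul1e [X in (X < _)%E](_ : _ = 1%E) ?ltry//.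
  exact: probability_setT.
have [q [mq q0 qE]] := ex_version rfin muinv mw w0 mh h0.
(* The fixed point equation is tested on a Borel set E: change of variables, invariance of [A], the
   density property with weight w 1_E(r x), then duality. *)
have hq : {ae mu, forall x, h x = q x}.
  apply: (ae_eq_of_integral mh mq h0 hoo) => E mE.
  have mIE : measurable_fun setT (\1_E : borel X -> R) by exact: measurable_indic.
  have mrE : measurable_fun setT (fun x => w x * \1_E (r x) : R).
    by apply: measurable_funM => //; exact: (measurableT_comp mIE mr).
  rewrite -hE// -integral_rinf'; last 2 first.
  - apply: measurable_funM => //; exact: (measurable_comp_coord 0 mIE).
  - by move=> s; rewrite mulr_ge0.
  transitivity (\int[mu]_x (\1_E x * q x)%:E)%E; last first.
    by apply: eq_integral => x _; rewrite mulrC.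
  rewrite (integral_version rfin muinv mr mw w0 mIE _ mh h0)//.
  transitivity (\int[nu]_s (\1_A s * (w (s 0%N) * \1_E (r (s 0%N))))%:E)%E.
    by apply: eq_integral => s _; rewrite rA; congr (_%:E); rewrite /rinf mulrCA.
  rewrite (hE _ mrE); last by move=> x; rewrite mulr_ge0.
  by apply: eq_integral => x _; congr (_%:E); ring.
have [|c hc] := fixc h 1 mh h01.
  by apply: (aeS2 hq qE) => x -> <-.
have c0 : 0 <= c.
  rewrite leNgt; apply/negP => clt; apply: (@ae_False _ _ _ mu).
  by apply: (aeS hc) => x hx; move: (h0 x); rewrite hx leNgt clt.
(* Induction through [rinf], which replaces x_{n+1} by x_n; the weight at x_0 that appears is
   rewritten as a function of x_n and joined to [psi], giving [psi']. *)
have indep n : forall psi : borel X -> R, measurable_fun setT psi ->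
    (forall x, 0 <= psi x) ->
    (\int[nu]_s (\1_A s * psi (s n))%:E = \int[nu]_s (c * psi (s n))%:E)%E.
  elim: n => [|n IH] psi mpsi psi0.
    rewrite hE// (@integral_coord0' (fun x => c * psi x)); last 2 first.
    - exact: measurable_funM.
    - by move=> x; rewrite mulr_ge0.
    apply: ge0_ae_integral_eq => //.
    - by move=> x; rewrite mulr_ge0.
    - by move=> x; rewrite mulr_ge0.
    - exact: measurable_funM.
    - by apply: (aeS hc) => x ->.
  pose psi' (x : borel X) := w (iter n r x) * psi x.
  have mpsi' : measurable_fun setT psi'.
    by apply: measurable_funM => //; exact: (measurableT_comp mw (measurable_iter n)).
  have psi'0 x : 0 <= psi' x by rewrite mulr_ge0.
  have mpn := measurable_comp_coord n.+1 mpsi.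
  have sol : {ae nu, forall s : seqspace X, w (s 0%N) = w (iter n r (s n))}.
    by apply: (aeS nuP.1) => s /(coord_of_solenoid n 0); rewrite addn0 => ->.
  rewrite -integral_rinf'; last 2 first.
  - exact: measurable_funM.
  - by move=> s; rewrite mulr_ge0.
  rewrite -[RHS]integral_rinf'; last 2 first.
  - exact: measurable_funM.
  - by move=> s; rewrite mulr_ge0.
  have mpn' := measurable_comp_coord n mpsi'.
  transitivity (\int[nu]_s (\1_A s * psi' (s n))%:E)%E.
    apply: ge0_ae_integral_eq.
    - by move=> s; apply: mulr_ge0; [exact: w0|exact: mulr_ge0].
    - by move=> s; rewrite mulr_ge0.
    - exact: measurable_funM.
    - apply: (aeS sol) => s E; rewrite rA /psi' -E /w -[rinf r s n.+1]/(s n); ring.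
  rewrite IH//; apply/esym; apply: ge0_ae_integral_eq.
  - by move=> s; apply: mulr_ge0; [exact: w0|exact: mulr_ge0].
  - by move=> s; rewrite mulr_ge0.
  - exact: measurable_funM.
  - apply: (aeS sol) => s E; rewrite /psi' -E /w -[rinf r s n.+1]/(s n); ring.
have total : (\int[nu]_s (\1_A s)%:E = \int[nu]_s (cst c s)%:E)%E.
  have := indep 0%N (cst 1) (measurable_cst _) (fun=> ler01).
  by under eq_integral do rewrite mulr1; under [in RHS]eq_integral do rewrite mulr1.
have nuA : nu A = c%:E.
  rewrite -[A]setIT -integral_indic// total.
  rewrite -[LHS]/(\int[nu]_s (cst c%:E s))%E integral_cst// -[RHS]mule1; congr (_ * _)%E.
  exact: probability_setT.
have key : (\int[nu]_s (\1_A s * \1_A s)%:E = \int[nu]_s (cst c s * \1_A s)%:E)%E.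
  apply: (@integral_transport_pi_system _ _ _ _ _ nu nu (\1_A) (cst c) id (@rects _ X)) => //.
  - exact: measurable_rectsE.
  - exact: rects_setI.
  - have nuAoo : (nu A < +oo)%E by rewrite nuA ltry.
    by rewrite integral_indic// setIT.
  move=> _ [n [B [mB ->]]].
  (* The rectangle as a condition on x_n, through x_k = r^(n-k)(x_n). *)
  pose B' : set (borel X) := \bigcap_(k in [set k | (k <= n)%N]) ((iter (n - k) r) @^-1` B k).
  have mB' : measurable B'.
    apply: bigcap_measurable => [|k _]; first by exists 0%N.
    by rewrite -[X in measurable X]setTI; exact: measurable_iter.
  have mIB' : measurable_fun setT (\1_B' : borel X -> R) by exact: measurable_indic.
  have sol : {ae nu, forall s : seqspace X, \1_(rect n B) s = \1_B' (s n) :> R}.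
    apply: (aeS nuP.1) => s sols; rewrite !indicE; congr (nat_of_bool _)%:R.
    have sk k : (k <= n)%N -> s k = iter (n - k) r (s n).
      by move=> kn; rewrite (coord_of_solenoid (n - k) k sols) subnK.
    apply/idP/idP => /set_mem H; apply: mem_set => k /= kn; last by rewrite sk//; exact: H.
    by rewrite -sk//; exact: H.
  have mR : measurable_fun setT (\1_(rect n B) : seqspace X -> R).
    by apply: measurable_indic; exact: measurable_rect.
  have mB'n := measurable_comp_coord n mIB'.
  transitivity (\int[nu]_s (\1_A s * \1_B' (s n))%:E)%E.
    apply: ge0_ae_integral_eq.
    - by move=> s; rewrite mulr_ge0.
    - by move=> s; rewrite mulr_ge0.
    - exact: measurable_funM.
    - by apply: (aeS sol) => s ->.
  rewrite indep//; apply/esym; apply: ge0_ae_integral_eq.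
  - by move=> s; rewrite mulr_ge0.
  - by move=> s; rewrite mulr_ge0.
  - exact: measurable_funM.
  - by apply: (aeS sol) => s ->.
(* Independence of [A] from itself: its measure is its own square. *)
have : (c%:E = c%:E * c%:E)%E.
  rewrite -{1}nuA -{2}nuA -{1}[A]setIT -integral_indic//.
  transitivity (\int[nu]_s (\1_A s * \1_A s)%:E)%E.
    by apply: eq_integral => s _; rewrite indicE; case: (_ \in _); rewrite ?mulr1 ?mulr0.
  rewrite key -[A in nu A]setIT -integral_indic// -ge0_integralZl//.
  exact/measurable_EFinP.
rewrite -EFinM => -[] /eqP; rewrite -[X in X == _]mulr1 -subr_eq0 -mulrBr mulf_eq0.
move=> /orP[/eqP c_0|/eqP c_1]; [left|right]; apply: (etrans nuA); congr (_%:E); lra.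
Qed.

End Equivalences.

(** * Almost everywhere convergence from geometric bounds *)

Lemma cvg_of_geometric_bound (R : realType) (u : nat -> R) (C : R) :
  (forall k, `|u k.+1 - u k| <= C / 2 ^+ k) -> cvgn u.
Proof.
move=> uC.
have C0 : 0 <= C by have := uC 0%N; rewrite expr0 divr1; exact: le_trans.
suff : cvgn (series (telescope u)).
  rewrite telescopeK => /cvg_ex[l ul]; apply/cvg_ex; exists (l + u 0%N).
  have : (fun n => (u n - u 0%N) + u 0%N) @ \oo --> l + u 0%N.
    by apply: cvgD => //; exact: cvg_cst.
  by under eq_fun do rewrite subrK.
apply: normed_cvg; apply: (@series_le_cvg _ _ (geometric C (2^-1))).
- by move=> n /=.
- by move=> n; rewrite /geometric/= mulr_ge0// exprn_ge0.
- by move=> n; rewrite /telescope/geometric/= exprVn; exact: uC.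
- by apply: is_cvg_geometric_series; rewrite ger0_norm// invf_lt1// ltr1n.
Qed.

(** The series of $4^k u_k^2$ has integral at most $\sum 4^k 16^{-k} < \infty$, so it is finite
    a.e., and each of its terms is bounded by its sum S. *)
Lemma ae_geometric_bound d (T : measurableType d) (R : realType)
    (nu : {measure set T -> \bar R}) (u : nat -> T -> R) :
  (forall k, measurable_fun setT (u k)) ->
  (forall k, (\int[nu]_x (u k x ^+ 2)%:E <= (16^-1 ^+ k)%:E)%E) ->
  {ae nu, forall x, exists C, forall k, `|u k x| <= C / 2 ^+ k}.
Proof.
move=> mu_ Iu.
pose v k x := 4 ^+ k * u k x ^+ 2.
have mv k : measurable_fun setT (v k).
  by apply: measurable_funM => //; exact: measurable_funX.
have v0 k x : 0 <= v k x by rewrite mulr_ge0 ?sqr_ge0// exprn_ge0.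
have mS : measurable_fun setT (fun x => \sum_(k <oo) (v k x)%:E)%E.
  apply: ge0_emeasurable_sum => [k x _ _|k _]; first by rewrite lee_fin.
  exact/measurable_EFinP.
have SE : (\int[nu]_x (\sum_(k <oo) (v k x)%:E) < +oo)%E.
  rewrite integral_nneseries//; last 2 first.
  - by move=> k; exact/measurable_EFinP.
  - by move=> k x _; rewrite lee_fin.
  apply: (@le_lt_trans _ _ (\sum_(k <oo) (1 / (2 ^ (k + 0))%:R)%:E)%E).
    apply: lee_nneseries => [k _ _|k _]; first by apply: integral_ge0 => x _; rewrite lee_fin.
    under eq_integral do rewrite /v EFinM.
    rewrite ge0_integralZl//; last 2 first.
    - by apply/measurable_EFinP; exact: measurable_funX.
    - by move=> x _; rewrite lee_fin sqr_ge0.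
    apply: (@le_trans _ _ ((4 ^+ k)%:E * (16^-1 ^+ k)%:E)%E).
      by rewrite lee_pmul2l ?lte_fin ?exprn_gt0.
    rewrite -EFinM lee_fin -exprMn addn0 div1r natrX -exprVn.
    by rewrite lerXn2r ?nnegrE//; lra.
  rewrite (_ : limn _ = (2 : R)%:E) ?ltry//.
  have := @cvg_geometric_eseries_half R 2 0; rewrite expr0 divr1.
  move=> /cvg_lim <-//; congr (limn _); apply/funext => n; apply: eq_bigr => k _.
  by rewrite addn0 addn1 expnS natrM invfM mulrA divff.
have iS : nu.-integrable setT (fun x => \sum_(k <oo) (v k x)%:E)%E.
  apply/integrableP; split => //.
  rewrite (eq_integral (fun x => \sum_(k <oo) (v k x)%:E)%E)// => x _.
  by rewrite gee0_abs// nneseries_ge0// => k _ _; rewrite lee_fin.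
have H := integrable_ae measurableT iS.
apply: (aeS H) => x /(_ I) Sfin.
pose S := fine (\sum_(k <oo) (v k x)%:E)%E.
have vS k : v k x <= S.
  rewrite -lee_fin /S fineK//.
  apply: le_trans (nneseries_lim_ge k.+1 _); last by move=> j _ _; rewrite lee_fin.
  rewrite big_mkord big_ord_recr/= leeDr// sume_ge0// => j _; by rewrite lee_fin.
(* Adding 1 avoids a square root: S <= (1 + S)^2. *)
exists (1 + S) => k.
have S0 : 0 <= S by apply: le_trans (v0 0%N x) (vS 0%N).
rewrite ler_pdivlMr ?exprn_gt0// -(@ler_pXn2r _ 2)// ?nnegrE ?mulr_ge0 ?exprn_ge0 ?addr_ge0//.
have -> : (`|u k x| * 2 ^+ k) ^+ 2 = v k x.
  rewrite exprMn real_normK ?num_real// mulrC exprAC /v; congr (_ ^+ k * _).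
  by ring.
by apply: le_trans (vS k) _; nra.
Qed.

(** * Bounded fixed points *)
Section Martingale.
Variables (R : realType) (X : pseudoPMetricType R) (r : X -> X).
Variable mu : probability (borel X) R.
Hypothesis rfin : forall x, finite_set (fibre r x) /\ fibre r x !=set0.
Hypothesis muinv : strongly_invariant r mu.
Hypothesis mr : measurable_fun setT (r : borel X -> borel X).
Variable m0 : borel X -> R[i].
Let w : borel X -> R := fun x => sqn (m0 x).
Hypothesis mw : measurable_fun setT w.
Hypothesis w1 : forall x, Tavg r w x = 1.
Variable nu : probability (seqspace X) R.
Hypothesis nuP : solenoid_measure r m0 mu nu.

Let w0 x : 0 <= w x. Proof. exact: sqn_ge0. Qed.
Let integral_coord0' := integral_coord0 rfin nuP.
Let integral_rinf' := integral_rinf rfin muinv mr mw w1 nuP.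

Let mcc := @measurable_comp_coord R X.

Variables (h : borel X -> R) (M : R).
Hypothesis mh : measurable_fun setT h.
Hypothesis h0M : forall x, 0 <= h x <= M.
Hypothesis Rh : {ae mu, forall x, Rw r w h x = h x}.

Let h0 x : 0 <= h x. Proof. by have /andP[] := h0M x. Qed.
Let hM x : h x <= M. Proof. by have /andP[] := h0M x. Qed.
Let M0 : 0 <= M. Proof. exact: le_trans (h0 point) (hM point). Qed.

(** One martingale step. At n = 0 it is the fixed point equation in dual form; [rinf] raises the
    index, its weight being absorbed into the test function of x_n. *)
Lemma integral_coordS n (psi : borel X -> R) : measurable_fun setT psi ->
  (forall x, 0 <= psi x) ->
  (\int[nu]_s (psi (s n) * h (s n.+1))%:E = \int[nu]_s (psi (s n) * h (s n))%:E)%E.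
Proof.
elim: n psi => [|n IH] psi mpsi psi0.
  have m01 : measurable_fun setT (fun s : seqspace X => psi (s 0%N) * h (s 1%N)).
    by apply: measurable_funM; exact: mcc.
  have mpr : measurable_fun setT (fun x => w x * (psi (r x) * h x)).
    by apply: measurable_funM => //; apply: measurable_funM => //; exact: (measurableT_comp mpsi mr).
  rewrite -integral_rinf'//; last by move=> s; rewrite mulr_ge0.
  rewrite /rinf (integral_coord0' mpr); last first.
    by move=> x; apply: mulr_ge0; [exact: w0|exact: mulr_ge0].
  have mph : measurable_fun setT (fun x => psi x * h x) by exact: measurable_funM.
  rewrite (integral_coord0' mph); last by move=> x; rewrite mulr_ge0.
  rewrite -(integral_version rfin muinv mr mw w0 mpsi psi0 mh h0 (q := h))//.
  by split => //; apply: (aeS Rh) => x ->.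
pose psi' (x : borel X) := w (iter n r x) * psi x.
have mpsi' : measurable_fun setT psi'.
  by apply: measurable_funM => //; exact: (measurableT_comp mw (measurable_iter mr n)).
have psi'0 x : 0 <= psi' x by rewrite mulr_ge0.
have sol : {ae nu, forall s : seqspace X, w (s 0%N) = w (iter n r (s n))}.
  by apply: (aeS nuP.1) => s /(coord_of_solenoid n 0); rewrite addn0 => ->.
have m1 k l : measurable_fun setT (fun s : seqspace X => psi (s k) * h (s l)).
  by apply: measurable_funM; exact: mcc.
have m1' k l : measurable_fun setT (fun s : seqspace X => psi' (s k) * h (s l)).
  by apply: measurable_funM; exact: mcc.
have p0 k l (s : seqspace X) : 0 <= psi (s k) * h (s l) by rewrite mulr_ge0.
have p0' k l (s : seqspace X) : 0 <= psi' (s k) * h (s l) by rewrite mulr_ge0.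
rewrite -(integral_rinf' (m1 _ _) (p0 _ _)) -[RHS](integral_rinf' (m1 _ _) (p0 _ _)).
transitivity (\int[nu]_s (psi' (s n) * h (s n.+1))%:E)%E.
  apply: ge0_ae_integral_eq => //.
    by move=> s; apply: mulr_ge0; [exact: w0|exact: mulr_ge0].
  apply: (aeS sol) => s E; rewrite /psi' -E /w -[rinf r s n.+1]/(s n) -[rinf r s n.+2]/(s n.+1).
  by ring.
rewrite IH//; apply/esym; apply: ge0_ae_integral_eq => //.
- by move=> s; apply: mulr_ge0; [exact: w0|exact: mulr_ge0].
- by apply: (aeS sol) => s E; rewrite /psi' -E /w -[rinf r s n.+1]/(s n); ring.
Qed.

(** A test function of x_m is also one of every later coordinate, through iterates of [r], so single
    steps can be chained. *)
Lemma integral_coord_martingale m n (psi : borel X -> R) : measurable_fun setT psi ->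
  (forall x, 0 <= psi x) ->
  (\int[nu]_s (psi (s m) * h (s (n + m)%N))%:E = \int[nu]_s (psi (s m) * h (s m))%:E)%E.
Proof.
move=> mpsi psi0; elim: n => [//|n IH]; rewrite -IH.
pose psi' (x : borel X) := psi (iter n r x).
have mpsi' : measurable_fun setT psi' by exact: (measurableT_comp mpsi (measurable_iter mr n)).
have sol : {ae nu, forall s : seqspace X, psi (s m) = psi' (s (n + m)%N)}.
  by apply: (aeS nuP.1) => s /(coord_of_solenoid n m) ->.
have psi'0 x : 0 <= psi' x by exact: psi0.
have m1 k l : measurable_fun setT (fun s : seqspace X => psi (s k) * h (s l)).
  by apply: measurable_funM; exact: mcc.
have m1' k l : measurable_fun setT (fun s : seqspace X => psi' (s k) * h (s l)).
  by apply: measurable_funM; exact: mcc.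
transitivity (\int[nu]_s (psi' (s (n + m)%N) * h (s (n + m).+1))%:E)%E.
  apply: ge0_ae_integral_eq => //; [by move=> s; rewrite mulr_ge0|by move=> s; rewrite mulr_ge0|].
  by apply: (aeS sol) => s ->.
rewrite integral_coordS//.
apply/esym; apply: ge0_ae_integral_eq => //; [by move=> s; rewrite mulr_ge0|by move=> s; rewrite mulr_ge0|].
by apply: (aeS sol) => s ->.
Qed.

Let int_le (F : seqspace X -> R) (K : R) : measurable_fun setT F ->
  (forall s, 0 <= F s <= K) ->
  exists e : R, [/\ (\int[nu]_s (F s)%:E = e%:E)%E, 0 <= e & e <= K].
Proof.
move=> mF F0K.
have I0 : (0 <= \int[nu]_s (F s)%:E)%E.
  by apply: integral_ge0 => s _; rewrite lee_fin; have /andP[] := F0K s.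
have IK : (\int[nu]_s (F s)%:E <= K%:E)%E.
  apply: (@le_trans _ _ (\int[nu]_s (cst K%:E s))%E).
    apply: ge0_le_integral => //.
    - by move=> s _; rewrite lee_fin; have /andP[] := F0K s.
    - exact/measurable_EFinP.
    - by move=> s _; rewrite lee_fin; have /andP[] := F0K s.
  rewrite integral_cst// -[leRHS]mule1; apply: lee_pmul => //.
  - by have /andP[F0 FK] := F0K point; rewrite lee_fin (le_trans F0).
  - exact: probability_le1.
have fin : (\int[nu]_s (F s)%:E)%E \is a fin_num.
  by rewrite ge0_fin_numE// (le_lt_trans IK)// ltry.
exists (fine (\int[nu]_s (F s)%:E)%E); split; first by rewrite fineK.
- by rewrite fine_ge0.
- by rewrite -lee_fin fineK.
Qed.

Let a n := fine (\int[nu]_s (h (s n) ^+ 2)%:E)%E.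

Let mhs n : measurable_fun setT (fun s : seqspace X => h (s n) ^+ 2).
Proof. by apply: measurable_funX; exact: mcc. Qed.

Let aP n : [/\ (\int[nu]_s (h (s n) ^+ 2)%:E = (a n)%:E)%E, 0 <= a n & a n <= M ^+ 2].
Proof.
have [|e [eE e0 eM]] := @int_le _ (M ^+ 2) (mhs n).
  by move=> s; rewrite sqr_ge0/= lerXn2r// nnegrE// h0.
by rewrite /a eE.
Qed.

(** Orthogonality of martingale increments: the mixed moment of h(x_m) and h(x_{n+m}) is the second
    moment at the earlier index m. *)
Lemma integral_increment n m :
  (\int[nu]_s ((h (s (n + m)%N) - h (s m)) ^+ 2)%:E = (a (n + m)%N - a m)%:E)%E.
Proof.
have [aE _ _] := aP (n + m)%N; have [aE' _ _] := aP m.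
have md : measurable_fun setT (fun s : seqspace X => (h (s (n + m)%N) - h (s m)) ^+ 2).
  by apply: measurable_funX; apply: measurable_funB; exact: mcc.
have [|e [eE _ _]] := @int_le _ ((M + M) ^+ 2) md.
  move=> s; rewrite sqr_ge0/=.
  have := h0 (s (n + m)%N); have := hM (s (n + m)%N); have := h0 (s m); have := hM (s m).
  by move=> *; rewrite -subr_ge0 subr_sqr mulr_ge0//; lra.
have mx : measurable_fun setT (fun s : seqspace X => h (s m) * h (s (n + m)%N)).
  by apply: measurable_funM; exact: mcc.
have xE : (\int[nu]_s (h (s m) * h (s (n + m)%N))%:E = (a m)%:E)%E.
  by rewrite integral_coord_martingale// -aE'; under eq_integral do rewrite -expr2.
(* The square is expanded with the mixed terms on the left, so that only nonnegative functions are
   integrated. *)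
have : (\int[nu]_s ((h (s (n + m)%N) - h (s m)) ^+ 2)%:E +
    \int[nu]_s (h (s m) * h (s (n + m)%N))%:E + \int[nu]_s (h (s m) * h (s (n + m)%N))%:E =
    \int[nu]_s (h (s (n + m)%N) ^+ 2)%:E + \int[nu]_s (h (s m) ^+ 2)%:E)%E.
  rewrite -!ge0_integralD//.
  - by apply: eq_integral => s _; rewrite -!EFinD; congr (_%:E); ring.
  - by move=> s _; rewrite lee_fin sqr_ge0.
  - exact/measurable_EFinP.
  - by move=> s _; rewrite lee_fin sqr_ge0.
  - exact/measurable_EFinP.
  - by move=> s _; rewrite -EFinD lee_fin addr_ge0 ?sqr_ge0// mulr_ge0.
  - by apply: emeasurable_funD; exact/measurable_EFinP.
  - by move=> s _; rewrite lee_fin mulr_ge0.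
  - exact/measurable_EFinP.
  - by move=> s _; rewrite lee_fin sqr_ge0.
  - exact/measurable_EFinP.
  - by move=> s _; rewrite lee_fin mulr_ge0.
  - exact/measurable_EFinP.
by rewrite eE xE aE aE' -!EFinD => -[E]; congr (_%:E); lra.
Qed.

Lemma a_nd : nondecreasing_seq a.
Proof.
move=> m n mn; rewrite -(subnK mn) -subr_ge0 -lee_fin -integral_increment.
by apply: integral_ge0 => s _; rewrite lee_fin sqr_ge0.
Qed.

Lemma integral_increment_le (L e : R) n m : (forall k, a k <= L) ->
  L - e <= a n -> L - e <= a m ->
  (\int[nu]_s ((h (s n) - h (s m)) ^+ 2)%:E <= e%:E)%E.
Proof.
move=> aL an am; have [mn|/ltnW nm] := leqP m n.
  by rewrite -(subnK mn) integral_increment lee_fin subnK//; have := aL n; lra.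
rewrite -(subnK nm); under eq_integral do rewrite -sqrrN opprB.
by rewrite integral_increment lee_fin subnK//; have := aL m; lra.
Qed.

(** Coordinate m_k + 1 of [rinf r s] is coordinate m_k of [s]; a common limit along both index
    sequences is therefore invariant. *)
Lemma martingale_limit : exists f : seqspace X -> R,
  [/\ measurable_fun setT f, {ae nu, forall s, f (rinf r s) = f s} &
   exists m : nat -> nat, {ae nu, forall s : seqspace X, h (s (m k).+1) @[k --> \oo] --> f s}].
Proof.
pose L := sup (range a).
have hub : has_ubound (range a) by exists (M ^+ 2) => _ [n _ <-]; have [] := aP n.
have aL k : a k <= L by apply: ub_le_sup => //; exists k.
(* Second moments increase to L. Two indices with moments at least L - 16^-k give an increment of
   squared norm at most 16^-k, the rate that [ae_geometric_bound] asks for. *)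
have exm k : exists n, L - 16^-1 ^+ k <= a n.
  have e0 : 0 < 16^-1 ^+ k :> R by rewrite exprn_gt0.
  have [|_ [n _ <-] an] := @sup_adherent _ (range a) _ e0.
    by split => //; exists (a 0%N), 0%N.
  by exists n; exact: ltW.
have [m mP] := choice exm.
have mP' k : L - 16^-1 ^+ k <= a (m k).+1.
  by apply: le_trans (mP k) _; exact: a_nd.
pose x k (s : seqspace X) := h (s (m k)).
pose y k (s : seqspace X) := h (s (m k).+1).
have mx k : measurable_fun setT (x k) by exact: mcc.
have my k : measurable_fun setT (y k) by exact: mcc.
have ux : {ae nu, forall s, exists C, forall k, `|x k.+1 s - x k s| <= C / 2 ^+ k}.
  apply: (@ae_geometric_bound _ _ _ nu (fun k s => x k.+1 s - x k s)) => k.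
    exact: measurable_funB.
  apply: (@integral_increment_le L) => //; apply: le_trans (mP k.+1).
  by rewrite lerD2l lerN2 exprS ler_piMl// ?exprn_ge0// invf_le1// ler1n.
have uy : {ae nu, forall s, exists C, forall k, `|y k s - x k s| <= C / 2 ^+ k}.
  apply: (@ae_geometric_bound _ _ _ nu (fun k s => y k s - x k s)) => k.
    exact: measurable_funB.
  exact: (@integral_increment_le L).
(* A limsup is defined and measurable without reference to convergence. It is taken along m_k + 1,
   so that f at [rinf r s] is the limsup of [x k s]. *)
pose f s := limn_sup (fun k => y k s).
have cvgxy : {ae nu, forall s, x k s @[k --> \oo] --> f s /\ y k s @[k --> \oo] --> f s}.
  apply: (aeS2 ux uy) => s [C /cvg_of_geometric_bound /cvg_ex[/= l xl]] [C' yC].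
  have yx0 : y k s - x k s @[k --> \oo] --> 0.
    have : geometric C' (2^-1) k @[k --> \oo] --> 0.
      by apply: cvg_geometric; rewrite ger0_norm// invf_lt1// ltr1n.
    move=> g0; apply/norm_cvg0P; apply: (squeeze_cvgr _ _ g0) => //; last exact: cvg_cst.
    by apply: nearW => k; rewrite normr_ge0/= /geometric/= exprVn; exact: yC.
  have yl : y k s @[k --> \oo] --> l.
    have : (y k s - x k s) + x k s @[k --> \oo] --> 0 + l by exact: cvgD.
    by rewrite add0r; under eq_fun do rewrite subrK.
  suff -> : f s = l by [].
  by rewrite /f /limn_sup; apply/cvg_lim => //; exact: cvg_sups.
exists f; split.
- apply: measurable_fun_limn_sup => //.
  + by move=> s _; exists M => _ [k _ <-]; exact: hM.
  + by move=> s _; exists 0 => _ [k _ <-]; exact: h0.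
- apply: (aeS cvgxy) => s [xf _].
  rewrite {1}/f /limn_sup; apply/cvg_lim => //; apply: cvg_sups; exact: xf.
- by exists m; apply: (aeS cvgxy) => s [].
Qed.

Lemma fixed_const_of_solenoid :
  (forall phi, L2 nu phi -> aeq nu (Uop r m0 phi) (piop m0 phi) ->
    exists c, aeq nu phi (fun=> c)) ->
  exists c, {ae mu, forall x, h x = c}.
Proof.
move=> fixc; have [f [mf finv [m fm]]] := martingale_limit.
have f0M : {ae nu, forall s, 0 <= f s <= M}.
  apply: (aeS fm) => s fs; apply/andP; split.
    by rewrite -(cvg_lim _ fs)//; apply: limr_ge; [exact: cvgP fs|exact: nearW].
  by rewrite -(cvg_lim _ fs)//; apply: limr_le; [exact: cvgP fs|exact: nearW].
have [||c cE] := fixc (fun s => (f s)%:C%C).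
- split; first exact: cmeasurable_real.
  apply: (@le_lt_trans _ _ (\int[nu]_s (cst (M ^+ 2)%:E s))%E); last first.
    rewrite integral_cst// [X in (_ * X)%E](_ : _ = 1%E) ?mule1 ?ltry//.
    exact: probability_setT.
  apply: ae_ge0_le_integral => //.
  - by move=> s _; rewrite lee_fin sqn_ge0.
  - by apply/measurable_EFinP/measurable_sqn; exact: cmeasurable_real.
  - by move=> s _; rewrite lee_fin sqr_ge0.
  - apply: (aeS f0M) => s /andP[fs0 fsM] _.
    by rewrite lee_fin sqn_real lerXn2r// nnegrE.
- by apply: (aeS finv) => s; rewrite /Uop /piop => ->.
have fc : {ae nu, forall s, f s = complex.Re c} by apply: (aeS cE) => s <-.
exists (complex.Re c).
have hoo : (\int[mu]_x (h x)%:E < +oo)%E.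
  rewrite -(integral_coord0' mh h0).
  have [|e [-> _ _]] := @int_le (fun s => h (s 0%N)) M (mcc 0 mh); last by rewrite ltry.
  by move=> s; rewrite h0 hM.
apply: (ae_eq_of_integral mh (measurable_cst _) h0 hoo) => B mB.
have mIB : measurable_fun setT (\1_B : borel X -> R) by exact: measurable_indic.
have m1 k : measurable_fun setT (fun s : seqspace X => \1_B (s 0%N) * h (s (m k).+1)).
  by apply: measurable_funM; exact: mcc.
(* The integral of 1_B(x_0) h(x_n) does not depend on n; its limit identifies the integral of h over
   B with c times the measure of B. *)
have [|||||_ _] := @dominated_convergence _ _ _ nu setT measurableT
  (fun k (s : seqspace X) => (\1_B (s 0%N) * h (s (m k).+1))%:E)
  (fun s => (\1_B (s 0%N) * complex.Re c)%:E) (cst M%:E).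
- by move=> k; exact/measurable_EFinP.
- by apply/measurable_EFinP; apply: measurable_funM => //; exact: (mcc 0 mIB).
- apply: (aeS2 fm fc) => s fs fsc _; apply: cvg_EFin; first exact: nearW.
  by rewrite -fsc; apply: cvgMr.
- exact: finite_measure_integrable_cst.
- apply: aeW => s k _; rewrite gee0_abs ?lee_fin ?mulr_ge0// indicE.
  by case: (_ \in _); rewrite ?mul1r ?mul0r.
have E k : (\int[nu]_s (\1_B (s 0%N) * h (s (m k).+1))%:E = \int[mu]_x (h x * \1_B x)%:E)%E.
  rewrite -[(m k).+1]addn0 integral_coord_martingale//.
  rewrite (@integral_coord0' (fun x => \1_B x * h x)).
  - by apply: eq_integral => x _; rewrite mulrC.
  - exact: measurable_funM.
  - by move=> x; rewrite mulr_ge0.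
under eq_fun do rewrite E.
move=> cv; have := cvg_lim (@ereal_hausdorff R) cv; rewrite lim_cst// => ->.
have c0 : 0 <= complex.Re c.
  rewrite leNgt; apply/negP => clt; apply: (@ae_False _ _ _ nu).
  by apply: (aeS2 f0M fc) => s /andP[fs _] fsc; move: fs; rewrite fsc leNgt clt.
rewrite (@integral_coord0' (fun x => \1_B x * complex.Re c)).
- by apply: eq_integral => x _; rewrite mulrC.
- exact: measurable_funM.
- by move=> x; rewrite mulr_ge0.
Qed.

End Martingale.

(** * Fixed points in L^p *)
Section FixedPoints.
Variables (R : realType) (X : pseudoPMetricType R) (r : X -> X).
Variable mu : probability (borel X) R.
Hypothesis rfin : forall x, finite_set (fibre r x) /\ fibre r x !=set0.
Hypothesis muinv : strongly_invariant r mu.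
Hypothesis mr : measurable_fun setT (r : borel X -> borel X).
Variable m0 : borel X -> R[i].
Let w : borel X -> R := fun x => sqn (m0 x).
Hypothesis mm0 : cmeasurable m0.
Hypothesis w1 : forall x, Tavg r w x = 1.

Implicit Types f g phi psi : borel X -> R.

Let w0 x : 0 <= w x. Proof. exact: sqn_ge0. Qed.
Let mw : measurable_fun setT w. Proof. exact: measurable_sqn. Qed.

Local Notation Q := (Qw r mu w).

Lemma iterQP n f : measurable_fun setT f -> (forall x, 0 <= f x) ->
  measurable_fun setT (iter n Q f) /\ (forall x, 0 <= iter n Q f x).
Proof.
move=> mf f0; elim: n => [//|n [mn n0]].
by have [mq q0 _] := QwP rfin muinv mw w0 mn n0.
Qed.

Lemma ae_iterQS n f : measurable_fun setT f -> (forall x, 0 <= f x) ->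
  {ae mu, forall x, iter n.+1 Q f x = Rw r w (iter n Q f) x}.
Proof.
move=> mf f0; have [mn n0] := iterQP n mf f0.
by have [_ _ qE] := QwP rfin muinv mw w0 mn n0.
Qed.

Lemma ae_iterQ_le n f g : measurable_fun setT f -> (forall x, 0 <= f x) ->
  measurable_fun setT g -> (forall x, 0 <= g x) ->
  {ae mu, forall x, f x <= g x} -> {ae mu, forall x, iter n Q f x <= iter n Q g x}.
Proof.
move=> mf f0 mg g0 fg; elim: n => [//|n IH].
apply: (aeS3 (ae_iterQS n mf f0) (ae_iterQS n mg g0) (ae_Rw_le rfin muinv w0 IH)).
by move=> x -> ->.
Qed.

Lemma ae_iterQ_cst n (c : R) : 0 <= c -> {ae mu, forall x, iter n Q (fun=> c) x = c}.
Proof.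
move=> c0; elim: n => [|n IH]; first exact: aeW.
have mc : measurable_fun setT (fun _ : borel X => c) by exact: measurable_cst.
apply: (aeS2 (ae_iterQS n mc (fun=> c0)) (ae_eq_Rw rfin muinv w IH)) => x -> ->.
exact: Rw_cst.
Qed.

Lemma ae_iterQD n f g : measurable_fun setT f -> (forall x, 0 <= f x) ->
  measurable_fun setT g -> (forall x, 0 <= g x) ->
  {ae mu, forall x, iter n Q (fun y => f y + g y) x = iter n Q f x + iter n Q g x}.
Proof.
move=> mf f0 mg g0; elim: n => [|n IH]; first exact: aeW.
have mfg : measurable_fun setT (fun y => f y + g y) by exact: measurable_funD.
have fg0 x : 0 <= f x + g x by rewrite addr_ge0.
apply: (aeS2 (ae_iterQS n mfg fg0) (aeS3 (ae_iterQS n mf f0) (ae_iterQS n mg g0)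
  (ae_eq_Rw rfin muinv w IH) (fun x a b c => conj a (conj b c)))) => x -> [-> [-> ->]].
rewrite (@eq_Rw _ _ _ rfin w _ (fun y => 1 * iter n Q f y + iter n Q g y)).
  by rewrite RwD// mul1r.
by move=> y _; rewrite mul1r.
Qed.

Lemma m0nS n x : m0n r m0 n.+1 x = m0 x * m0n r m0 n (r x).
Proof.
by rewrite /m0n big_ord_recl; congr (_ * _); apply: eq_bigr => i _; rewrite -iterSr.
Qed.

Lemma cmeasurable_m0n n : cmeasurable (m0n r m0 n : borel X -> R[i]).
Proof.
elim: n => [|n IH].
  rewrite (_ : m0n r m0 0 = fun=> 1); first exact: cmeasurable_cst.
  by apply/funext => x; rewrite /m0n big_ord0.
rewrite (_ : m0n r m0 n.+1 = fun x => m0 x * m0n r m0 n (r x)).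
  apply: cmeasurableM => //; have [m1 m2] := IH.
  by split; [exact: (measurableT_comp m1 mr)|exact: (measurableT_comp m2 mr)].
by apply/funext => x; rewrite m0nS.
Qed.

Let msn n : measurable_fun setT (fun x : borel X => sqn (m0n r m0 n x)).
Proof. by apply: measurable_sqn; exact: cmeasurable_m0n. Qed.

Lemma integral_m0nS n f : measurable_fun setT f -> (forall x, 0 <= f x) ->
  (\int[mu]_x (sqn (m0n r m0 n.+1 x) * f x)%:E =
   \int[mu]_x (sqn (m0n r m0 n x) * Q f x)%:E)%E.
Proof.
move=> mf f0.
rewrite (integral_version rfin muinv mr mw w0 (msn n) (fun=> sqn_ge0 _) mf f0).
  by apply: eq_integral => x _; rewrite m0nS sqnM mulrA.
exact: QwP.
Qed.

(** Each step splits the factor m_0(x) off the product and applies duality. Hence the integrals in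
    (iv) are those of the iterates of the transfer operator on |h|^p. *)
Lemma integral_iterQ n i f : measurable_fun setT f -> (forall x, 0 <= f x) ->
  (\int[mu]_x (sqn (m0n r m0 (n + i) x) * f x)%:E =
   \int[mu]_x (sqn (m0n r m0 n x) * iter i Q f x)%:E)%E.
Proof.
move=> mf f0; elim: i n => [|i IH] n; first by rewrite addn0.
have [mi i0] := iterQP i mf f0.
by rewrite addnS -addSn IH integral_m0nS.
Qed.

Lemma integral_iterQ0 i f : measurable_fun setT f -> (forall x, 0 <= f x) ->
  (\int[mu]_x (iter i Q f x)%:E = \int[mu]_x (sqn (m0n r m0 i x) * f x)%:E)%E.
Proof.
move=> mf f0; rewrite -[i in RHS]add0n integral_iterQ//; apply: eq_integral => x _.
rewrite /m0n big_ord0 (_ : sqn (1 : R[i]) = 1) ?mul1r//.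
by rewrite sqnE/= expr1n expr0n addr0.
Qed.

Lemma integral_m0n n : (\int[mu]_x (sqn (m0n r m0 n x))%:E = 1)%E.
Proof.
have m1 : measurable_fun setT (fun _ : borel X => 1 : R) by exact: measurable_cst.
have := integral_iterQ0 n m1 (fun=> ler01).
rewrite (@ge0_ae_integral_eq _ _ _ mu (iter n Q (fun=> 1)) (cst 1)) //; first last.
- exact: ae_iterQ_cst.
- by have [_] := iterQP n m1 (fun=> ler01).
under [in X in _ = X -> _]eq_integral do rewrite mulr1.
move=> <-; rewrite -[LHS]/(\int[mu]_x (cst 1%E x))%E integral_cst// mul1e.
exact: probability_setT.
Qed.

Lemma bounded_cvg_integral (u : nat -> borel X -> R) (v : borel X -> R) (K : R) :
  (forall n, measurable_fun setT (u n)) -> measurable_fun setT v ->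
  (forall n x, 0 <= u n x) -> (forall n, {ae mu, forall x, u n x <= K}) ->
  {ae mu, forall x, u n x @[n --> \oo] --> v x} ->
  (\int[mu]_x (u n x)%:E @[n --> \oo] --> \int[mu]_x (v x)%:E)%E.
Proof.
move=> mu_ mv u0 uK uv.
have [|||||_ _] := @dominated_convergence _ _ _ mu setT measurableT
  (fun n x => (u n x)%:E) (EFin \o v) (cst K%:E) => //.
- by move=> n; exact/measurable_EFinP.
- exact/measurable_EFinP.
- by apply: (aeS uv) => x ux _; apply: cvg_EFin => //; exact: nearW.
- exact: finite_measure_integrable_cst.
- by apply: (aeS (ae_foralln uK)) => x uxK n _; rewrite gee0_abs ?lee_fin.
Qed.

Section SubharmonicBound.
Variables (f : borel X -> R) (p M : R).
Hypothesis mf : measurable_fun setT f.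
Hypothesis f0 : forall x, 0 <= f x.
Hypothesis fR : {ae mu, forall x, f x <= Rw r w f x}.
Hypothesis p1 : 1 < p.
Hypothesis fM : forall n, (\int[mu]_x (sqn (m0n r m0 n x) * f x `^ p)%:E <= M%:E)%E.
Hypothesis fixc : forall (h : borel X -> R) (K : R),
  measurable_fun setT h -> (forall x, 0 <= h x <= K) ->
  {ae mu, forall x, Rw r w h x = h x} -> exists c, {ae mu, forall x, h x = c}.

Let g n := iter n Q f.

Let g0 n x : 0 <= g n x. Proof. exact: (iterQP n mf f0).2. Qed.
Let mg n : measurable_fun setT (g n). Proof. by have [] := iterQP n mf f0. Qed.
Let gS n : {ae mu, forall x, g n.+1 x = Rw r w (g n) x}.
Proof. exact: ae_iterQS. Qed.

Let g_nd n : {ae mu, forall x, g n x <= g n.+1 x}.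
Proof.
elim: n => [|n IH]; first by apply: (aeS2 fR (gS 0)) => x fx ->.
by apply: (aeS3 (gS n) (gS n.+1) (ae_Rw_le rfin muinv w0 IH)) => x -> ->.
Qed.

Let mpow : measurable_fun setT (fun x => f x `^ p).
Proof. exact: (measurableT_comp (measurable_powR p) mf). Qed.

(** Uses f <= 1 + f^p and the fact that $|m_0^{(n)}|^2$ has integral 1. *)
Let integral_g n : (\int[mu]_x (g n x)%:E <= (1 + M)%:E)%E.
Proof.
rewrite integral_iterQ0//.
apply: (@le_trans _ _ (\int[mu]_x (sqn (m0n r m0 n x) +
    sqn (m0n r m0 n x) * f x `^ p)%:E)%E).
  apply: ge0_le_integral => //.
  - by move=> x _; rewrite lee_fin mulr_ge0 ?sqn_ge0.
  - by apply/measurable_EFinP; exact: measurable_funM.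
  - by apply/measurable_EFinP; apply: measurable_funD => //; exact: measurable_funM.
  - move=> x _; rewrite lee_fin -[X in _ <= X + _]mulr1 -mulrDr ler_wpM2l ?sqn_ge0//.
    have [f1|f1] := leP (f x) 1; first by rewrite (le_trans f1)// lerDl powR_ge0.
    rewrite (@le_trans _ _ (f x `^ p))//; last by rewrite lerDr.
    by rewrite -{1}[f x]powRr1// ler_powR// ltW.
under eq_integral do rewrite EFinD.
rewrite ge0_integralD//.
- by rewrite integral_m0n EFinD leeD2l.
- by move=> x _; rewrite lee_fin sqn_ge0.
- exact/measurable_EFinP.
- by move=> x _; rewrite lee_fin mulr_ge0 ?sqn_ge0// powR_ge0.
- by apply/measurable_EFinP; exact: measurable_funM.
Qed.

Let excess (k : R) x := Num.max (f x - k) 0.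

Let mexcess k : measurable_fun setT (excess k).
Proof. by apply: measurable_maxr => //; exact: measurable_funB. Qed.

Let excess0 k x : 0 <= excess k x. Proof. by rewrite le_max lexx orbT. Qed.

(** Where f > k, the excess is at most f = f^(1-p) f^p <= k^(1-p) f^p, because 1 - p is negative. *)
Let integral_excess k n : 0 < k ->
  (\int[mu]_x (iter n Q (excess k) x)%:E <= (k `^ (1 - p) * M)%:E)%E.
Proof.
move=> k0; rewrite integral_iterQ0//.
apply: (@le_trans _ _ (\int[mu]_x ((k `^ (1 - p))%:E *
    (sqn (m0n r m0 n x) * f x `^ p)%:E))%E).
  apply: ge0_le_integral => //.
  - by move=> x _; rewrite lee_fin mulr_ge0 ?sqn_ge0.
  - by apply/measurable_EFinP; exact: measurable_funM.
  - by apply: measurable_funeM; apply/measurable_EFinP; exact: measurable_funM.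
  - move=> x _; rewrite -EFinM lee_fin mulrCA ler_wpM2l ?sqn_ge0//.
    rewrite /excess; have [fk|kf] := leP (f x - k) 0.
      by rewrite mulr_ge0 ?powR_ge0.
    have fx0 : 0 < f x by lra.
    apply: (@le_trans _ _ (f x)); first by lra.
    have fxE : f x = f x `^ (1 - p) * f x `^ p.
      by rewrite -powRD ?subrK ?powRr1// (gt_eqF fx0) implybT.
    rewrite [leLHS]fxE ler_wpM2r ?powR_ge0// -[1 - p]opprB !powRN.
    rewrite lef_pV2 ?posrE ?powR_gt0// ge0_ler_powR ?nnegrE ?(ltW k0) ?f0//.
      by rewrite subr_ge0 ltW.
    by lra.
rewrite ge0_integralZl//.
- by rewrite EFinM lee_pmul2l ?lte_fin ?powR_gt0.
- by apply/measurable_EFinP; exact: measurable_funM.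
- by move=> x _; rewrite lee_fin mulr_ge0 ?sqn_ge0// powR_ge0.
- by rewrite lee_fin powR_ge0.
Qed.

(* The truncations min (g n) k increase to a bounded superharmonic function t,
   and the iterates Q^n t decrease to a bounded fixed point, hence a constant. *)
Let superharmonic (k : R) : 0 < k -> exists t : borel X -> R,
  [/\ measurable_fun setT t, forall x, 0 <= t x <= k,
      {ae mu, forall x, Num.min (f x) k <= t x},
      {ae mu, forall x, Rw r w t x <= t x} &
      (\int[mu]_x (t x)%:E <= (1 + M)%:E)%E].
Proof.
move=> k0; pose u n x := Num.min (g n x) k.
have mu_ n : measurable_fun setT (u n) by apply: measurable_minr.
have u0 n x : 0 <= u n x by rewrite le_min g0 ltW.
have uk n x : u n x <= k by rewrite ge_min lexx orbT.
have ub x : has_ubound (range (u ^~ x)) by exists k => _ [n _ <-].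
pose t x := sups (u ^~ x) 0.
have ut n x : u n x <= t x by apply: ub_le_sup; [exact: has_ubound_sdrop|exists n].
have tk x : t x <= k.
  apply: ge_sup; first by exists (u 0%N x); exists 0%N.
  by move=> _ [n _ <-].
have t0 x : 0 <= t x by exact: le_trans (u0 0%N x) (ut 0%N x).
have mt : measurable_fun setT t by apply: measurable_fun_sups.
have ucvg : {ae mu, forall x, u n x @[n --> \oo] --> t x}.
  apply: (aeS (ae_foralln g_nd)) => x gx.
  rewrite (_ : t x = sup (range (u ^~ x))).
    apply: nondecreasing_cvgn => //; apply/nondecreasing_seqP => n.
    by rewrite /u le_min ge_min gx/= ge_min lexx orbT.
  by rewrite /t /sups; congr sup; apply/seteqP; split=> y [n _ <-]; exists n.
exists t; split => //.
- by move=> x; rewrite t0 tk.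
- by apply: aeW => x; exact: (ut 0%N).
(* R u_n is at most R g_n = g_{n+1} and at most k, hence at most u_{n+1} <= t; the limit is taken on
   each finite fibre. *)
- apply: (aeS2 (ae_fibre rfin muinv ucvg) (ae_foralln gS)) => x ucvgx gSx.
  have RT : Rw r w (u n) x @[n --> \oo] --> Rw r w t x by exact: Rw_cvg.
  rewrite -(cvg_lim _ RT)//; apply: limr_le; first exact: cvgP RT.
  apply: nearW => n; apply: le_trans (ut n.+1 x); rewrite le_min; apply/andP; split.
    by rewrite gSx; apply: Rw_le => // y _; rewrite ge_min lexx.
  by rewrite -[leRHS](Rw_cst rfin w1 k x); apply: Rw_le.
- have cv := bounded_cvg_integral mu_ mt u0 (fun n => aeW _ (uk n)) ucvg.
  rewrite -(cvg_lim (@ereal_hausdorff R) cv); apply: lime_le; first exact: cvgP cv.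
  apply: nearW => n; apply: le_trans (integral_g n); apply: ge0_le_integral => //.
  + by move=> x _; rewrite lee_fin.
  + exact/measurable_EFinP.
  + exact/measurable_EFinP.
  + by move=> x _; rewrite lee_fin ge_min lexx.
Qed.

Let pos x := Num.max (f x - (1 + M)) 0.

Let mpos : measurable_fun setT pos.
Proof. by apply: measurable_maxr => //; exact: measurable_funB. Qed.

(* With t as in [superharmonic], f <= Q^n t + Q^n (f - k)^+, where Q^n t tends to a
   constant c <= 1 + M and Q^n preserves integrals. *)
Let integral_pos (k : R) : 0 < k ->
  (\int[mu]_x (pos x)%:E <= (k `^ (1 - p) * M)%:E)%E.
Proof.
move=> k0; have [t [mt t0k ft Rt It]] := superharmonic k0.
have t0 x : 0 <= t x by have /andP[] := t0k x.
have tk x : t x <= k by have /andP[] := t0k x.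
pose v n := iter n Q t.
have mv n : measurable_fun setT (v n) by have [] := iterQP n mt t0.
have v0 n x : 0 <= v n x by exact: (iterQP n mt t0).2.
have vS n : {ae mu, forall x, v n.+1 x = Rw r w (v n) x} by exact: ae_iterQS.
have v_ni n : {ae mu, forall x, v n.+1 x <= v n x}.
  elim: n => [|n IH]; first by apply: (aeS2 Rt (vS 0%N)) => x Rx ->.
  by apply: (aeS3 (vS n) (vS n.+1) (ae_Rw_le rfin muinv w0 IH)) => x -> ->.
have vt n : {ae mu, forall x, v n x <= t x}.
  elim: n => [|n IH]; first exact: aeW.
  by apply: (aeS2 IH (v_ni n)) => x h1 h2; exact: le_trans h2 h1.
have lb x : has_lbound (range (v ^~ x)) by exists 0 => _ [n _ <-].
pose V0 x := infs (v ^~ x) 0.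
have mV0 : measurable_fun setT V0 by apply: measurable_fun_infs.
have V00 x : 0 <= V0 x.
  by apply: lb_le_inf; [exists (v 0%N x); exists 0%N|move=> _ [n _ <-]].
have V0k x : V0 x <= k.
  by apply: le_trans (tk x); apply: ge_inf; [exact: has_lbound_sdrop|exists 0%N].
have vcvg : {ae mu, forall x, v n x @[n --> \oo] --> V0 x}.
  apply: (aeS (ae_foralln v_ni)) => x vx.
  rewrite (_ : V0 x = inf (range (v ^~ x))).
    by apply: nonincreasing_cvgn => //; apply/nonincreasing_seqP.
  by rewrite /V0 /infs; congr inf; apply/seteqP; split=> y [n _ <-]; exists n.
have RV : {ae mu, forall x, Rw r w V0 x = V0 x}.
  apply: (aeS3 (ae_fibre rfin muinv vcvg) (ae_foralln vS) vcvg) => x cvgx vSx cvx.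
  have RT : Rw r w (v n) x @[n --> \oo] --> Rw r w V0 x by exact: Rw_cvg.
  have : v (n + 1)%N x @[n --> \oo] --> V0 x by apply: cvg_comp cvx; exact: cvg_addnr.
  under eq_fun do rewrite addn1 vSx.
  by move=> cv; exact: cvg_unique RT cv.
have [|c Vc] := fixc mV0 _ RV (K := k); first by move=> x; rewrite V00 V0k.
have c0 : 0 <= c.
  rewrite leNgt; apply/negP => clt; apply: (@ae_False _ _ _ mu).
  by apply: (aeS Vc) => x Vx; move: (V00 x); rewrite Vx leNgt clt.
(* The constant lies a.e. below [t], and mu has mass 1, so the integral of [t] bounds it. *)
have cM : c <= 1 + M.
  rewrite -lee_fin; apply: le_trans It.
  have -> : c%:E = (\int[mu]_x (cst c%:E x))%E.
    rewrite integral_cst// -[LHS]mule1; congr (_ * _)%E.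
    by apply/esym; exact: probability_setT.
  apply: ae_ge0_le_integral => //.
  - by move=> x _; rewrite lee_fin.
  - exact/measurable_EFinP.
  - apply: (aeS Vc) => x <- _; rewrite lee_fin.
    by apply: ge_inf; [exact: has_lbound_sdrop|exists 0%N].
pose d n x := Num.max (v n x - c) 0.
have md n : measurable_fun setT (d n).
  by apply: measurable_maxr => //; exact: measurable_funB.
have d0 n x : 0 <= d n x by rewrite le_max lexx orbT.
have dcvg : (\int[mu]_x (d n x)%:E @[n --> \oo] --> 0)%E.
  have -> : 0%E = (\int[mu]_x (cst 0 x)%:E)%E by rewrite integral0.
  apply: (@bounded_cvg_integral d (cst 0) k) => //.
  - move=> n; apply: (aeS (vt n)) => x vx; rewrite /d ge_max (ltW k0) andbT.
    by have := tk x; lra.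
  - apply: (aeS2 vcvg Vc) => x cvx Vx.
    have H : v n x - c @[n --> \oo] --> 0.
      by rewrite -(subrr c) -{2}Vx; apply: cvgB => //; exact: cvg_cst.
    apply: (squeeze_cvgr (f := cst 0) (h := fun n => `|v n x - c|)) => //.
    + by apply: nearW => n; rewrite d0/= /d ge_max normr_ge0 andbT ler_norm.
    + exact: cvg_cst.
    + by rewrite -(normr0 R); exact: cvg_norm.
apply/lee_addgt0Pr => e e0.
have fle n : {ae mu, forall x, f x <= v n x + iter n Q (excess k) x}.
  pose b x := Num.min (f x) k.
  have mb : measurable_fun setT b by apply: measurable_minr.
  have b0 x : 0 <= b x by rewrite le_min f0 ltW.
  have fg : {ae mu, forall x, f x <= g n x}.
    elim: n => [|n IH]; first exact: aeW.
    by apply: (aeS2 IH (g_nd n)) => x; exact: le_trans.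
  (* Splitting before iterating: f <= Q^n f, whose bounded part is at most Q^n t because min(f, k)
     <= t. *)
  have fE : f = (fun y => b y + excess k y).
    apply/funext => x; rewrite /b /excess.
    by case: (leP (f x) k) => ?; case: (leP (f x - k) 0) => ?; lra.
  have := ae_iterQD n mb b0 (mexcess k) (excess0 k); rewrite -fE => gE.
  by apply: (aeS3 fg gE (ae_iterQ_le n mb b0 mt t0 ft)) => x fx gx bt;
    apply: le_trans fx _; rewrite /g gx lerD2r.
have : \forall n \near \oo, (\int[mu]_x (d n x)%:E < e%:E)%E.
  apply: (dcvg [set y | y < e%:E]%E); apply: open_nbhs_nbhs; split.
    exact: open_ereal_lt_ereal.
  by rewrite /= lte_fin.
move=> [n _ /(_ n (leqnn n)) /= dn].
have [mE E0] := iterQP n (mexcess k) (excess0 k).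
(* From f <= v_n + Q^n(excess) and c <= 1 + M, the part of f above 1 + M is at most Q^n(excess) +
   (v_n - c)^+. *)
apply: (@le_trans _ _ (\int[mu]_x (iter n Q (excess k) x + d n x)%:E)%E).
  apply: ae_ge0_le_integral => //.
  - by move=> x _; rewrite lee_fin le_max lexx orbT.
  - exact/measurable_EFinP.
  - by move=> x _; rewrite lee_fin addr_ge0.
  - by apply/measurable_EFinP; exact: measurable_funD.
  - apply: (aeS (fle n)) => x fx _; rewrite lee_fin ge_max addr_ge0// andbT.
    have : v n x - c <= d n x by rewrite le_max lexx.
    by lra.
under eq_integral do rewrite EFinD.
rewrite ge0_integralD//.
- by apply: leeD; [exact: integral_excess|exact: ltW].
- by move=> x _; rewrite lee_fin.
- exact/measurable_EFinP.
- by move=> x _; rewrite lee_fin.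
- exact/measurable_EFinP.
Qed.

Lemma subharmonic_bounded : exists K, {ae mu, forall x, f x <= K}.
Proof.
exists (1 + M).
have pos0 x : 0 <= pos x by rewrite le_max lexx orbT.
have M0 : 0 <= M.
  rewrite -lee_fin; apply: le_trans (fM 0%N); apply: integral_ge0 => x _.
  by rewrite lee_fin mulr_ge0 ?sqn_ge0// powR_ge0.
suff Ipos : (\int[mu]_x (pos x)%:E = 0)%E.
  apply: (aeS (integral0_ae mpos pos0 Ipos)) => x posx.
  have : f x - (1 + M) <= pos x by rewrite le_max lexx.
  by rewrite posx subr_le0.
apply/eqP; rewrite eq_le integral_ge0 ?andbT; last by move=> x _; rewrite lee_fin.
apply/lee_addgt0Pr => e e0; rewrite add0e.
have q0 : 0 < p - 1 by rewrite subr_gt0.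
(* Makes k^(1-p) equal to e/(M+1), so that the bound is eM/(M+1) <= e; M + 1 keeps k positive when M
   = 0. *)
pose k := ((M + 1) / e) `^ (p - 1)^-1.
have Me0 : 0 < (M + 1) / e by rewrite divr_gt0//; lra.
have k0 : 0 < k by exact: powR_gt0.
apply: le_trans (integral_pos k0) _; rewrite lee_fin.
have M10 : 0 < M + 1 by lra.
rewrite -[1 - p]opprB powRN /k -powRrM mulVf ?gt_eqF// powRr1; last exact: ltW.
by rewrite invf_div mulrAC ler_pdivrMr// ler_wpM2l ?lerDl//; exact: ltW.
Qed.

End SubharmonicBound.

(** The positive parts of the real and imaginary parts of h and of -h are subharmonic and dominated
    by |h|. Bounding all four puts h in L^oo, where (iii) applies. *)
Lemma no_Lp_fixed_of_Linf :
  (forall h : X -> R[i], Linf mu h -> aeq mu (transfer r m0 h) h -> ae_constant mu h) ->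
  ~ exists p : R, 1 < p /\ exists h : X -> R[i],
    [/\ Lp mu p h, ~ ae_constant mu h, aeq mu (transfer r m0 h) h &
        exists M : R, forall n : nat,
          (\int[mu]_x (sqn (m0n r m0 n x) * cabs (h x) `^ p)%:E <= M%:E)%E].
Proof.
move=> fix_const [p [p1 [h [[[m1 m2] hp] nconst Rh [M hM]]]]].
have fixc := bounded_fixed_const_real rfin w1 fix_const.
apply: nconst; apply: fix_const => //.
have cabs0 (z : R[i]) : 0 <= cabs z by exact: sqrtr_ge0.
have mcabs : measurable_fun setT (fun x : borel X => cabs (h x)).
  rewrite (_ : (fun x => _) = fun x : borel X => Num.sqrt (sqn (h x))); last first.
    by apply/funext => x; rewrite sqnE.
  have : measurable_fun setT (fun x : borel X => sqn (h x) `^ 2^-1).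
    by apply: (measurableT_comp (measurable_powR _)); exact: measurable_sqn.
  by under eq_fun do rewrite powR12_sqrt ?sqn_ge0//.
have part (u : borel X -> R) : measurable_fun setT u -> (forall x, `|u x| <= cabs (h x)) ->
    {ae mu, forall x, Rw r w u x = u x} -> exists K, {ae mu, forall x, u x <= K}.
  move=> mu' uh Ru.
  pose f x := Num.max (u x) 0.
  have mf : measurable_fun setT f by apply: measurable_maxr.
  have f0 x : 0 <= f x by rewrite le_max lexx orbT.
  have fu x : u x <= f x by rewrite le_max lexx.
  have fh x : f x <= cabs (h x).
    by rewrite ge_max cabs0 andbT (le_trans (ler_norm _)).
  have [|n|K fK] := @subharmonic_bounded f p M mf f0 _ p1 _ fixc.
  - apply: (aeS Ru) => x Rux; rewrite /f ge_max -{1}Rux; apply/andP; split.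
      by apply: Rw_le.
    by apply: Rw_ge0 => // y _; rewrite le_max lexx orbT.
  - apply: le_trans (hM n); apply: ge0_le_integral => //.
    + by move=> x _; rewrite lee_fin mulr_ge0 ?sqn_ge0// powR_ge0.
    + apply/measurable_EFinP; apply: measurable_funM => //.
      exact: (measurableT_comp (measurable_powR p) mf).
    + apply/measurable_EFinP; apply: measurable_funM => //.
      exact: (measurableT_comp (measurable_powR p) mcabs).
    + move=> x _; rewrite lee_fin ler_wpM2l ?sqn_ge0// ge0_ler_powR ?nnegrE//.
      by lra.
  by exists K; apply: (aeS fK) => x; exact: le_trans.
have Re_le (z : R[i]) : `|complex.Re z| <= cabs z.
  by rewrite -sqrtr_sqr ler_wsqrtr// lerDl sqr_ge0.
have Im_le (z : R[i]) : `|complex.Im z| <= cabs z.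
  by rewrite -sqrtr_sqr ler_wsqrtr// lerDr sqr_ge0.
have RRe : {ae mu, forall x, Rw r w (fun y => complex.Re (h y)) x = complex.Re (h x)}.
  by apply: (aeS Rh) => x E; rewrite -(transfer_Re rfin) E.
have RIm : {ae mu, forall x, Rw r w (fun y => complex.Im (h y)) x = complex.Im (h x)}.
  by apply: (aeS Rh) => x E; rewrite -(transfer_Im rfin) E.
have RN (u : borel X -> R) : {ae mu, forall x, Rw r w u x = u x} ->
    {ae mu, forall x, Rw r w (fun y => - u y) x = - u x}.
  move=> Ru; apply: (aeS Ru) => x <-; rewrite -sub0r -{1}(Rw_cst rfin w1 0 x) -RwB//.
  by apply: eq_Rw => // y _; rewrite sub0r.
have [K1 h1] := part _ m1 (fun x => Re_le (h x)) RRe.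
have [K2 h2] := part _ m2 (fun x => Im_le (h x)) RIm.
have [|K3 h3] := part _ (measurable_funN m1) _ (RN _ RRe).
  by move=> x; rewrite /= normrN.
have [|K4 h4] := part _ (measurable_funN m2) _ (RN _ RIm).
  by move=> x; rewrite /= normrN.
split; first by split.
exists (Num.sqrt ((`|K1| + `|K3|) ^+ 2 + (`|K2| + `|K4|) ^+ 2)).
apply: (aeS2 (aeS2 h1 h3 (fun x a b => conj a b)) (aeS2 h2 h4 (fun x a b => conj a b))).
move=> x [a1 a3] [a2 a4]; rewrite /cabs ler_wsqrtr//.
have n1 := ler_norm K1; have n2 := ler_norm K2; have n3 := ler_norm K3; have n4 := ler_norm K4.
have p1' := normr_ge0 K1; have p2' := normr_ge0 K2; have p3' := normr_ge0 K3; have p4' := normr_ge0 K4.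
have {}a3 : - complex.Re (h x) <= K3 by exact: a3.
have {}a4 : - complex.Im (h x) <= K4 by exact: a4.
by apply: lerD; rewrite -subr_ge0 subr_sqr mulr_ge0//; lra.
Qed.

Lemma Linf_fixed_const_of_Lp :
  (~ exists p : R, 1 < p /\ exists h : X -> R[i],
    [/\ Lp mu p h, ~ ae_constant mu h, aeq mu (transfer r m0 h) h &
        exists M : R, forall n : nat,
          (\int[mu]_x (sqn (m0n r m0 n x) * cabs (h x) `^ p)%:E <= M%:E)%E]) ->
  forall h : X -> R[i], Linf mu h -> aeq mu (transfer r m0 h) h -> ae_constant mu h.
Proof.
move=> nex h Lh Rh; apply: contrapT => nconst; apply: nex.
have cabs0 (z : R[i]) : 0 <= cabs z by exact: sqrtr_ge0.
have sqE (z : R[i]) : cabs z `^ 2 = sqn z by rewrite powR_mulrn.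
have [K hK] := Linf_sqn Lh.
have hK' : {ae mu, forall x, sqn (h x) <= Num.max K 0}.
  by apply: (aeS hK) => x hx; rewrite le_max hx.
have msh := measurable_sqn Lh.1.
have K0 : 0 <= Num.max K 0 by rewrite le_max lexx orbT.
have bd n : (\int[mu]_x (sqn (m0n r m0 n x) * cabs (h x) `^ 2)%:E <= (Num.max K 0)%:E)%E.
  under eq_integral do rewrite sqE.
  apply: (@le_trans _ _ (\int[mu]_x ((Num.max K 0)%:E * (sqn (m0n r m0 n x))%:E))%E).
    apply: ae_ge0_le_integral => //.
    - by move=> x _; rewrite lee_fin mulr_ge0 ?sqn_ge0.
    - by apply/measurable_EFinP; exact: measurable_funM.
    - by move=> x _; rewrite -EFinM lee_fin mulr_ge0 ?sqn_ge0.
    - by apply: measurable_funeM; exact/measurable_EFinP.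
    - by apply: (aeS hK') => x hx _; rewrite -EFinM lee_fin mulrC ler_wpM2r ?sqn_ge0.
  rewrite ge0_integralZl//.
  - by rewrite integral_m0n mule1.
  - exact/measurable_EFinP.
  - by move=> x _; rewrite lee_fin sqn_ge0.
exists 2; split; first by lra.
exists h; split => //; last by exists (Num.max K 0).
split; first exact: Lh.1.
(* Membership in L^2 is the case n = 0 of the uniform bound, the empty product being 1. *)
apply: le_lt_trans (ltry (Num.max K 0)); apply: le_trans (bd 0%N).
rewrite (eq_integral (fun x : borel X => (sqn (m0n r m0 0 x) * cabs (h x) `^ 2)%:E))// => x _.
rewrite /m0n big_ord0 (_ : sqn (1 : R[i]) = 1) ?mul1r//.
by rewrite sqnE/= expr1n expr0n addr0.
Qed.

Lemma Linf_fixed_const_of_bounded : bounded_fixed_const r mu m0 ->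
  forall h : X -> R[i], Linf mu h -> aeq mu (transfer r m0 h) h -> ae_constant mu h.
Proof.
move=> fixc h [[m1 m2] [M hM]] Rh.
have part (u : borel X -> R) : measurable_fun setT u ->
    {ae mu, forall x, `|u x| <= M} -> {ae mu, forall x, Rw r w u x = u x} ->
    exists c, {ae mu, forall x, u x = c}.
  move=> mu' uM Ru.
  have M0 : 0 <= M.
    rewrite leNgt; apply/negP => M0; apply: (@ae_False _ _ _ mu).
    by apply: (aeS uM) => x; have := normr_ge0 (u x); lra.
  (* Constants are fixed by the operator, so u + M is again a fixed point; clamping it to [0, 2M]
     changes it on a null set and makes its bounds hold everywhere. *)
  pose v x := Num.max 0 (Num.min (u x + M) (M + M)).
  have mv : measurable_fun setT v.
    by apply: measurable_maxr => //; apply: measurable_minr => //; exact: measurable_funD.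
  have v01 x : 0 <= v x <= M + M.
    by rewrite le_max lexx/= ge_max ge_min lexx orbT addr_ge0.
  have vu : {ae mu, forall x, v x = u x + M}.
    apply: (aeS uM) => x; rewrite ler_norml => /andP[a b].
    by rewrite /v min_l ?max_r//; lra.
  have [|c vc] := fixc v (M + M) mv v01.
    apply: (aeS3 (ae_eq_Rw rfin muinv w vu) Ru vu) => x -> Rux ->.
    rewrite (@eq_Rw _ _ _ rfin w _ (fun y => 1 * u y + M)); last by move=> y _; rewrite mul1r.
    by rewrite (RwD rfin w 1 u (fun=> M)) Rw_cst// Rux mul1r.
  by exists (c - M); apply: (aeS2 vu vc) => x; lra.
have RRe : {ae mu, forall x, Rw r w (fun y => complex.Re (h y)) x = complex.Re (h x)}.
  by apply: (aeS Rh) => x E; rewrite -(transfer_Re rfin) E.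
have RIm : {ae mu, forall x, Rw r w (fun y => complex.Im (h y)) x = complex.Im (h x)}.
  by apply: (aeS Rh) => x E; rewrite -(transfer_Im rfin) E.
have [|a ha] := part _ m1 _ RRe.
  apply: (aeS hM) => x; apply: le_trans.
  by rewrite -sqrtr_sqr ler_wsqrtr// lerDl sqr_ge0.
have [|b hb] := part _ m2 _ RIm.
  apply: (aeS hM) => x; apply: le_trans.
  by rewrite -sqrtr_sqr ler_wsqrtr// lerDr sqr_ge0.
exists (Complex a b); apply: (aeS2 ha hb) => x; case: (h x) => s t /= -> ->.
by [].
Qed.

End FixedPoints.

Theorem theorem2p5 (R : realType) (X : pseudoPMetricType R)
    (r : X -> X) (mu : probability (borel X) R) (m0 : X -> R[i])
    (muinf : probability (seqspace X) R) :
  (* X is a compact metric space *)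
  hausdorff_space X -> compact [set: X] ->
  (* r is Borel measurable with 0 < #r^{-1}(x) < oo *)
  measurable_fun setT (r : borel X -> borel X) ->
  (forall x : X, finite_set (fibre r x) /\ fibre r x !=set0) ->
  (* mu is a strongly invariant Borel probability measure *)
  strongly_invariant r mu ->
  (* m0 in L^oo(X, mu), normalized, non-singular *)
  Linf mu m0 ->
  (forall x : X,
     ((nfib r x)%:R)^-1 * \sum_(y \in fibre r x) sqn (m0 y) = 1 :> R) ->
  mu [set x | m0 x = 0] = 0%E ->
  (* H = L^2(X_oo, mu_oo), U, pi, phi = 1: the realization on the solenoid *)
  solenoid_measure r m0 mu muinf ->
  let i_ := irreducible_wavelet r m0 mu muinf in
  let ii := ergodic muinf (rinf r) in
  let iii := forall h : X -> R[i],
      Linf mu h -> aeq mu (transfer r m0 h) h -> ae_constant mu h in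
  let iv := ~ exists p : R, 1 < p /\
      exists h : X -> R[i],
        [/\ Lp mu p h, ~ ae_constant mu h, aeq mu (transfer r m0 h) h &
            exists M : R, forall n : nat,
              (\int[mu]_x (sqn (m0n r m0 n x) * cabs (h x) `^ p)%:E
                 <= M%:E)%E] in
  let v := forall phi' : seqspace X -> R[i],
      L2 muinf phi' -> aeq muinf (Uop r m0 phi') (piop m0 phi') ->
      exists c : R[i], aeq muinf phi' (fun=> c) in
  [/\ i_ <-> ii, i_ <-> iii, i_ <-> iv & i_ <-> v].
Proof.
move=> _ _ mr rfin muinv mm0 w1 m0z nuP i_ ii iii iv v.
have mw : measurable_fun setT (fun x : borel X => sqn (m0 x)) by exact: measurable_sqn mm0.1.
have w1' x : Tavg r (fun x : borel X => sqn (m0 x)) x = 1 by exact: w1.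
(* A zero value of [mu] yields an a.e. statement once the set is known to be measurable. *)
have mz : measurable [set x : borel X | m0 x = 0].
  have -> : [set x : borel X | m0 x = 0] = [set x : borel X | sqn (m0 x) <= 0].
    apply/seteqP; split=> x /=; first by move=> ->; rewrite sqn0.
    by move=> le0; apply: sqn_eq0; apply/eqP; rewrite eq_le le0 sqn_ge0.
  exact: measurable_sublevel.
have m0n0 : {ae mu, forall x : borel X, m0 x <> 0} by exact: ae_of_measure0 mz m0z.
have i_ii : i_ -> ii by exact: ergodic_of_irreducible.
have ii_v : ii -> v.
  by move=> erg phi; exact: (ergodic_fixed_const rfin muinv mr mw w1' nuP).
have v_i : v -> i_ by exact: (irreducible_of_fixed_const rfin muinv mr mm0 mw w1' nuP).
have iii_ii : iii -> ii.
  move=> /(bounded_fixed_const_real rfin w1').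
  exact: (ergodic_of_bounded_fixed_const rfin muinv mr mw w1' nuP).
have v_iii : v -> iii.
  move=> hv; apply: (Linf_fixed_const_of_bounded rfin muinv w1') => w h M mh hM Rh.
  by apply: (fixed_const_of_solenoid rfin muinv mr mw w1' nuP mh hM Rh).
have iii_iv : iii -> iv by exact: (no_Lp_fixed_of_Linf rfin muinv mr mm0.1 w1').
have iv_iii : iv -> iii by exact: (Linf_fixed_const_of_Lp rfin muinv mr mm0.1 w1').
(* The cycles i => ii => v => i and v => iii => ii, together with iii <=> iv, connect all five. *)
by split; split; tauto.
Qed.
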